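(* Let $\mathcal{S}$ be a family of dendric return morphisms from $\mathcal{A}^*$ to $\mathcal{A}^*$, fix two distinct letters $a,b\in\mathcal{A}$, and let $X$ be a shift space having an $\mathcal{S}$-adic representation $\boldsymbol\sigma=(\sigma_n)_{n\ge0}$. Then $X$ is the natural coding of a regular interval exchange transformation if and only if $\boldsymbol\sigma$ is primitive and labels an infinite path in the graph $\mathcal{G}_{IET}(\mathcal{S})$. Moreover, if this path starts at the vertex $(\le^L,\le^R)$, then $X$ is the natural coding of a regular interval exchange transformation for the pair of orders with top order $\le^R$ and bottom order $\le^L$.
   Context: Shift spaces, languages, extension sets $E_F^L(w),E_F^R(w),E_F(w)$, extension graphs, dendricity, return morphisms, $\sigma$-initial factors, $\mathcal{L}(\sigma)$, dendric return morphisms, $\mathcal{T}^L(\sigma),\mathcal{T}^R(\sigma)$, $\varphi^L_{\sigma,s},\varphi^R_{\sigma,p}$, multi-cliques, left/right valid triplets, $\mathcal{S}$-adic representations, primitivity and labeled infinite paths are as follows. [A finite alphabet $\mathcal{A}$, $|\mathcal{A}|\ge2$; a shift space is a nonempty closed shift-invariant $X\subseteq\mathcal{A}^{\mathbb{Z}}$; $E^L_F(w)=\{c:cw\in F\}$, $E^R_F(w)=\{c:wc\in F\}$, $E_F(w)=\{(c,d):cwd\in F\}$; a return morphism for $w$ is an injective non-erasing morphism $\sigma$ with $\sigma(c)w$ containing exactly two occurrences of $w$, as proper prefix and proper suffix, for each letter $c$, $w$ being of maximal length if unspecified; $\mathcal{A}^L_{\sigma,s}=\{c:\sigma(c)\in\mathcal{A}^+s\}$,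 $\mathcal{A}^R_{\sigma,p}=\{c:\sigma(c)w\in p\mathcal{A}^+\}$; $\varphi^L_{\sigma,s}(c)$ is the letter $c'$ with $\sigma(c)\in\mathcal{A}^*c's$ and $\varphi^R_{\sigma,p}(c)$ the letter $c'$ with $\sigma(c)w\in pc'\mathcal{A}^*$; $\mathcal{T}^L(\sigma)$ (resp. $\mathcal{T}^R(\sigma)$) is the set of longest common suffixes of $\sigma(c),\sigma(d)$ (resp. longest common prefixes of $\sigma(c)w,\sigma(d)w$) over $c\ne d$; $\mathcal{L}(\sigma)$ is the set of factors of the $\sigma(c)w$ and $\sigma$-initial factors are those without occurrence of $w$; $\sigma$ is dendric if each $\sigma$-initial factor $u$ has $\mathcal{E}_{\mathcal{L}(\sigma)}(u)$ a tree. Multi-clique $G(\{C_1,\dots,C_k\})$: for each $i$ all pairs of distinct elements of $C_i$ joined by an edge of color $c_i$, colors distinct; acyclic for the coloring: every simple cycle is monochromatic; $G^L_{\sigma,s}$, $G^R_{\sigma,p}$ are the subgraphs induced by $\mathcal{A}^L_{\sigma,s}$, $\mathcal{A}^R_{\sigma,p}$; $\sigma^L(G)=G(\{\varphi^L_{\sigma,s}(C_i)\}_{i,s\in\mathcal{T}^L(\sigma)})$, $\sigma^R(G)=G(\{\varphi^R_{\sigma,p}(C_i)\}_{i,p\in\mathcal{T}^R(\sigma)})$; $(G',\sigma,G)$ is left (resp. right) valid if $G$ is a multi-clique acyclic for the coloring and connected, each $G^L_{\sigma,s}$, $s\in\mathcal{T}^L(\sigma)$ (resp. $G^R_{\sigma,p}$,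 $p\in\mathcal{T}^R(\sigma)$) is connected, and $G'=\sigma^L(G)$ (resp. $\sigma^R(G)$) is acyclic for the coloring and connected. $\mathcal{S}$-adic: $X=\{x: \mathcal{L}(x)\subseteq\mathcal{L}^{(0)}(\boldsymbol\sigma)\}$ where $\mathcal{L}^{(n)}(\boldsymbol\sigma)$ is the set of factors of the words $\sigma_n\cdots\sigma_{N-1}(c)$, $N>n$; primitive: for every $n$ there is $N>n$ with every letter occurring in every $\sigma_n\cdots\sigma_{N-1}(c)$.] Interval exchanges: given a pair of total orders on $\mathcal{A}$ with top order $\le_1$ and bottom order $\le_2$, an interval exchange transformation is a partition $\{I_c: c\in\mathcal{A}\}$ of $[0,1)$ into left-closed right-open intervals placed from left to right according to $\le_1$, together with a bijection $T:[0,1)\to[0,1)$ that is a translation on each $I_c$ and such that the images $T(I_c)$ are placed from left to right according to $\le_2$. It is regular if the orbits of the nonzero left endpoints of the $I_c$ are infinite and pairwise disjoint. Its natural coding is the set of $x\in\mathcal{A}^{\mathbb{Z}}$ such that for every factor $u_0\cdots u_{n-1}$ of $x$, $\bigcap_{0\le i<n}T^{-i}(I_{u_i})\ne\emptyset$. Planarity: for total orders $\le^L,\le^R$ on $\mathcal{A}$, a word $w$ of a factorial set $F$ is planar for $(\le^L,\le^R)$ if for all $(c_1,d_1),(c_2,d_2)\in E_F(w)$, $c_1<^L c_2$ implies $d_1\le^R d_2$. A return morphism $\sigma$ is $(\le^L,\le^R)$-planar if all its $\sigma$-initial factors are planar in $\mathcal{L}(\sigma)$ for $(\le^L,\le^R)$.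 A partial map $\varphi$ is order preserving from $\preceq$ to $\le$ if $x\prec y$ implies $\varphi(x)\le\varphi(y)$ for $x,y$ in its domain. $\sigma$ is planar preserving from $(\preceq^L,\preceq^R)$ to $(\le^L,\le^R)$ if every $\varphi^L_{\sigma,s}$, $s\in\mathcal{T}^L(\sigma)$, is order preserving from $\preceq^L$ to $\le^L$ and every $\varphi^R_{\sigma,p}$, $p\in\mathcal{T}^R(\sigma)$, is order preserving from $\preceq^R$ to $\le^R$. For a total order $\le$ with $c_1<\dots<c_n$, $G(\le)$ is the colored tree on $\mathcal{A}$ whose edges are $\{c_i,c_{i+1}\}$, $i<n$, each with its own color; $\le^*$ denotes the reverse order. A pair $(\le^L,\le^R)$ is irreducible if for no $0<k<|\mathcal{A}|$ are the $k$ smallest letters for $\le^L$ the same as the $k$ smallest letters for $\le^R$. The graph $\mathcal{G}_{IET}(\mathcal{S})$ (depending on the fixed letters $a,b$): its vertices are the irreducible pairs $(\le^L,\le^R)$ with $a<^Lb$, and there is an edge from $(\le^L,\le^R)$ to $(\preceq^L,\preceq^R)$ labeled $\sigma\in\mathcal{S}$ if (1) $(G(\le^L),\sigma,G(\preceq^L))$ is left valid; (2) $(G(\le^R),\sigma,G(\preceq^R))$ is right valid; (3) $\sigma$ is $(\le^L,\le^R)$-planar; (4) $\sigma$ is planar preserving from $(\preceq^L,\preceq^R)$ to $(\le^L,\le^R)$ or from $((\preceq^L)^*,(\preceq^R)^* )$ to $(\le^L,\le^R)$. *)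

(* Defs.v *)
From Stdlib Require Import Reals ZArith.
From mathcomp Require Import all_boot.

Set Implicit Arguments.
Unset Strict Implicit.
Unset Printing Implicit Defensive.

Section Words.
Variable A : finType.

Definition morph := A -> seq A.

Definition wimg (s : morph) (u : seq A) : seq A := flatten (map s u).

Definition inj_morph (s : morph) : Prop :=
  forall u v : seq A, wimg s u = wimg s v -> u = v.

Definition occs (w z : seq A) : seq nat :=
  [seq i <- iota 0 (size z - size w).+1 | take (size w) (drop i z) == w].

Definition ret_for (s : morph) (w : seq A) : Prop :=
  inj_morph s /\
  forall c : A, 0 < size (s c) /\ occs w (s c ++ w) = [:: 0; size (s c)].

Definition ret_word (s : morph) (w : seq A) : Prop :=
  ret_for s w /\ forall w', ret_for s w' -> size w' <= size w.

Definition Lsig (s : morph) (w : seq A) (u : seq A) : bool :=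
  has (fun c => infix u (s c ++ w)) (enum A).

Definition sig_initial (s : morph) (w u : seq A) : bool :=
  Lsig s w u && ~~ infix w u.

Section SimpleGraph.
Variable V : finType.
Definition connected_on (P : {set V}) (e : rel V) : Prop :=
  forall x y, x \in P -> y \in P ->
    connect (fun u v => [&& u \in P, v \in P & e u v]) x y.
Definition sacyclic (e : rel V) : Prop :=
  forall p : seq V, uniq p -> 2 < size p -> ~~ cycle e p.
Definition is_tree (P : {set V}) (e : rel V) : Prop :=
  P != set0 /\ connected_on P e /\
  sacyclic (fun u v => [&& u \in P, v \in P & e u v]).
End SimpleGraph.

Section Ext.
Variable F : pred (seq A).
Definition EL (u : seq A) : {set A} := [set c | F (c :: u)].
Definition ER (u : seq A) : {set A} := [set d | F (rcons u d)].
Definition Eb (u : seq A) (c d : A) : bool := F (c :: rcons u d).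
Definition ext_vertices (u : seq A) : {set A + A} :=
  [set x | match x with inl c => c \in EL u | inr d => d \in ER u end].
Definition ext_edge (u : seq A) : rel (A + A) :=
  fun x y => match x, y with
             | inl c, inr d => Eb u c d
             | inr d, inl c => Eb u c d
             | _, _ => false end.
Definition ext_tree (u : seq A) : Prop := is_tree (ext_vertices u) (ext_edge u).
End Ext.

Definition dendric (s : morph) (w : seq A) : Prop :=
  forall u, sig_initial s w u -> ext_tree (Lsig s w) u.
Definition dendric_return (s : morph) : Prop :=
  exists w, ret_word s w /\ dendric s w.

Fixpoint lcp (u v : seq A) : seq A :=
  match u, v with
  | x :: u', y :: v' => if x == y then x :: lcp u' v' else [::]
  | _, _ => [::]
  end.
Definition lcs (u v : seq A) : seq A := rev (lcp (rev u) (rev v)).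

Definition TL (s : morph) : seq (seq A) :=
  undup (flatten [seq [seq lcs (s c) (s d) | d <- enum A & d != c] | c <- enum A]).
Definition TR (s : morph) (w : seq A) : seq (seq A) :=
  undup (flatten [seq [seq lcp (s c ++ w) (s d ++ w) | d <- enum A & d != c]
                 | c <- enum A]).

Definition AL (s : morph) (x : seq A) : {set A} :=
  [set c | (size x < size (s c)) && suffix x (s c)].
Definition AR (s : morph) (w p : seq A) : {set A} :=
  [set c | (size p < size (s c ++ w)) && prefix p (s c ++ w)].
(* phi^L_{s,x}(c) = c' with s(c) in A^* c' x (meaningful on AL s x) *)
Definition phiL (s : morph) (x : seq A) (c : A) : A :=
  nth c (s c) (size (s c) - size x).-1.
(* phi^R_{s,p}(c) = c' with s(c)w in p c' A^* (meaningful on AR s w p) *)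
Definition phiR (s : morph) (w p : seq A) (c : A) : A :=
  nth c (s c ++ w) (size p).

(* a multi-clique G({C_1,...,C_k}) is given by the list of its cliques;
   the clique at position i has its own color i *)


Definition cstep (G : seq {set A}) : rel (A * nat) :=
  fun p q => [&& p.1 != q.1, p.1 \in nth set0 G p.2 & q.1 \in nth set0 G p.2].

(* acyclic for the coloring: every simple cycle (distinct vertices, distinct
   edges) is monochromatic.  A cycle is a list of (vertex, color of the edge
   leaving it); two-vertex cycles with two different colors (parallel edges)
   are non-monochromatic simple cycles. *)
Definition acyclic_col (G : seq {set A}) : Prop :=
  forall p : seq (A * nat),
    uniq (map fst p) -> 1 < size p -> cycle (cstep G) p -> constant (map snd p).

Definition mc_adj (G : seq {set A}) : rel A :=
  fun x y => (x != y) && has (fun C : {set A} => (x \in C) && (y \in C)) G.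

Definition mc_connected_on (G : seq {set A}) (P : {set A}) : Prop :=
  connected_on P (mc_adj G).

(* equality of multi-cliques as colored graphs (up to renaming colors):
   same multiset of cliques having at least one edge *)
Definition mc_eq (G1 G2 : seq {set A}) : Prop :=
  perm_eq [seq C <- G1 | 1 < #|pred_of_set C|] [seq C <- G2 | 1 < #|pred_of_set C|].

Definition sigL (s : morph) (G : seq {set A}) : seq {set A} :=
  flatten [seq [seq [set phiL s x c | c in C :&: AL s x] | x <- TL s] | C <- G].
Definition sigR (s : morph) (w : seq A) (G : seq {set A}) : seq {set A} :=
  flatten [seq [seq [set phiR s w p c | c in C :&: AR s w p] | p <- TR s w] | C <- G].

Definition left_valid (G' : seq {set A}) (s : morph) (G : seq {set A}) : Prop :=
  acyclic_col G /\ mc_connected_on G setT /\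
  (forall x, x \in TL s -> mc_connected_on G (AL s x)) /\
  mc_eq G' (sigL s G) /\ acyclic_col (sigL s G) /\ mc_connected_on (sigL s G) setT.

Definition right_valid (w : seq A) (G' : seq {set A}) (s : morph) (G : seq {set A}) : Prop :=
  acyclic_col G /\ mc_connected_on G setT /\
  (forall p, p \in TR s w -> mc_connected_on G (AR s w p)) /\
  mc_eq G' (sigR s w G) /\ acyclic_col (sigR s w G) /\ mc_connected_on (sigR s w G) setT.

Definition total_order (le : rel A) : Prop :=
  (forall x, le x x) /\ (forall x y, le x y -> le y x -> x = y) /\
  (forall x y z, le x y -> le y z -> le x z) /\ (forall x y, le x y || le y x).
Definition ltr (le : rel A) : rel A := fun x y => le x y && (x != y).
Definition rev_order (le : rel A) : rel A := fun x y => le y x.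

Definition consecutive (le : rel A) (c d : A) : bool :=
  ltr le c d && [forall e, ~~ (ltr le c e && ltr le e d)].
Definition Gord (le : rel A) : seq {set A} :=
  flatten [seq [seq [set c; d] | d <- enum A & consecutive le c d] | c <- enum A].

Definition ksmallest (le : rel A) (k : nat) : {set A} :=
  [set c | #|[set d | ltr le d c]| < k].
Definition irreducible (leL leR : rel A) : Prop :=
  forall k, 0 < k < #|A| -> ksmallest leL k != ksmallest leR k.

Definition planar_word (F : pred (seq A)) (leL leR : rel A) (u : seq A) : Prop :=
  forall c1 d1 c2 d2, Eb F u c1 d1 -> Eb F u c2 d2 -> ltr leL c1 c2 -> leR d1 d2.
Definition planar_morph (s : morph) (w : seq A) (leL leR : rel A) : Prop :=
  forall u, sig_initial s w u -> planar_word (Lsig s w) leL leR u.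
Definition order_pres (D : {set A}) (phi : A -> A) (pre le : rel A) : Prop :=
  forall x y, x \in D -> y \in D -> ltr pre x y -> le (phi x) (phi y).
Definition planar_pres (s : morph) (w : seq A) (pL pR leL leR : rel A) : Prop :=
  (forall x, x \in TL s -> order_pres (AL s x) (phiL s x) pL leL) /\
  (forall p, p \in TR s w -> order_pres (AR s w p) (phiR s w p) pR leR).

Definition vertex := (rel A * rel A)%type.

Definition iet_vertex (a b : A) (v : vertex) : Prop :=
  total_order v.1 /\ total_order v.2 /\ irreducible v.1 v.2 /\ ltr v.1 a b.

Definition iet_edge (S : morph -> Prop) (v : vertex) (s : morph) (v' : vertex) : Prop :=
  S s /\ exists w, ret_word s w /\
    left_valid (Gord v.1) s (Gord v'.1) /\
    right_valid w (Gord v.2) s (Gord v'.2) /\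
    planar_morph s w v.1 v.2 /\
    (planar_pres s w v'.1 v'.2 v.1 v.2 \/
     planar_pres s w (rev_order v'.1) (rev_order v'.2) v.1 v.2).

Definition labels_path (a b : A) (S : morph -> Prop) (sg : nat -> morph)
    (v : nat -> vertex) : Prop :=
  forall n, iet_vertex a b (v n) /\ iet_edge S (v n) (sg n) (v n.+1).

Fixpoint compw (sg : nat -> morph) (n k : nat) (u : seq A) : seq A :=
  match k with
  | 0 => u
  | k'.+1 => wimg (sg n) (compw sg n.+1 k' u)
  end.

Definition Ln (sg : nat -> morph) (n : nat) (u : seq A) : Prop :=
  exists N c, n < N /\ infix u (compw sg n (N - n) [:: c]).

Definition primitive_seq (sg : nat -> morph) : Prop :=
  forall n, exists N, n < N /\ forall c d : A, d \in compw sg n (N - n) [:: c].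

Definition biseq := Z -> A.
Definition shift (x : biseq) : biseq := fun i => x (Z.add i 1%Z).
Definition factor (x : biseq) (u : seq A) : Prop :=
  exists i : Z, u = [seq x (Z.add i (Z.of_nat k)) | k <- iota 0 (size u)].

Definition shift_space (X : biseq -> Prop) : Prop :=
  (exists x, X x) /\
  (forall x, X x <-> X (shift x)) /\
  (* closed for the product topology *)
  (forall x, (forall n : nat, exists y, X y /\
                forall i : Z, (Z.abs i <= Z.of_nat n)%Z -> y i = x i) -> X x).

Definition S_adic_rep (S : morph -> Prop) (X : biseq -> Prop) (sg : nat -> morph) : Prop :=
  (forall n, S (sg n)) /\
  forall x, X x <-> (forall u, factor x u -> Ln sg 0 u).

Definition rsum (l : A -> R) (s : seq A) : R := foldr (fun c r => Rplus (l c) r) R0 s.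

Section IET.
Variables (le1 le2 : rel A) (lam : A -> R).
(* left endpoint of I_c (intervals placed according to le1) *)
Definition lend (c : A) : R := rsum lam [seq d <- enum A | ltr le1 d c].
(* left endpoint of T(I_c) (images placed according to le2) *)
Definition iend (c : A) : R := rsum lam [seq d <- enum A | ltr le2 d c].
Definition inI (c : A) (x : R) : Prop := Rle (lend c) x /\ Rlt x (Rplus (lend c) (lam c)).
Definition inIb (c : A) (x : R) : bool :=
  if Rle_dec (lend c) x then (if Rlt_dec x (Rplus (lend c) (lam c)) then true else false)
  else false.
Definition Tiet (x : R) : R :=
  match [pick c | inIb c x] with
  | Some c => Rplus x (Rminus (iend c) (lend c))
  | None => x
  end.

Definition is_IET : Prop :=
  total_order le1 /\ total_order le2 /\ (forall c, Rlt R0 (lam c)) /\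
  rsum lam (enum A) = R1.

Definition orbit (y z : R) : Prop :=
  exists n : nat, iter n Tiet y = z \/ iter n Tiet z = y.

Definition regular_IET : Prop :=
  (forall c, lend c <> R0 -> forall l : seq R, exists z, orbit (lend c) z /\ ~ List.In z l) /\
  (forall c d, lend c <> R0 -> lend d <> R0 -> c <> d ->
     forall z, orbit (lend c) z -> orbit (lend d) z -> False).

Fixpoint codes (t : R) (u : seq A) : Prop :=
  match u with
  | [::] => True
  | c :: u' => inI c t /\ codes (Tiet t) u'
  end.

Definition natural_coding (X : biseq -> Prop) : Prop :=
  forall x, X x <-> (forall u, factor x u ->
     exists t, Rle R0 t /\ Rlt t R1 /\ codes t u).
End IET.

(* X is the natural coding of a regular IET with top order le1, bottom le2 *)
Definition coding_regular_IET_for (X : biseq -> Prop) (le1 le2 : rel A) : Prop :=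
  exists lam : A -> R, is_IET le1 le2 lam /\ regular_IET le1 le2 lam /\
                       natural_coding le1 le2 lam X.

Definition coding_regular_IET (X : biseq -> Prop) : Prop :=
  exists le1 le2 : rel A, coding_regular_IET_for X le1 le2.

End Words.

(* Main.v *)
From HB Require Import structures.
Require Import Defs.
From Stdlib Require Import Reals ZArith Classical IndefiniteDescription Lra Lia.
From Stdlib Require FinFun.
From mathcomp Require Import all_boot zify.
From mathcomp Require filter.

Set Implicit Arguments.
Unset Strict Implicit.
Unset Printing Implicit Defensive.

(** A language that is factorial, biextendable, recurrent word by word, planar for (leL, leR)
    and such that leL-consecutive left extensions of a word always share a right extension is
    called [good]; this is the combinatorial form of "language of a regular interval exchange".

    From an interval exchange to a path.  The language of a regular interval exchange is good:
    a failure of the sharing condition is a connection, and recurrence is Poincare recurrence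
    for the length.  Since its extension graphs are connected and those of the dendric
    morphism are trees, the two coincide on initial factors, so every block s(c)w occurs in the
    language, and L1 = {v : s(v)w in L} is again good, for the orders obtained by comparing the
    codes rev (s c) and s(c)w lexicographically.  Every consecutive pair for leL is separated
    by arbitrarily long words, hence comes from a consecutive pair of the new order; as both
    orders have |A| - 1 consecutive pairs this is a bijection, which is the equality of
    multi-cliques required by validity.  A good language is uniformly recurrent, and comparing
    the periods of the return words with the right special words yields primitivity.

    From a path to an interval exchange.  Planarity and the existence of long words separating
    consecutive letters climb up the path.  A limit of word frequencies along an ultrafilter
    gives an invariant weight mu, positive exactly on the language; the lengths mu [c] define
    the interval exchange.  By planarity the words c u are sorted alike by (c, u) and by (u, c),
    so T maps the interval of c u into that of u, and the coding follows.  Regularity holds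
    because the left endpoint of an image interval lies in the interior of the interval of
    every long word separating the two adjacent letters. *)

(** * Total orders and their coloured path graphs *)

(** A return word may be empty. The morphism then maps letters to letters, and passing to the next
    level shortens nothing. Words of unbounded length exclude a tail of such levels, so on the way
    back inductions on length are paired with an induction on the distance to the next nonempty
    return word.

    Goodness is chosen so as to pass down one level. Connectedness is asked along [leL] only;
    convexity of extension sets and connectedness along [leR] follow from planarity. Recurrence is
    asked word by word, and its uniform form is deduced at each level from a minimality property: a
    biextendable factorial sublanguage containing the empty word is the whole language.

    Reversing both orders preserves goodness and the path graphs. This allows each vertex to be
    normalized by the position of [a] and [b], and it is the origin of the two alternatives in
    condition (4) on edges.

    In the converse direction any invariant weight that is positive exactly on the language will do.
    Along an ultrafilter all word frequencies converge at once, and primitivity bounds them away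
    from zero. *)

Section TotalOrders.
Variable A : finType.
Implicit Types (le : rel A) (c d e : A).

Lemma ltrW le c d : ltr le c d -> le c d.
Proof. by case/andP. Qed.

Lemma ltr_neq le c d : ltr le c d -> c != d.
Proof. by case/andP. Qed.

Lemma ltrr le c : ltr le c c = false.
Proof. by rewrite /ltr eqxx andbF. Qed.

Lemma ler_refl le c : total_order le -> le c c.
Proof. by case. Qed.

Lemma ler_anti le c d : total_order le -> le c d -> le d c -> c = d.
Proof. by case=> _ [h _]; apply: h. Qed.

Lemma ler_trans le d c e : total_order le -> le c d -> le d e -> le c e.
Proof. by case=> _ [_ [h _]]; apply: h. Qed.

Lemma ltrNge le c d : total_order le -> ltr le c d = ~~ le d c.
Proof.
move=> H; apply/idP/idP.
  case/andP=> h1 h2; apply/negP=> h3; move/negP: h2; apply; apply/eqP.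
  exact: ler_anti H h1 h3.
case: (H) => hr [_ [_ ht]] h; rewrite /ltr.
have := ht d c; rewrite (negbTE h) /= => ->.
by apply: contraNneq h => ->.
Qed.

Lemma lerNgt le c d : total_order le -> le c d = ~~ ltr le d c.
Proof. by move=> H; rewrite ltrNge // negbK. Qed.

Lemma ler_lt_trans le d c e : total_order le -> le c d -> ltr le d e -> ltr le c e.
Proof.
move=> H h1; rewrite !ltrNge // => h2; apply: contra h2 => h3.
exact: ler_trans H h3 h1.
Qed.

Lemma ltr_le_trans le d c e : total_order le -> ltr le c d -> le d e -> ltr le c e.
Proof.
move=> H h1 h2; move: h1; rewrite !ltrNge // => h1; apply: contra h1 => h3.
exact: ler_trans H h2 h3.
Qed.

Lemma ltr_trans le d c e : total_order le -> ltr le c d -> ltr le d e -> ltr le c e.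
Proof. by move=> H h1 /ltrW; apply: ltr_le_trans. Qed.

Lemma ltr_asym le c d : total_order le -> ltr le c d -> ltr le d c -> False.
Proof. by move=> H h1 h2; have := ltr_trans H h1 h2; rewrite ltrr. Qed.

Lemma ltr_total le c d : total_order le -> c != d -> ltr le c d \/ ltr le d c.
Proof.
move=> H ne; case E : (le c d); first by left; rewrite /ltr E.
by right; rewrite ltrNge // E.
Qed.

Lemma ler_eqVlt le c d : total_order le -> le c d -> c = d \/ ltr le c d.
Proof. by move=> H h; case: (eqVneq c d) => [|ne]; [left | right; rewrite /ltr h]. Qed.

Lemma consecutive_lt le c d : consecutive le c d -> ltr le c d.
Proof. by case/andP. Qed.

Lemma consecutive_le le c d e : total_order le -> consecutive le c d ->
  ltr le c e -> le d e.
Proof.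
move=> H /andP[_ /forallP h] h1; have := h e; rewrite h1 /= => h2.
by rewrite lerNgt.
Qed.

Lemma consecutive_ge le c d e : total_order le -> consecutive le c d ->
  ltr le e d -> le e c.
Proof.
move=> H /andP[_ /forallP h] h1; have := h e; rewrite h1 andbT => h2.
by rewrite lerNgt.
Qed.

Lemma succ_exists le c d : total_order le -> ltr le c d ->
  exists2 s, consecutive le c s & le s d.
Proof.
move=> H hd.
pose m (x : A) := #|[set y | ltr le y x]|.
case: (@arg_minnP _ d (fun x => ltr le c x) m hd) => s hs hmin.
have hle x : ltr le c x -> le s x.
  move=> hx; rewrite lerNgt //; apply/negP => hxs.
  have := hmin _ hx; rewrite leqNgt => /negP; apply.
  apply: proper_card; apply/properP; split.
    by apply/subsetP=> y; rewrite !inE => hy; exact: ltr_trans H hy hxs.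
  by exists x; rewrite !inE // ltrr.
exists s; last exact: hle.
rewrite /consecutive hs /=; apply/forallP=> e; apply/negP=> /andP[h1 h2].
by have := hle _ h1; rewrite lerNgt // h2.
Qed.

(** Serves as a discrete intermediate value principle: a property that differs at [a] and [b] must
    change across some consecutive pair between them. *)
Lemma consecutive_ind le (P : A -> A -> Prop) a b : total_order le ->
  (forall x, P x x) -> (forall y x z, P x y -> P y z -> P x z) ->
  (forall x y, le a x -> le y b -> consecutive le x y -> P x y) ->
  le a b -> P a b.
Proof.
move=> H Pr Pt.
have [n] := ubnP #|[set y | ltr le a y && le y b]|.
elim: n a => // n IH a hn Pc hab.
case: (ler_eqVlt H hab) => [->|hlt]; first exact: Pr.
have [s hs hsb] := succ_exists H hlt.
have has := consecutive_lt hs.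
apply: (Pt s); first by apply: Pc => //; apply: ler_refl.
apply: IH => //.
  move: hn; rewrite ltnS; apply: leq_trans; apply: proper_card; apply/properP; split.
    apply/subsetP=> y; rewrite !inE => /andP[h1 ->]; rewrite andbT.
    exact: ltr_trans H has h1.
  by exists s; rewrite !inE ?ltrr // has.
by move=> x y h; apply: Pc; apply: ler_trans H _ h; apply: ltrW.
Qed.

Lemma min_exists le (x : A) : total_order le -> exists c, forall d, le c d.
Proof.
move=> H; pose m (x : A) := #|[set y | ltr le y x]|.
case: (@arg_minnP _ x predT m isT) => c _ hmin; exists c => d.
rewrite lerNgt //; apply/negP => h; have := hmin d isT; rewrite leqNgt => /negP.
apply; apply: proper_card; apply/properP; split.
  by apply/subsetP=> y; rewrite !inE => hy; exact: ltr_trans H hy h.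
by exists d; rewrite !inE // ltrr.
Qed.

Lemma rev_order_total le : total_order le -> total_order (rev_order le).
Proof.
case=> h1 [h2 [h3 h4]]; split; [exact: h1 | split; [|split]].
- by move=> x y a b; apply: h2.
- by move=> x y z a b; apply: h3 b a.
- by move=> x y; rewrite /rev_order orbC.
Qed.

Lemma ltr_rev le c d : ltr (rev_order le) c d = ltr le d c.
Proof. by rewrite /ltr /rev_order eq_sym. Qed.

Lemma consecutive_rev le c d : consecutive (rev_order le) c d = consecutive le d c.
Proof.
rewrite /consecutive (ltr_rev le); congr andb; apply: eq_forallb => e.
by rewrite !(ltr_rev le) andbC.
Qed.

Lemma max_exists le (x : A) : total_order le -> exists c, forall d, le d c.
Proof.
move=> H; have [c hc] := min_exists x (rev_order_total H).
by exists c => d; apply: hc.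
Qed.

Lemma pred_exists le c d : total_order le -> ltr le c d ->
  exists2 s, consecutive le s d & le c s.
Proof.
move=> H h; have H' := rev_order_total H.
have [|s h1 h2] := @succ_exists (rev_order le) d c H'; first by rewrite (ltr_rev le).
by exists s => //; rewrite -(consecutive_rev le).
Qed.

Lemma consecutive_inj le c d d' : total_order le ->
  consecutive le c d -> consecutive le c d' -> d = d'.
Proof.
move=> H h h'; apply: (ler_anti H).
  exact: consecutive_le H h (consecutive_lt h').
exact: consecutive_le H h' (consecutive_lt h).
Qed.

Lemma consecutive_injr le c c' d : total_order le ->
  consecutive le c d -> consecutive le c' d -> c = c'.
Proof.
move=> H h h'; apply: (ler_anti H).
  exact: consecutive_ge H h' (consecutive_lt h).
exact: consecutive_ge H h (consecutive_lt h').
Qed.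

Lemma mem_Gord le (C : {set A}) :
  reflect (exists c d, consecutive le c d /\ C = [set c; d]) (C \in Gord le).
Proof.
apply: (iffP flattenP) => [[s /mapP[c hc ->] /mapP[d]]|[c [d [h ->]]]].
  by rewrite mem_filter => /andP[h _] ->; exists c, d.
exists [seq [set c; d0] | d0 <- enum A & consecutive le c d0].
  by apply/mapP; exists c; rewrite ?mem_enum.
by apply/mapP; exists d; rewrite // mem_filter h mem_enum.
Qed.

Lemma consecutive_neq le c d : consecutive le c d -> c != d.
Proof. by move/consecutive_lt/ltr_neq. Qed.

Lemma consecutive_set_inj le c d c' d' : total_order le ->
  consecutive le c d -> consecutive le c' d' -> [set c; d] = [set c'; d'] ->
  c = c' /\ d = d'.
Proof.
move=> H h h' /setP E.
have := E c'; rewrite !inE eqxx /= => /orP[/eqP hc|/eqP hc].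
  by split=> //; apply: (consecutive_inj H h); rewrite -hc.
have := E d'; rewrite !inE eqxx orbT => /orP[/eqP hd|/eqP hd].
  subst; case: (ltr_asym H (consecutive_lt h)); exact: consecutive_lt.
by move: (consecutive_neq h'); rewrite hc hd eqxx.
Qed.

Lemma card_set2_gt1 c d : (1 < #|[set c; d]|) = (c != d).
Proof. by rewrite cards2; case: (c != d). Qed.

Lemma Gord_card le C : C \in Gord le -> 1 < #|C|.
Proof. by case/mem_Gord=> c [d [h ->]]; rewrite card_set2_gt1 (consecutive_neq h). Qed.

Lemma filter_Gord le : [seq C <- Gord le | 1 < #|pred_of_set C|] = Gord le.
Proof. by apply/all_filterP/allP=> C; apply: Gord_card. Qed.

Lemma filter_consecutive le c : total_order le ->
  [seq d <- enum A | consecutive le c d] =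
  if [pick d | consecutive le c d] is Some d then [:: d] else [::].
Proof.
move=> H; case: pickP => [d hd|h0].
  rewrite (@eq_filter _ _ (pred1 d)) ?filter_pred1_uniq ?enum_uniq ?mem_enum //.
  move=> x /=; apply/idP/eqP => [hx|->//].
  exact: consecutive_inj H hx hd.
by rewrite (@eq_filter _ _ pred0) ?filter_pred0.
Qed.

Lemma uniq_Gord le : total_order le -> uniq (Gord le).
Proof.
move=> H; rewrite /Gord.
have: uniq (enum A) by apply: enum_uniq.
elim: {1 3}(enum A) => //= c s IH /andP[hc hs].
rewrite cat_uniq IH // andbT; apply/andP; split.
  rewrite map_inj_in_uniq; first by rewrite filter_uniq // enum_uniq.
  move=> x y; rewrite !mem_filter => /andP[h1 _] /andP[h2 _] E.
  exact: consecutive_inj H h1 h2.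
apply/hasPn=> C /flattenP[t /mapP[c' hc' ->] /mapP[d']].
rewrite mem_filter => /andP[h' _] ->; apply/negP=> /mapP[d].
rewrite mem_filter => /andP[h _] /esym E.
case: (consecutive_set_inj H h h' E) => Ec _.
by move: hc; rewrite Ec hc'.
Qed.

Lemma size_flatten_map_pred (T I B : Type) (f : I -> B -> T) (F : I -> seq B)
  (P : pred I) (s : seq I) : (forall i, size (F i) = P i) ->
  size (flatten [seq [seq f i j | j <- F i] | i <- s]) = count P s.
Proof.
by move=> h; elim: s => //= i s IH; rewrite size_cat IH size_map h.
Qed.

Lemma size_Gord le : total_order le -> size (Gord le) = #|A|.-1.
Proof.
move=> H; rewrite /Gord.
rewrite (@size_flatten_map_pred _ _ _ _ _ (fun c => [exists d, consecutive le c d])); last first.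
  move=> c; rewrite filter_consecutive //; case: pickP => [d hd|h0] /=.
    by case: existsP => // -[]; exists d.
  by case: existsP => // -[d]; rewrite h0.
rewrite -size_filter cardE; case E : (enum A) => [//|x t]; rewrite -E.
have [m hm] := max_exists x H.
(* Exactly the greatest letter lacks a successor. *)
have -> : [seq c <- enum A | [exists d, consecutive le c d]] = rem m (enum A).
  rewrite rem_filter ?enum_uniq //; apply: eq_filter => c /=.
  apply/existsP/idP => [[d hd]|hc].
    apply: contraTneq (consecutive_lt hd) => ->.
    by rewrite -lerNgt.
  have : ltr le c m by rewrite /ltr hm.
  by case/(succ_exists H) => d hd _; exists d.
by rewrite size_rem ?mem_enum.
Qed.

Lemma Gord_rev_perm le : total_order le -> perm_eq (Gord le) (Gord (rev_order le)).
Proof.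
move=> H; apply: uniq_perm; rewrite ?uniq_Gord //; first exact: rev_order_total.
move=> C; apply/mem_Gord/mem_Gord => -[c [d [h ->]]]; exists d, c.
  by rewrite (consecutive_rev le) setUC.
by rewrite -(consecutive_rev le) setUC.
Qed.

Lemma mc_eq_refl (G : seq {set A}) : mc_eq G G.
Proof. exact: perm_refl. Qed.

(** Positions are colors: when the nontrivial cliques are distinct, such a clique determines its
    color. This settles cycles with two vertices. *)
Lemma nth_filter_uniq (T : eqType) (P : pred T) x0 (s : seq T) i j :
  uniq (filter P s) -> i < size s -> j < size s ->
  P (nth x0 s i) -> nth x0 s i = nth x0 s j -> i = j.
Proof.
elim: s i j => // a s IH [|i] [|j] //= hu hi hj hP E.
- move: hu; rewrite hP /= E => /andP[/negP[]].
  by rewrite mem_filter mem_nth // andbT -E.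
- move: hu; rewrite -E hP /= => /andP[/negP[]].
  by rewrite mem_filter mem_nth // andbT.
- congr S; apply: IH => //.
  by move: hu; case: ifP => // _ /andP[].
Qed.

(** * Multi-cliques that agree with a path graph *)

Section MultiClique.
Variables (le : rel A) (G : seq {set A}).
Hypothesis Hle : total_order le.
Hypothesis HG : mc_eq (Gord le) G.

Let HG' : perm_eq (Gord le) [seq C <- G | 1 < #|pred_of_set C|].
Proof. by move: HG; rewrite /mc_eq filter_Gord. Qed.

Lemma mc_eq_mem x y k : x != y -> x \in nth set0 G k -> y \in nth set0 G k ->
  [/\ k < size G, nth set0 G k = [set x; y] & consecutive le x y \/ consecutive le y x].
Proof.
move=> ne hx hy.
have hk : k < size G.
  by rewrite ltnNge; apply/negP => h; move: hx; rewrite nth_default // inE.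
have hC : 1 < #|nth set0 G k| by apply/card_gt1P; exists x, y.
have : nth set0 G k \in Gord le by rewrite (perm_mem HG') mem_filter hC mem_nth.
case/mem_Gord => c [d [hcd E]]; rewrite E in hx hy *; split=> //.
  move: hx hy ne; rewrite !inE => /orP[]/eqP-> /orP[]/eqP->; rewrite ?eqxx //.
  by rewrite setUC.
by move: hx hy ne; rewrite !inE => /orP[]/eqP-> /orP[]/eqP->; rewrite ?eqxx //; auto.
Qed.

(** Rotate a cycle so that it starts at its greatest vertex. Both neighbours of that vertex are its
    predecessor in the order, so the cycle has two vertices and uses one clique twice. *)
Lemma mc_eq_acyclic : acyclic_col G.
Proof.
move=> p hu hs hc.
have [z hz hmax] : exists2 z, z \in p & forall t, t \in p -> le t.1 z.1.
  have hs0 : 0 < size p by apply: ltnW.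
  elim: p hs0 {hs hu hc} => // z p IH _; case: p IH => [_|y p /(_ isT)[t ht hm]].
    by exists z; rewrite ?mem_head // => t; rewrite inE => /eqP->; apply: ler_refl.
  case E: (le z.1 t.1).
    exists t; first by rewrite inE ht orbT.
    by move=> u; rewrite inE => /orP[/eqP->|/hm].
  have h2 : le t.1 z.1 by rewrite lerNgt // /ltr E.
  exists z; first exact: mem_head.
  move=> u; rewrite inE => /orP[/eqP->|/hm h3]; first exact: ler_refl.
  exact: ler_trans Hle h3 h2.
case/rot_to: hz => i q E.
have hu' : uniq (map fst (z :: q)) by rewrite -E map_rot rot_uniq.
have hc' : cycle (cstep G) (z :: q) by rewrite -E rot_cycle.
have hm' t : t \in z :: q -> le t.1 z.1 by rewrite -E mem_rot; apply: hmax.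
have {hs}hs' : 1 < size (z :: q) by rewrite -E size_rot.
suff : constant (map snd (z :: q)).
  rewrite -E map_rot; move: (map snd p) => s.
  case/(constantP z.2) => x Ex; case: s Ex => // a s Ex.
  apply/(constantP z.2); exists x; apply: (@rot_inj i).
  have -> : rot i (nseq (size (a :: s)) x) = nseq (size (a :: s)) x.
    apply: (@eq_from_nth _ x); rewrite size_rot // => j hj.
    have : nth x (rot i (nseq (size (a :: s)) x)) j \in nseq (size (a :: s)) x.
      by rewrite -(mem_rot i) mem_nth // size_rot.
    by rewrite mem_nseq => /andP[_ /eqP->]; rewrite nth_nseq; case: ifP.
  by rewrite Ex size_rot.
case: q {E} hu' hc' hm' hs' => // y q hu' hc' hm' _.
case: q hu' hc' hm' => [|t q] hu' hc' hm'.
  move: hc' => /= /and3P[/and3P[ne h1 h2] /and3P[_ h3 h4] _].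
  have [k1 E1 _] := mc_eq_mem ne h1 h2.
  have [k2 E2 _] := mc_eq_mem ne h4 h3.
  rewrite andbT; apply/eqP; apply: (@nth_filter_uniq _ (fun C : {set A} => 1 < #|C|) set0 G) => //.
  - by rewrite -(perm_uniq HG') uniq_Gord.
  - by rewrite E2 card_set2_gt1.
  - by rewrite E2 E1.
move: hc'; rewrite /cycle rcons_path => /andP[/= /andP[/and3P[ne1 h1 h2] _] /and3P[ne2 h3 h4]].
set l := last t q in ne2 h3 h4.
have hl : l \in t :: q by apply: mem_last.
have [_ _ c1] := mc_eq_mem ne1 h1 h2.
have [_ _ c2] := mc_eq_mem ne2 h3 h4.
have hy : le y.1 z.1 by apply: hm'; rewrite !inE eqxx orbT.
have hl' : le l.1 z.1 by apply: hm'; rewrite 2!inE hl !orbT.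
have {}c1 : consecutive le y.1 z.1.
  by case: c1 => // /consecutive_lt; rewrite ltrNge // hy.
have {}c2 : consecutive le l.1 z.1.
  by case: c2 => // /consecutive_lt; rewrite ltrNge // hl'.
have E := consecutive_injr Hle c1 c2.
move: hu' => /= /and3P[_ /negP[]]; rewrite E.
by have := map_f fst hl; rewrite /= => ->.
Qed.

(** An order-convex set contains every consecutive pair met between two of its elements. *)
Lemma mc_eq_connected (P : {set A}) :
  (forall x y z, x \in P -> z \in P -> le x y -> le y z -> y \in P) ->
  mc_connected_on G P.
Proof.
move=> hconv.
have esym : connect_sym (fun u v => [&& u \in P, v \in P & mc_adj G u v]).
  apply: sym_connect_sym => u v; rewrite /mc_adj eq_sym andbCA.
  by congr [&& _, _, _ & _]; apply: eq_has => C; rewrite andbC.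
suff main x y : x \in P -> y \in P -> le x y ->
   connect (fun u v => [&& u \in P, v \in P & mc_adj G u v]) x y.
  move=> x y hx hy; case E: (le x y); first exact: main.
  by rewrite esym; apply: main => //; rewrite lerNgt // /ltr E.
move=> hx hy.
apply: (@consecutive_ind le (fun a b => connect (fun u v => [&& u \in P, v \in P & mc_adj G u v]) a b) x y Hle) => //.
  by move=> v u w; apply: connect_trans.
move=> u v hu hv c; apply: connect1.
have huv := ltrW (consecutive_lt c).
have hu' : u \in P by apply: (hconv x u y) => //; apply: ler_trans huv hv.
have hv' : v \in P by apply: (hconv x v y) => //; apply: ler_trans hu huv.
rewrite hu' hv' /mc_adj (consecutive_neq c) /=.
apply/hasP; exists [set u; v]; last by rewrite !inE !eqxx orbT.
have : [set u; v] \in Gord le by apply/mem_Gord; exists u, v.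
by rewrite (perm_mem HG') mem_filter => /andP[].
Qed.
End MultiClique.
End TotalOrders.

(** * Return morphisms and desubstitution *)

Ltac slia := simpl Equality.sort in *; lia.

(** * First and last occurrences of a word *)

Section Words.
Variable A : finType.
Implicit Types (u v w x y p q : seq A).

Lemma cat_split u x v y : u ++ x = v ++ y -> size u <= size v ->
  exists2 p, v = u ++ p & x = p ++ y.
Proof.
move=> E h; exists (drop (size u) v).
  have /(congr1 (take (size u))) := E; rewrite take_size_cat // take_cat.
  case: ltnP => [h1 {1}->|h1]; first by rewrite cat_take_drop.
  have e : size u = size v by apply/eqP; rewrite eqn_leq h h1.
  by rewrite e subnn take0 drop_size cats0 => <-; rewrite cats0.
have /(congr1 (drop (size u))) := E; rewrite drop_size_cat // drop_cat => ->.
case: ltnP => // h1; have e : size u = size v by apply/eqP; rewrite eqn_leq h h1.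
by rewrite e subnn drop0 drop_size.
Qed.

Lemma cat_cancel u x y : u ++ x = u ++ y -> x = y.
Proof. by elim: u => //= a u IH []. Qed.

Lemma cat_cancelr u x y : x ++ u = y ++ u -> x = y.
Proof. by move/(congr1 rev); rewrite !rev_cat => /cat_cancel/(can_inj revK). Qed.

Lemma infix_sub u x y v w z : u ++ x ++ y = v ++ w ++ z -> size u <= size v ->
  size v + size w <= size u + size x -> infix w x.
Proof.
move=> E h1 h2; have [p ep] := cat_split E h1; subst.
rewrite catA => e2; have [|q -> _] := cat_split (esym e2).
  by move: h2; rewrite !size_cat; slia.
by rewrite -catA infix_infix.
Qed.

(** The two notions are asymmetric on purpose: [x] stops before the occurrence of [w], while [p] in
    [last_occ] starts with it. This matches left codes, read in [s c], and right codes, read in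
    [s c ++ w]. *)
Definition first_occ w x := forall p q, p ++ w ++ q = x ++ w -> size p = size x.
Definition last_occ w p :=
  (exists p', p = w ++ p') /\ forall u v, u ++ w ++ v = p -> u = [::].

Lemma first_occ_exists w u : infix w u ->
  exists x y, u = x ++ w ++ y /\ first_occ w x.
Proof.
case/infixP=> x; have [n] := ubnP (size x).
elim: n x u => // n IH x u hn [y E].
case: (boolP (all (fun i => (take (size w) (drop i (x ++ w)) != w)) (iota 0 (size x)))).
  move/allP=> h; exists x, y; split=> // p q Ep.
  have hs := congr1 size Ep; rewrite !size_cat in hs.
  apply/eqP; rewrite eqn_leq; apply/andP; split; first slia.
  rewrite leqNgt; apply/negP=> hp.
  have := h (size p); rewrite mem_iota /= hp => /(_ isT).
  by rewrite -Ep drop_size_cat // take_size_cat // eqxx.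
case/allPn=> i; rewrite mem_iota /= add0n negbK => hi /eqP Ei.
have Ex : x ++ w = take i (x ++ w) ++ w ++ drop (size w) (drop i (x ++ w)).
  by rewrite -{3}Ei !cat_take_drop.
apply: (IH (take i (x ++ w))).
  by rewrite size_take size_cat; move: hi hn; clear; case: ifP => ?; slia.
exists (drop (size w) (drop i (x ++ w)) ++ y).
by rewrite E catA {1}Ex -!catA.
Qed.

Lemma last_occ_exists w u : infix w u ->
  exists x p, u = x ++ p /\ last_occ w p.
Proof.
case/infixP=> x [y]; have [n] := ubnP (size y).
elim: n x y u => // n IH x y u hn E.
case: (boolP (all (fun i => (take (size w) (drop i (w ++ y)) != w)) (iota 1 (size y)))).
  move/allP=> h; exists x, (w ++ y); split=> //; split; first by exists y.
  move=> p q Ep; apply/eqP; rewrite -size_eq0 -leqn0 leqNgt; apply/negP=> hp.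
  have hs := congr1 size Ep; rewrite !size_cat in hs.
  have := h (size p); rewrite mem_iota hp -Ep drop_size_cat // take_size_cat // eqxx.
  by move=> /(_ ltac:(slia)).
case/allPn=> i; rewrite mem_iota negbK => /andP[hi1 hi2] /eqP Ei.
have Ex : w ++ y = take i (w ++ y) ++ w ++ drop (size w) (drop i (w ++ y)).
  by rewrite -{3}Ei !cat_take_drop.
apply: (IH (x ++ take i (w ++ y)) (drop (size w) (drop i (w ++ y)))).
  by rewrite !size_drop size_cat; slia.
by rewrite E {1}Ex -!catA.
Qed.
End Words.

Section Wimg.
Variables (A : finType) (s : morph A).

Lemma wimg_cat u v : wimg s (u ++ v) = wimg s u ++ wimg s v.
Proof. by rewrite /wimg map_cat flatten_cat. Qed.

Lemma wimg_cons c v : wimg s (c :: v) = s c ++ wimg s v.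
Proof. by []. Qed.

Lemma wimg1 c : wimg s [:: c] = s c.
Proof. by rewrite /wimg /= cats0. Qed.

Lemma wimg_rcons v c : wimg s (rcons v c) = wimg s v ++ s c.
Proof. by rewrite -cats1 wimg_cat wimg1. Qed.

Lemma wimg_infix u v : infix u v -> infix (wimg s u) (wimg s v).
Proof. by case/infixP=> a [b ->]; rewrite !wimg_cat infix_infix. Qed.

Lemma wimg_boundary z i : i < size (wimg s z) ->
  exists z1 g z2, [/\ z = z1 ++ g :: z2, size (wimg s z1) <= i
    & i < size (wimg s z1) + size (s g)].
Proof.
elim: z i => // c z IH i; rewrite wimg_cons size_cat => hi.
case: (ltnP i (size (s c))) => h; first by exists [::], c, z.
have [|z1 [g [z2 [-> h1 h2]]]] := IH (i - size (s c)); first slia.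
by exists (c :: z1), g, z2; rewrite wimg_cons size_cat; split=> //; slia.
Qed.
End Wimg.

(** * Synchronization: occurrences of the return word are block boundaries *)

Section Return.
Variables (A : finType) (s : morph A) (w : seq A).
Hypothesis Hret : ret_for s w.

Lemma ret_inj u v : wimg s u = wimg s v -> u = v.
Proof. by case: Hret => h _; apply: h. Qed.

Lemma ret_nonerasing c : 0 < size (s c).
Proof. by case: Hret => _ /(_ c)[]. Qed.

Lemma mem_occs (z : seq A) i : (i \in occs w z) = (i <= size z - size w) && (take (size w) (drop i z) == w).
Proof. by rewrite mem_filter mem_iota /= add0n ltnS andbC. Qed.

Lemma ret_pre c : exists r, s c ++ w = w ++ r.
Proof.
case: Hret => _ /(_ c)[_ h]; have : 0 \in occs w (s c ++ w) by rewrite h mem_head.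
rewrite mem_occs drop0 => /andP[_ /eqP E]; exists (drop (size w) (s c ++ w)).
by rewrite -{2}E cat_take_drop.
Qed.

Lemma ret_occ c x y : x ++ w ++ y = s c ++ w -> size x = 0 \/ size x = size (s c).
Proof.
move=> E; case: Hret => _ /(_ c)[_ h].
have : size x \in occs w (s c ++ w).
  rewrite mem_occs -E drop_size_cat // take_size_cat // eqxx andbT.
  by rewrite !size_cat; slia.
by rewrite h !inE => /orP[]/eqP; auto.
Qed.

Lemma wimg_pre z : exists r, wimg s z ++ w = w ++ r.
Proof.
elim: z => [|c z [r IH]]; first by exists [::]; rewrite cats0.
rewrite wimg_cons -catA IH catA; case: (ret_pre c) => r' ->.
by exists (r' ++ r); rewrite -catA.
Qed.

(** What follows the first block starts with [w], so an occurrence beginning inside that block lies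
    in [s c ++ w], where only the two ends are allowed. *)
Lemma wimg_occ z x y : x ++ w ++ y = wimg s z ++ w ->
  exists z1 z2, z = z1 ++ z2 /\ x = wimg s z1.
Proof.
elim: z x y => [|c z IH] x y.
  move/(congr1 size); rewrite !size_cat /= => h; exists [::], [::]; split=> //.
  by apply/nilP; rewrite /nilp; apply/eqP; slia.
rewrite wimg_cons -catA => E.
case: (leqP (size (s c)) (size x)) => h.
  have [x' -> E'] := cat_split (esym E) h.
  have [z1 [z2 [-> ->]]] := IH _ _ (esym E').
  by exists (c :: z1), z2.
case: (wimg_pre z) => r Er; rewrite Er in E.
have [||q Eq _] := @cat_split _ (x ++ w) y (s c ++ w) r.
- by rewrite -!catA.
- by rewrite !size_cat; slia.
case: (@ret_occ c x q); first by rewrite Eq -catA.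
  by case: x {h E Eq} => // _; exists [::], (c :: z).
by move: h => /[swap] ->; rewrite ltnn.
Qed.

Lemma wimg_prefix v z y : wimg s v ++ w ++ y = wimg s z ++ w -> exists z', z = v ++ z'.
Proof. by case/wimg_occ=> z1 [z2 [-> /ret_inj->]]; exists z2. Qed.

Lemma ret_prefix_free c d y : s c ++ w ++ y = s d ++ w -> c = d.
Proof.
rewrite -(wimg1 s c) -(wimg1 s d) => /wimg_prefix[z'].
by case=> ->.
Qed.

(** In [s d ++ w] the suffix [s c ++ w] starts with [w], so it begins at a block boundary. *)
Lemma ret_suffix_free c d y : y ++ s c = s d -> c = d.
Proof.
move=> E; have [r Er] := ret_pre c.
have : y ++ w ++ r = wimg s [:: d] ++ w by rewrite wimg1 -E -catA Er.
case/wimg_occ => [[|e z1]] [z2 [Ez Ey]].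
  by apply: (@ret_prefix_free c d [::]); rewrite cats0 -E Ey.
case: z1 Ez Ey => //= -[<- _]; rewrite wimg1 => Ey.
have := congr1 size E; rewrite Ey size_cat; have := ret_nonerasing c; slia.
Qed.

Section Language.
Variable L : seq A -> Prop.
Hypothesis Lfac : forall u v, infix u v -> L v -> L u.
Hypothesis LextL : forall u, L u -> exists c, L (c :: u).
Hypothesis LextR : forall u, L u -> exists d, L (rcons u d).
Hypothesis HD : forall u, L u -> exists z, infix u (wimg s z).

Lemma ext_left u m : L u -> exists2 x, size x = m & L (x ++ u).
Proof.
move=> hu; elim: m => [|m [x <- hx]]; first by exists [::].
by have [c hc] := LextL hx; exists (c :: x).
Qed.

Lemma ext_right u m : L u -> exists2 y, size y = m & L (u ++ y).
Proof.
move=> hu; elim: m => [|m [y <- hy]]; first by exists [::]; rewrite ?cats0.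
have [c hc] := LextR hy; exists (rcons y c); first by rewrite size_rcons.
by rewrite -rcons_cat.
Qed.

Lemma decode u x y : L u -> u = w ++ y -> u = x ++ w -> exists v, u = wimg s v ++ w.
Proof.
move=> hu E1 E2; have [z /infixP[p [q E]]] := HD hu.
have Ea : p ++ w ++ (y ++ q ++ w) = wimg s z ++ w.
  by rewrite E E1 -!catA.
have [z1 [z2 [Ez Ep]]] := wimg_occ Ea.
have Eb : x ++ w ++ (q ++ w) = wimg s z2 ++ w.
  apply: (@cat_cancel _ p).
  have -> : p ++ x ++ w ++ q ++ w = wimg s z ++ w by rewrite E E2 -!catA.
  by rewrite Ez wimg_cat -catA -Ep.
have [v [z3 [_ Ev]]] := wimg_occ Eb.
by exists v; rewrite -Ev.
Qed.

Let M := \max_(c : A) size (s c).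
Let sM c : size (s c) <= M. Proof. by rewrite /M (leq_bigmax c). Qed.

(** Some block boundary lies at distance at most [M] from the start of [u], and every boundary is
    followed by [w]. *)
Lemma long_infix u : L u -> M + size w <= size u -> infix w u.
Proof.
move=> hu hs; have [z /infixP[p [q E]]] := HD hu.
case: (posnP (size u)) => [h0|hpos].
  have : size w = 0 by slia.
  by move/size0nil=> ->; apply: infix0s.
have [|z1 [g [z2 [Ez h1 h2]]]] := @wimg_boundary _ s z (size p).
  by rewrite E !size_cat; slia.
case: (leqP (size p) (size (wimg s z1))) => h3.
  have [r Er] := wimg_pre (g :: z2).
  apply: (@infix_sub _ p u (q ++ w) (wimg s z1) w r) => //.
  have -> : p ++ u ++ q ++ w = wimg s z ++ w by rewrite E -!catA.
    by rewrite Ez wimg_cat -catA Er.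
  by have := ret_nonerasing g; have := sM g; slia.
have [r Er] := wimg_pre z2.
apply: (@infix_sub _ p u (q ++ w) (wimg s (rcons z1 g)) w r) => //.
- have -> : p ++ u ++ q ++ w = wimg s z ++ w by rewrite E -!catA.
  by rewrite Ez -cat_rcons wimg_cat -catA Er.
- by rewrite wimg_rcons size_cat; slia.
- by rewrite wimg_rcons size_cat; have := sM g; slia.
Qed.

Lemma sandwich u : L u -> exists x y v, w ++ x ++ u ++ y ++ w = wimg s v ++ w /\ L (w ++ x ++ u ++ y ++ w).
Proof.
move=> hu; have [x hx hxu] := ext_left (M + size w) hu.
have [y hy hxy] := ext_right (M + size w) hxu.
have /infixP[x1 [x2 Ex]] : infix w x.
  by apply: long_infix; rewrite ?hx //; apply: Lfac hxu; apply: prefix_infix.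
have /infixP[y1 [y2 Ey]] : infix w y.
  by apply: long_infix; rewrite ?hy //; apply: Lfac hxy; apply: suffix_infix.
have hL : L (w ++ x2 ++ u ++ y1 ++ w).
  apply: Lfac hxy; apply/infixP; exists x1, y2.
  by rewrite Ex Ey -!catA.
have [v Ev] := @decode _ (w ++ x2 ++ u ++ y1) (x2 ++ u ++ y1 ++ w) hL (erefl _) ltac:(by rewrite -!catA).
by exists x2, y1, v.
Qed.

Lemma desubstitute c x v p d : first_occ w x -> last_occ w p ->
  L (c :: rcons (x ++ wimg s v ++ p) d) ->
  exists g h y y', [/\ s g = y ++ c :: x, s h ++ w = p ++ d :: y'
    & L (wimg s (g :: rcons v h) ++ w)].
Proof.
move=> hx [[p' Ep] hp] hL.
have [X [Y [z [Ez hZ]]]] := sandwich hL.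
have Ez' : (w ++ X ++ c :: x) ++ wimg s v ++ p ++ (d :: Y ++ w) = wimg s z ++ w.
  by rewrite -Ez -!catA /= -!cats1 -!catA.
have [r Er] := wimg_pre v.
have [|za [zb [Eab Ea]]] := @wimg_occ z (w ++ X ++ c :: x) (r ++ p' ++ (d :: Y ++ w)).
  by rewrite -Ez' Ep -!catA; do 3 congr cat; rewrite catA -Er -!catA.
have Eb : wimg s v ++ w ++ (p' ++ d :: Y ++ w) = wimg s zb ++ w.
  apply/eqP; move/eqP: Ez'; rewrite Eab wimg_cat Ea -!catA eqseq_cat // eqxx /=.
  by rewrite Ep -!catA.
have [zc Ec] := wimg_prefix Eb.
have {Eb}Ec' : p ++ d :: Y ++ w = wimg s zc ++ w.
  move/eqP: Eb; rewrite Ec wimg_cat -!catA eqseq_cat // eqxx /= => /eqP <-.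
  by rewrite Ep -!catA.
have [g [za' Eg]] : exists g za', za = rcons za' g.
  case/lastP: za Ea {Eab} => [|za' g] /(congr1 size); last by exists g, za'.
  by rewrite !size_cat /=; slia.
have [h [zc' Eh]] : exists h zc', zc = h :: zc'.
  case: zc Ec' {Ec} => [|h zc'] /(congr1 size); last by exists h, zc'.
  by rewrite Ep !size_cat /= size_cat; slia.
(* If the block of [g] were no longer than [x], its start would give an occurrence of [w] in
   [x ++ w] before the final one. *)
have [y Ey] : exists y, s g = y ++ c :: x.
  move: Ea; rewrite Eg wimg_rcons catA => Ea.
  case: (leqP (size (w ++ X)) (size (wimg s za'))) => hh.
    have [[|c' q] Eq1 Eq2] := cat_split Ea hh; first by exists [::].
    case: Eq2 => _ Eq2.
    have [r' Er'] := ret_pre g.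
    have := hx q r'; rewrite -Er' Eq2 -catA => /(_ (erefl _)).
    by rewrite size_cat; have := ret_nonerasing g; slia.
  by have [q Eq1 Eq2] := cat_split (esym Ea) (ltnW hh); exists q.
have [y' Ey'] : exists y', s h ++ w = p ++ d :: y'.
  move: Ec'; rewrite Eh wimg_cons -catA.
  have [r' Er'] := wimg_pre zc'; rewrite Er' catA => Ec'.
  case: (leqP (size (s h ++ w)) (size p)) => hh.
    have [q Eq1 _] := cat_split (esym Ec') hh.
    have Eh0 := hp (s h) q; move: Eh0; rewrite Eq1 -catA => /(_ (erefl _)) E0.
    by have := ret_nonerasing h; rewrite E0.
  have [[|d' q] Eq1 Eq2] := cat_split Ec' (ltnW hh).
    by move: hh; rewrite Eq1 cats0 ltnn.
  by exists q; rewrite Eq1; case: Eq2 => <- _.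
exists g, h, y, y'; split=> //.
apply: Lfac hZ; rewrite Ez Eab Ec Eg Eh.
have -> : rcons za' g ++ v ++ h :: zc' = za' ++ (g :: rcons v h) ++ zc'.
  by rewrite -cats1 -!catA /= cat_rcons.
have [r' Er'] := wimg_pre zc'.
rewrite !wimg_cat -!catA Er'.
by apply/infixP; exists (wimg s za'), r'; rewrite -!catA.
Qed.

Lemma decompose u : L u -> infix w u ->
  exists x v p, [/\ u = x ++ wimg s v ++ p, first_occ w x & last_occ w p].
Proof.
move=> hu /first_occ_exists[x [y [Eu hx]]].
have [|a [p [Ea hp]]] := @last_occ_exists _ w (w ++ y).
  by apply: prefix_infix.
have [[p' Ep] _] := hp.
have Ew : w ++ y = (a ++ w) ++ p' by rewrite Ea Ep -!catA.
have [|q Eq _] := cat_split Ew; first by rewrite size_cat leq_addl.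
have hL : L (a ++ w).
  by apply: Lfac hu; rewrite Eu Ew; apply: infix_infix.
have [v Ev] := decode hL Eq (erefl _).
have Ea' : a = wimg s v.
  exact: cat_cancelr Ev.
exists x, v, p; split=> //.
by rewrite Eu Ea Ea'.
Qed.

(** Take the block that holds [c]. If the word ran beyond this block and the [w] after it, that [w]
    would lie inside [u]. *)
Lemma ext_in_Lsig c u d : L (c :: rcons u d) -> ~~ infix w u -> Lsig s w (c :: rcons u d).
Proof.
move=> hL hu; have [X [Y [z [Ez _]]]] := sandwich hL.
have [|z1 [g [z2 [E h1 h2]]]] := @wimg_boundary _ s z (size (w ++ X)).
  by have := congr1 size Ez; rewrite !size_cat /= size_rcons; slia.
apply/hasP; exists g; first by rewrite mem_enum.
have [r Er] := wimg_pre z2.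
have Ez2 : wimg s z ++ w = wimg s z1 ++ (s g ++ w) ++ r.
  by rewrite E -cat_rcons wimg_cat wimg_rcons -!catA Er.
apply: (@infix_sub _ (wimg s z1) _ r (w ++ X) _ (Y ++ w)).
- by rewrite -Ez2 -Ez -!catA.
- exact: h1.
rewrite leqNgt; apply/negP => hlt; move/negP: hu; apply.
apply: (@infix_sub _ (w ++ X ++ [:: c]) u (d :: Y ++ w) (wimg s z1 ++ s g) w r).
- have : wimg s z1 ++ s g ++ w ++ r = w ++ X ++ (c :: rcons u d) ++ Y ++ w.
    by rewrite Ez Ez2 -!catA.
  by rewrite -!catA /= => ->; rewrite -cats1 -!catA.
- by rewrite !size_cat /= in h2 *; slia.
- by rewrite !size_cat /= size_rcons in hlt *; slia.
Qed.
End Language.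
End Return.

(** * Good languages and uniform recurrence *)

Section Good.
Variable A : finType.
Implicit Types (L : seq A -> Prop) (leL leR : rel A).

(** Sharing is asked along [leL] only, since [good_connectedR] recovers it along [leR]. The notion
    is thus stable under reversal of words ([good_rev]) and of both orders ([good_flip]), which
    halves the later arguments. *)
Record good L leL leR : Prop := Good {
  good_L : total_order leL;
  good_R : total_order leR;
  good_fac : forall u v, infix u v -> L v -> L u;
  good_extL : forall u, L u -> exists c, L (c :: u);
  good_extR : forall u, L u -> exists d, L (rcons u d);
  good_letter : forall c, L [:: c];
  good_planar : forall u c1 d1 c2 d2, L (c1 :: rcons u d1) -> L (c2 :: rcons u d2) ->
    ltr leL c1 c2 -> leR d1 d2;
  good_connected : forall u c c', consecutive leL c c' -> L (c :: u) -> L (c' :: u) ->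
    exists d, L (c :: rcons u d) /\ L (c' :: rcons u d);
  good_recurrent : forall u, L u -> exists x, L (u ++ x ++ u) }.

Section OneLanguage.
Variables (L : seq A -> Prop) (leL leR : rel A).
Hypothesis G : good L leL leR.

Let HL := good_L G.
Let HR := good_R G.

Lemma good_consl c u : L (c :: u) -> L u.
Proof. by apply: (good_fac G); apply: infix_cons. Qed.

Lemma good_rconsr c u : L (rcons u c) -> L u.
Proof. by apply: (good_fac G); apply: infix_rcons. Qed.

Lemma good_planarR u c1 d1 c2 d2 : L (c1 :: rcons u d1) -> L (c2 :: rcons u d2) ->
  ltr leR d1 d2 -> leL c1 c2.
Proof.
move=> h1 h2 hd; rewrite lerNgt //; apply/negP=> hc.
have := good_planar G h2 h1 hc; rewrite lerNgt // => /negP[]; exact: hd.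
Qed.

(** By induction the intermediate letter precedes [u]; the letter that follows is squeezed by
    planarity between two copies of [d]. *)
Lemma good_convexL u c1 c c2 : L (c1 :: u) -> L (c2 :: u) -> leL c1 c -> leL c c2 ->
  L (c :: u).
Proof.
elim/last_ind: u => [|u d IH] h1 h2 l1 l2; first exact: good_letter G c.
case: (ler_eqVlt HL l1) => [<-//|l1']; case: (ler_eqVlt HL l2) => [->//|l2'].
have hc : L (c :: u).
  by apply: IH => //; [move: h1 | move: h2]; rewrite -rcons_cons => /good_rconsr.
have [g hg] := good_extR G hc.
rewrite rcons_cons in hg.
have E : d = g.
  by apply: (ler_anti HR); [apply: (good_planar G h1 hg) | apply: (good_planar G hg h2)].
by rewrite E.
Qed.

(** Walk from a left extension of [u d] to one of [u d']. The letter shared by two consecutive left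
    extensions lies between [d] and [d'], so it is one of them. Either [d'] appears at a letter that
    still has [d], or [d] is carried to the end of the walk, where [d'] is available. *)
Lemma good_connectedR u d d' : consecutive leR d d' -> L (rcons u d) -> L (rcons u d') ->
  exists c, L (c :: rcons u d) /\ L (c :: rcons u d').
Proof.
move=> hd h h'; apply: NNPP => hno.
have [c hc] := good_extL G h; have [c' hc'] := good_extL G h'.
have hcc : leL c c' by apply: good_planarR hc hc' (consecutive_lt hd).
suff hd' : L (c :: rcons u d) -> L (c' :: rcons u d).
  by apply: hno; exists c'; split=> //; apply: hd'.
have convu e : leL c e -> leL e c' -> L (e :: u).
  by move=> k1 k2; apply: (good_convexL _ _ k1 k2);
     [apply: (@good_rconsr d) | apply: (@good_rconsr d')].
apply: (@consecutive_ind _ leL (fun x y => L (x :: rcons u d) -> L (y :: rcons u d)) c c' HL) => //.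
  by move=> y x z k1 k2 /k1.
move=> x y hx hy cxy hxd.
have lxy := consecutive_lt cxy.
have hxu : L (x :: u) by apply: convu => //; apply: ler_trans HL _ hy; apply: ltrW.
have hyu : L (y :: u) by apply: convu => //; apply: ler_trans HL hx _; apply: ltrW.
have [g [hxg hyg]] := good_connected G cxy hxu hyu.
have k1 : leR d g by apply: (good_planar G hxd hyg).
have k2 : leR g d'.
  by apply: (good_planar G hxg hc'); apply: ltr_le_trans HL lxy hy.
case: (ler_eqVlt HR k1) => [E|k3]; first by rewrite E.
have E := ler_anti HR k2 (consecutive_le HR hd k3).
by case: hno; exists x; rewrite -E.
Qed.

Lemma good_flip : good L (rev_order leL) (rev_order leR).
Proof.
split.
- exact: rev_order_total.
- exact: rev_order_total.
- exact: good_fac G.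
- exact: good_extL G.
- exact: good_extR G.
- exact: good_letter G.
- move=> u c1 d1 c2 d2 h1 h2; rewrite (ltr_rev leL) => h.
  exact: (good_planar G h2 h1 h).
- move=> u c c'; rewrite (consecutive_rev leL) => h h1 h2.
  by have [d [k1 k2]] := good_connected G h h2 h1; exists d.
- exact: good_recurrent G.
Qed.

Lemma good_rev : good (fun u => L (rev u)) leR leL.
Proof.
split=> //.
- by move=> u v h; apply: (good_fac G); rewrite infix_rev.
- by move=> u /(good_extR G)[d h]; exists d; rewrite rev_cons.
- by move=> u /(good_extL G)[c h]; exists c; rewrite rev_rcons.
- by move=> c; apply: (good_letter G).
- move=> u c1 d1 c2 d2; rewrite !rev_cons !rev_rcons => h1 h2.
  exact: (good_planarR h1 h2).
- move=> u c c' h; rewrite !rev_cons => h1 h2.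
  have [d [k1 k2]] := good_connectedR h h1 h2; exists d.
  by rewrite !rev_cons !rev_rcons.
- move=> u /(good_recurrent G)[x h]; exists (rev x).
  by rewrite !rev_cat revK -catA.
Qed.

Lemma good_long_special e f m : consecutive leL e f ->
  exists u, [/\ size u = m, L (e :: u) & L (f :: u)].
Proof.
move=> h; elim: m => [|m [u [<- h1 h2]]].
  by exists [::]; split=> //; apply: (good_letter G).
have [d [k1 k2]] := good_connected G h h1 h2.
by exists (rcons u d); rewrite size_rcons.
Qed.

(** Planarity applied both ways forces equal letters. Hence the words that can follow both [e] and
    [f] form a single chain of prefixes. *)
Lemma good_special_uniq e f u v : ltr leL e f -> L (e :: u) -> L (f :: u) ->
  L (e :: v) -> L (f :: v) -> size u = size v -> u = v.
Proof.
move=> h; elim/last_ind: u v => [|u d IH] v; first by move=> _ _ _ _ /esym/size0nil.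
case/lastP: v => [|v d']; first by rewrite size_rcons.
rewrite !size_rcons => h1 h2 h3 h4 [hs].
have E : u = v.
  apply: IH => //; [move: h1 | move: h2 | move: h3 | move: h4];
  by rewrite -rcons_cons => /good_rconsr.
subst v; congr rcons; apply: (ler_anti HR).
  exact: (good_planar G h1 h4).
exact: (good_planar G h3 h2).
Qed.

End OneLanguage.

Lemma good_convexR L leL leR u d1 d d2 : good L leL leR ->
  L (rcons u d1) -> L (rcons u d2) -> leR d1 d -> leR d d2 -> L (rcons u d).
Proof.
move=> G h1 h2 k1 k2.
have := good_convexL (u := rev u) (good_rev G) _ _ k1 k2.
by rewrite !rev_cons revK; apply.
Qed.

(** * Leaving and entering a sublanguage of a good language *)

Section Sublanguage.
Variables (L : seq A -> Prop) (leL leR : rel A).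
Hypothesis G : good L leL leR.
Let HL := good_L G.
Let HR := good_R G.
Variable L' : seq A -> Prop.
Hypothesis subL : forall u, L' u -> L u.
Hypothesis fac' : forall u v, infix u v -> L' v -> L' u.
Hypothesis extR' : forall u, L' u -> exists d, L' (rcons u d).
Hypothesis nonempty' : L' [::].

Definition special_stays (M : nat) := forall u e f, consecutive leL e f -> M <= size u ->
  L' u -> L (e :: u) -> L (f :: u) ->
  exists g, [/\ L (e :: rcons u g), L (f :: rcons u g) & L' (rcons u g)].

(** For a consecutive pair, the common right extensions form one chain. Either the chain stays in
    [L'], or it contains some [u0] outside [L']; then no common word at least as long as [u0] lies
    in [L'] and the condition is vacuous. *)
Lemma special_stays_exists : exists M, special_stays M.
Proof.
have H (p : A * A) : exists M, forall u, consecutive leL p.1 p.2 -> M <= size u ->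
  L' u -> L (p.1 :: u) -> L (p.2 :: u) ->
  exists g, [/\ L (p.1 :: rcons u g), L (p.2 :: rcons u g) & L' (rcons u g)].
  case: p => e f /=.
  have [[u0 [h1 h2 h3]]|hno] := classic (exists u, [/\ L (e :: u), L (f :: u) & ~ L' u]).
    exists (size u0) => u c hs hu k1 k2; case: h3.
    apply: (fac' _ hu); have E : u0 = take (size u0) u.
      have Et : infix (take (size u0) u) u by rewrite -{2}(cat_take_drop (size u0) u); apply: prefix_infix.
      apply: (good_special_uniq G (consecutive_lt c)) => //.
      - by apply: (good_fac G) k1; rewrite -{2}(cat_take_drop (size u0) u) -cat_cons; apply: prefix_infix.
      - by apply: (good_fac G) k2; rewrite -{2}(cat_take_drop (size u0) u) -cat_cons; apply: prefix_infix.
      - by rewrite size_takel.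
    rewrite E; rewrite -{2}(cat_take_drop (size u0) u); apply: prefix_infix.
  exists 0 => u c _ hu k1 k2.
  have [g [j1 j2]] := good_connected G c k1 k2.
  exists g; split=> //; apply: NNPP => j3; apply: hno; by exists (rcons u g).
have [F hF] := fin_all_exists H.
exists (\max_p F p) => u e f c hs; apply: (hF (e, f)) => //.
by apply: leq_trans hs; apply: (leq_bigmax (e, f)).
Qed.

Definition exits (m : nat) := exists u d, [/\ size u = m, L' u, L (rcons u d) & ~ L' (rcons u d)].
Definition enters (m : nat) := exists u c, [/\ size u = m, L' u, L (c :: u) & ~ L' (c :: u)].

(** Some consecutive pair [f], [f'] of right extensions of [u] is split by [L']. For a common left
    extension [c] of both, either [c :: u] is in [L'] and is left through [f'], or [c] enters
    [rcons u f]. *)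
Lemma exits_step m : exits m -> exits m.+1 \/ enters m.+1.
Proof.
case=> u [d [<- hu hud hnud]]; have [g hg] := extR' hu.
suff H : exists f f', [/\ consecutive leR f f' \/ consecutive leR f' f, L' (rcons u f), L (rcons u f') & ~ L' (rcons u f')].
  have [f [f' [hc hf hf' hnf]]] := H.
  have [c [k1 k2]] : exists c, L (c :: rcons u f) /\ L (c :: rcons u f').
    case: hc => hc; first exact: (good_connectedR G hc (subL hf) hf').
    by have [c [k1 k2]] := good_connectedR G hc hf' (subL hf); exists c.
  have [hcu|hcu] := classic (L' (c :: u)).
    left; exists (c :: u), f'; split=> // h; apply: hnf; apply: fac' h.
    by rewrite rcons_cons; apply: infix_cons.
  right; exists (rcons u f), c; split=> //; first by rewrite size_rcons.
  by move=> h; apply: hcu; apply: fac' h; rewrite -rcons_cons; apply: infix_rcons.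
suff key x y : leR x y -> L (rcons u x) -> L (rcons u y) ->
    ~ (L' (rcons u x) <-> L' (rcons u y)) ->
  exists f f', [/\ consecutive leR f f' \/ consecutive leR f' f, L' (rcons u f),
      L (rcons u f') & ~ L' (rcons u f')].
  case E : (leR g d); first by apply: (key g d) => //; [exact: subL | case=> /(_ hg)].
  apply: (key d g) => //; [by rewrite lerNgt // /ltr E | exact: subL | by case=> _ /(_ hg)].
move=> hxy hx hy; move=> hnot; apply: NNPP => hno; apply: hnot.
apply: (@consecutive_ind _ leR (fun x y => L' (rcons u x) <-> L' (rcons u y)) x y HR) => //.
  by move=> b a c -> ->.
move=> a b h1 h2 hab; have hl := ltrW (consecutive_lt hab).
have ha : L (rcons u a) by apply: (good_convexR G hx hy h1); apply: ler_trans hl h2.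
have hb : L (rcons u b) by apply: (good_convexR G hx hy _ h2); apply: ler_trans h1 hl.
by split=> h; apply: NNPP => h'; apply: hno; [exists a, b | exists b, a]; split; auto.
Qed.

Lemma first_exit w0 : L w0 -> ~ L' w0 -> exists m, exits m.
Proof.
elim/last_ind: w0 => [|u d IH] h h'; first by [].
have [hu|hu] := classic (L' u); first by exists (size u), u, d.
by apply: IH => //; apply: good_rconsr G _ _ h.
Qed.

(* [c] and some [c'] with [c'u] in [L'] both precede [ud]; two consecutive letters between
   them share a right extension inside [L'], which planarity forces to be [d]. *)
Lemma exit_enter_clash M M' u c d : special_stays M ->
  (forall u f f', consecutive leR f f' -> M' <= size u -> L' u ->
    L (rcons u f) -> L (rcons u f') ->
    exists c, [/\ L (c :: rcons u f), L (c :: rcons u f') & L' (c :: u)]) ->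
  M <= size u -> M' <= size u -> L' u -> L (c :: rcons u d) ->
  ~ L' (c :: u) -> ~ L' (rcons u d) -> False.
Proof.
move=> hM hM' s1 s2 hu hcd hnc hnd.
have hud : L (rcons u d) by apply: good_consl G _ _ hcd.
have [c' [hc' hc'u]] : exists c', L (c' :: rcons u d) /\ L' (c' :: u).
  have [g hg] := extR' hu; have hLg := subL hg.
  have ne : d != g by apply/eqP=> E; apply: hnd; rewrite E.
  case: (ltr_total HR ne) => hl.
    have [f hf1 hf2] := succ_exists HR hl.
    have hf : L (rcons u f).
      by apply: (good_convexR G hud hLg) => //; apply: ltrW (consecutive_lt hf1).
    by have [c' [k1 _ k2]] := hM' _ _ _ hf1 s2 hu hud hf; exists c'.
  have [f hf1 hf2] := pred_exists HR hl.
  have hf : L (rcons u f).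
    by apply: (good_convexR G hLg hud) => //; apply: ltrW (consecutive_lt hf1).
  by have [c' [_ k1 k2]] := hM' _ _ _ hf1 s2 hu hf hud; exists c'.
have main a b : ltr leL a b -> L (a :: rcons u d) -> L (b :: rcons u d) -> False.
  move=> hab ha hb; have [x hx1 hx2] := succ_exists HL hab.
  have hau : L (a :: u) by apply: (good_rconsr G (c := d)).
  have hbu : L (b :: u) by apply: (good_rconsr G (c := d)).
  have hxu : L (x :: u).
    by apply: (good_convexL G hau hbu) => //; apply: ltrW (consecutive_lt hx1).
  have [g [k1 k2 k3]] := hM _ _ _ hx1 s1 hu hau hxu.
  apply: hnd; suff -> : d = g by [].
  apply: (ler_anti HR); first exact: (good_planar G ha k2 (consecutive_lt hx1)).
  exact: (good_planar G k1 hb hab).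
have ne : c != c' by apply/eqP=> E; apply: hnc; rewrite E.
by case: (ltr_total HL ne) => h; apply: main h _ _.
Qed.

(* By recurrence the word [ud] leaving [L'] is preceded by another copy of itself, so
   extending [u] to the left inside [L'] stops at some letter, whence an entering word. *)
Lemma exit_clash M M' m : special_stays M ->
  (forall u f f', consecutive leR f f' -> M' <= size u -> L' u ->
    L (rcons u f) -> L (rcons u f') ->
    exists c, [/\ L (c :: rcons u f), L (c :: rcons u f') & L' (c :: u)]) ->
  M <= m -> M' <= m -> exits m -> False.
Proof.
move=> hM hM' s1 s2 [u [d [hm hu hud hnud]]].
have [x hx] := good_recurrent G hud.
have [c [a [b [Ea hc hnc]]]] : exists c a b, [/\ rcons u d ++ x = a ++ c :: b, L' (b ++ u)
    & ~ L' (c :: b ++ u)].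
  have : ~ L' ((rcons u d ++ x) ++ u).
    move=> h; apply: hnud; apply: fac' h.
    by rewrite -catA; exact: prefix_infix.
  elim: (rcons u d ++ x) => // c t IH /= hn.
  have [h|h] := classic (L' (t ++ u)); first by exists c, [::], t.
  by have [c' [a [b [-> h1 h2]]]] := IH h; exists c', (c :: a), b.
apply: (@exit_enter_clash M M' (b ++ u) c d) => //.
- by rewrite size_cat hm; lia.
- by rewrite size_cat hm; lia.
- apply: (good_fac G) hx; rewrite catA Ea; apply/infixP; exists a, [::].
  by rewrite cats0 -catA /= rcons_cat.
- move=> h; apply: hnud; apply: fac' h; rewrite rcons_cat; apply: suffix_infix.
Qed.
End Sublanguage.

Lemma exits_rev (L L' : seq A -> Prop) m :
  enters L L' m -> exits (fun u => L (rev u)) (fun u => L' (rev u)) m.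
Proof.
case=> u [c [h1 h2 h3 h4]]; exists (rev u), c.
by rewrite size_rev rev_rcons !revK.
Qed.

Lemma enters_rev (L L' : seq A -> Prop) m :
  exits (fun u => L (rev u)) (fun u => L' (rev u)) m -> enters L L' m.
Proof.
case=> u [c [h1 h2 h3 h4]]; exists (rev u), c; move: h3 h4.
by rewrite size_rev rev_rcons.
Qed.

Lemma exits_rev' (L L' : seq A -> Prop) m :
  enters (fun u => L (rev u)) (fun u => L' (rev u)) m -> exits L L' m.
Proof.
case=> u [c [h1 h2 h3 h4]]; exists (rev u), c; move: h3 h4.
by rewrite size_rev rev_cons.
Qed.

(* A proper biextendable sublanguage would be left or entered by words of every length. *)
Theorem good_minimal L leL leR (L' : seq A -> Prop) : good L leL leR ->
  (forall u, L' u -> L u) -> (forall u v, infix u v -> L' v -> L' u) ->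
  (forall u, L' u -> exists c, L' (c :: u)) ->
  (forall u, L' u -> exists d, L' (rcons u d)) -> L' [::] ->
  forall u, L u -> L' u.
Proof.
move=> G sub fac eL eR ne w0 hw0; apply: NNPP => hnw0.
have Gr := good_rev G.
pose Lr := fun u => L (rev u); pose Lr' := fun u => L' (rev u).
have sub' u : Lr' u -> Lr u by apply: sub.
have facr u v : infix u v -> Lr' v -> Lr' u.
  by move=> h; apply: fac; rewrite infix_rev.
have eLr u : Lr' u -> exists c, Lr' (c :: u).
  by move=> /eR[d h]; exists d; rewrite /Lr' rev_cons.
have eRr u : Lr' u -> exists c, Lr' (rcons u c).
  by move=> /eL[d h]; exists d; rewrite /Lr' rev_rcons.
have [M hM] := special_stays_exists G fac.
have [M' hM'] := special_stays_exists Gr facr.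
have [m0 hm0] := first_exit G ne hw0 hnw0.
have step m : exits L L' m \/ enters L L' m -> exits L L' m.+1 \/ enters L L' m.+1.
  case; first exact: (exits_step G sub fac eR).
  move/exits_rev/(exits_step Gr sub' facr eRr) => [/enters_rev|/exits_rev']; auto.
have hall k : exits L L' (m0 + k) \/ enters L L' (m0 + k).
  by elim: k => [|k IH]; [rewrite addn0; left | rewrite addnS; apply: step].
have [h|/exits_rev h] := hall (M + M').
- apply: (exit_clash (M' := M') G sub fac eR hM _ _ _ h); try lia.
  move=> u f f' hf hs hu h1 h2.
  have [||||g [k1 k2 k3]] := hM' (rev u) f f' hf; rewrite ?size_rev ?rev_cons ?revK //.
    by rewrite /Lr' revK.
  by exists g; move: k1 k2 k3; rewrite /Lr' !rev_cons !rev_rcons !revK.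
- apply: (exit_clash (M' := M) Gr sub' facr eRr hM' _ _ _ h); try lia.
  move=> u f f' hf hs hu h1 h2; rewrite rev_rcons in h1; rewrite rev_rcons in h2.
  have [|g [k1 k2 k3]] := hM (rev u) f f' hf _ hu h1 h2; first by rewrite size_rev.
  by exists g; rewrite /Lr' !rev_cons !rev_rcons.
Qed.

Theorem good_uniformly_recurrent L leL leR w0 : good L leL leR -> L w0 ->
  exists M, forall z, L z -> M <= size z -> infix w0 z.
Proof.
move=> G hw0; apply: NNPP => hno.
have avoiding M : exists z, [/\ L z, M <= size z & ~~ infix w0 z].
  apply: NNPP => h; apply: hno; exists M => z hz hs; apply/negPn/negP => hn.
  by apply: h; exists z.
(* The words that occur, with arbitrarily large margins, in words of [L] avoiding [w0]. The margins
   are what makes this sublanguage biextendable. *)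
pose L' u := forall m, exists x y, [/\ m <= size x, m <= size y, L (x ++ u ++ y)
  & ~~ infix w0 (x ++ u ++ y)].

(* Pigeonhole: if each letter fails at some margin, a single margin excludes all letters. *)
have unif (P : A -> nat -> Prop) : (forall d, ~ (forall m, P d m)) ->
    (forall d m m', m' <= m -> P d m -> P d m') -> exists M, forall d, ~ P d M.
  move=> h mono; have h' d : exists m, ~ P d m by apply: not_all_ex_not.
  have [F hF] := fin_all_exists h'; exists (\max_d F d) => d hd; apply: (hF d).
  by apply: mono hd; apply: (leq_bigmax d).
suff : L' w0 by move=> /(_ 0)[x [y [_ _ _]]]; rewrite infix_infix.
apply: (good_minimal G (L' := L')) hw0.
- move=> u /(_ 0)[x [y [_ _ h _]]]; apply: (good_fac G) h; exact: infix_infix.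
- move=> u v /infixP[a [b ->]] h m; have [x [y [h1 h2 h3 h4]]] := h m.
  exists (x ++ a), (b ++ y); rewrite !size_cat; split; try lia.
    by move: h3; rewrite -!catA.
  by move: h4; rewrite -!catA.
- move=> u hu; apply: NNPP => hn.
  have [||M hM] := unif (fun c m => exists x y, [/\ m <= size x, m <= size y, L (x ++ (c :: u) ++ y)
     & ~~ infix w0 (x ++ (c :: u) ++ y)]).
  - by move=> d h; apply: hn; exists d.
  - by move=> d m m' hm [x [y [h1 h2 h3 h4]]]; exists x, y; split=> //; lia.
  have [x [y []]] := hu M.+1; case/lastP: x => // x c h1 h2 h3 h4.
  apply: (hM c); exists x, y; rewrite size_rcons in h1; move: h3 h4.
  by rewrite !cat_rcons; split=> //; lia.
- move=> u hu; apply: NNPP => hn.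
  have [||M hM] := unif (fun c m => exists x y, [/\ m <= size x, m <= size y, L (x ++ (rcons u c) ++ y)
     & ~~ infix w0 (x ++ (rcons u c) ++ y)]).
  - by move=> d h; apply: hn; exists d.
  - by move=> d m m' hm [x [y [h1 h2 h3 h4]]]; exists x, y; split=> //; lia.
  have [x [y []]] := hu M.+1; case: y => // c y h1 h2 h3 h4.
  apply: (hM c); exists x, y; move: h3 h4 => /=.
  by rewrite !cat_rcons; split=> //; simpl in *; lia.
- move=> m; have [z [h1 h2 h3]] := avoiding (m + m).
  have hm : m <= size z by apply: leq_trans h2; apply: leq_addr.
  exists (take m z), (drop m z); rewrite /= cat_take_drop (size_takel hm) size_drop; split=> //.
  by rewrite leq_subRL.
Qed.
End Good.

(** * Lexicographic orders on a prefix code *)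

Section Lex.
Variables (A : finType) (le : rel A).

Fixpoint lexle (u v : seq A) : bool :=
  match u, v with
  | [::], _ => true
  | _ :: _, [::] => false
  | x :: u', y :: v' => if x == y then lexle u' v' else le x y
  end.

Hypothesis H : total_order le.

Lemma lexle_refl u : lexle u u.
Proof. by elim: u => //= x u ->; rewrite eqxx. Qed.

Lemma lexle_anti u v : lexle u v -> lexle v u -> u = v.
Proof.
elim: u v => [|x u IH] [|y v] //=; rewrite (eq_sym y x).
case: (eqVneq x y) => [->|ne] h1 h2; first by rewrite (IH v).
by rewrite (ler_anti H h1 h2) eqxx in ne.
Qed.

Lemma lexle_trans v u w : lexle u v -> lexle v w -> lexle u w.
Proof.
elim: u v w => [|x u IH] [|y v] [|z w] //=.
case: (eqVneq x y) => [E1|n1]; case: (eqVneq y z) => [E2|n2]; subst=> //.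
- by rewrite eqxx; apply: IH.
- by rewrite (negbTE n2).
- by rewrite (negbTE n1).
- case: (eqVneq x z) => [E|n3] h1 h2; last exact: ler_trans H h1 h2.
  by move: n1; rewrite (ler_anti H h1) ?eqxx // E.
Qed.

Lemma lexle_total u v : lexle u v || lexle v u.
Proof.
elim: u v => [|x u IH] [|y v] //=; rewrite (eq_sym y x).
by case: (eqVneq x y) => // _; case: (H) => _ [_ [_ h]]; apply: h.
Qed.

Lemma lexle_prefix p x u y v : lexle (p ++ x :: u) (p ++ y :: v) -> le x y.
Proof.
elim: p => [|a p IH] /=; last by rewrite eqxx.
by case: (eqVneq x y) => [-> _|//]; apply: ler_refl.
Qed.

Lemma lexle_convex p x u y v z : lexle (p ++ x :: u) z -> lexle z (p ++ y :: v) ->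
  exists x' u', z = p ++ x' :: u'.
Proof.
elim: p z => [|a p IH] [|b z] //=; first by exists b, z.
rewrite (eq_sym b a); case: (eqVneq a b) => [<-|ne] h1 h2.
  by have [x' [u' ->]] := IH z h1 h2; exists x', u'.
by rewrite (ler_anti H h1 h2) eqxx in ne.
Qed.

Lemma lcp_split (u v : seq A) : (forall y, u ++ y <> v) -> (forall y, v ++ y <> u) ->
  exists x y u' v', [/\ u = lcp u v ++ x :: u', v = lcp u v ++ y :: v' & x != y].
Proof.
elim: u v => [|x u IH] v h1 h2; first by case: (h1 v).
case: v h1 h2 => [|y v] h1 h2; first by case: (h2 (x :: u)).
rewrite /=; case: (eqVneq x y) => [E|ne]; last by exists x, y, u, v.
subst y; have [||a [b [u' [v' [E1 E2 n]]]]] := IH v.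
- by move=> y E; apply: (h1 y); rewrite /= E.
- by move=> y E; apply: (h2 y); rewrite /= E.
by exists a, b, u', v'; split=> //=; congr cons.
Qed.

Lemma lcp_cat (p : seq A) x u y v : x != y -> lcp (p ++ x :: u) (p ++ y :: v) = p.
Proof. by move=> ne; elim: p => [|a p IH] /=; rewrite ?(negbTE ne) // eqxx IH. Qed.

Variable psi : A -> seq A.
Hypothesis pfree : forall c d y, psi c ++ y = psi d -> c = d.

Definition ordlex : rel A := fun c d => lexle (psi c) (psi d).

Lemma ordlex_total : total_order ordlex.
Proof.
split; [|split; [|split]].
- by move=> c; apply: lexle_refl.
- move=> c d h1 h2; apply: (@pfree c d [::]); rewrite cats0; exact: lexle_anti.
- by move=> c d e; apply: lexle_trans.
- by move=> c d; apply: lexle_total.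
Qed.
Let Ho := ordlex_total.

(** Both sides are treated at once: [T], [AA] and [phi] stand for the left or the right data of the
    morphism. The map [ka], reversal or the identity, turns an element of [T] into a common prefix
    of codes. *)
Variables (T : seq (seq A)) (ka : seq A -> seq A) (AA : seq A -> {set A})
  (phi : seq A -> A -> A).
Hypothesis uT : uniq T.
Hypothesis ka_inj : injective ka.
Hypothesis HT : forall c d, c != d -> exists2 x, x \in T & ka x = lcp (psi c) (psi d).
Hypothesis AAP : forall x c, c \in AA x -> exists u, psi c = ka x ++ phi x c :: u.
Hypothesis AAI : forall x c y u, psi c = ka x ++ y :: u -> c \in AA x /\ phi x c = y.

Lemma ordlex_pres x : order_pres (AA x) (phi x) ordlex le.
Proof.
move=> c d /AAP[u E1] /AAP[v E2] /ltrW; rewrite /ordlex E1 E2.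
exact: lexle_prefix.
Qed.

Lemma ordlex_lt x c d : c \in AA x -> d \in AA x -> ltr le (phi x c) (phi x d) -> ltr ordlex c d.
Proof.
move=> hc hd h; rewrite ltrNge //; apply/negP => h'.
case: (ler_eqVlt Ho h') => [E|h2]; first by rewrite E ltrr in h.
by have := ordlex_pres hd hc h2; rewrite lerNgt // h.
Qed.

Lemma ordlex_convex x c d e : c \in AA x -> e \in AA x -> ordlex c d -> ordlex d e ->
  d \in AA x.
Proof.
move=> /AAP[u E1] /AAP[v E2]; rewrite /ordlex E1 E2 => h1 h2.
by have [y [u' E]] := lexle_convex h1 h2; case: (AAI E).
Qed.

Lemma ordlex_key x c d : c \in AA x -> d \in AA x -> phi x c != phi x d ->
  ka x = lcp (psi c) (psi d).
Proof. by move=> /AAP[u E1] /AAP[v E2] ne; rewrite E1 E2 lcp_cat. Qed.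

Lemma key_exists c d : c != d -> exists x, [/\ x \in T, c \in AA x, d \in AA x
  & phi x c != phi x d].
Proof.
move=> ne; have [x hx E] := HT ne.
have [||a [b [u [v [E1 E2 n]]]]] := @lcp_split (psi c) (psi d).
- by move=> y /pfree h; rewrite h eqxx in ne.
- by move=> y /pfree h; rewrite h eqxx in ne.
rewrite -E in E1 E2; have [h1 p1] := AAI E1; have [h2 p2] := AAI E2.
by exists x; split=> //; rewrite p1 p2.
Qed.

Lemma key_mem x c d : c \in AA x -> d \in AA x -> phi x c != phi x d -> x \in T.
Proof.
move=> hc hd n.
have ne : c != d by apply: contraNneq n => ->.
have [y hy E] := HT ne.
by rewrite (_ : x = y) //; apply: ka_inj; rewrite E; apply: ordlex_key.
Qed.

Definition sigG (G : seq {set A}) : seq {set A} :=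
  flatten [seq [seq [set phi x c | c in C :&: AA x] | x <- T] | C <- G].

Lemma image_pair x c d : c \in AA x -> d \in AA x ->
  [set phi x e | e in [set c; d] :&: AA x] = [set phi x c; phi x d].
Proof.
move=> hc hd; have -> : [set c; d] :&: AA x = [set c; d].
  by apply/setIidPl/subsetP=> e; rewrite !inE => /orP[]/eqP->.
by rewrite imsetU !imset_set1.
Qed.

Lemma image_pair_gt1 x c d : 1 < #|[set phi x e | e in [set c; d] :&: AA x]| ->
  [/\ c \in AA x, d \in AA x & phi x c != phi x d].
Proof.
case/card_gt1P=> a [b [/imsetP[e he ->] /imsetP[f hf ->] n]].
move: he hf n; rewrite !inE => /andP[/orP[]/eqP-> h1] /andP[/orP[]/eqP-> h2] n; split=> //;
 by rewrite ?eqxx // eq_sym in n *.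
Qed.

Hypothesis surj : forall e f, consecutive le e f ->
  exists x c d, [/\ c \in AA x, d \in AA x, phi x c = e & phi x d = f].

(** Walk from [c] to [d] along consecutive letters of the new order. All of them lie in [AA x] by
    convexity, and their images increase from [e] to [f] with nothing in between, so one step jumps
    from [e] to [f]. *)
Lemma consecutive_lift e f : consecutive le e f ->
  exists x c d, [/\ x \in T, consecutive ordlex c d, c \in AA x, d \in AA x &
     phi x c = e /\ phi x d = f].
Proof.
move=> hef; have [x [c [d [hc hd Ec Ed]]]] := surj hef.
have lef := consecutive_lt hef.
have lcd : ltr ordlex c d by apply: (ordlex_lt hc hd); rewrite Ec Ed.
apply: NNPP => hno.
have : phi x c = e -> phi x d = e.
  apply: (@consecutive_ind _ ordlex (fun a b => phi x a = e -> phi x b = e) c d Ho) => //.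
  - by move=> b a k h1 h2 /h1/h2.
  - move=> a b h1 h2 hab Ea; apply: NNPP => hb.
    have lab := ltrW (consecutive_lt hab).
    have ha : a \in AA x by apply: (ordlex_convex hc hd h1); apply: ler_trans lab h2.
    have hbA : b \in AA x by apply: (ordlex_convex hc hd _ h2); apply: ler_trans h1 lab.
    have k1 : le e (phi x b) by rewrite -Ea; apply: ordlex_pres => //; apply: consecutive_lt.
    have k2 : le (phi x b) f.
      rewrite -Ed; case: (ler_eqVlt Ho h2) => [->|h3]; first exact: ler_refl.
      exact: ordlex_pres.
    case: (ler_eqVlt H k1) => [E|k3]; first by rewrite E in hb.
    have Eb := ler_anti H k2 (consecutive_le H hef k3).
    apply: hno; exists x, a, b; split=> //.
    by apply: (key_mem ha hbA); rewrite Ea Eb; apply: ltr_neq lef.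
  exact: ltrW.
by move=> /(_ Ec) E; move: (ltr_neq lef); rewrite -E Ed eqxx.
Qed.

(* A pair contributes a nontrivial clique only for the longest common prefix of its codes. *)
Lemma size_sigG : size [seq C <- sigG (Gord ordlex) | 1 < #|pred_of_set C|] <= #|A|.-1.
Proof.
rewrite -(size_Gord Ho) /sigG.
have : {subset Gord ordlex <= Gord ordlex} by [].
elim: {1 3 4}(Gord ordlex) => [|C G IH hs] //.
rewrite /= filter_cat size_cat -(add1n (size G)); apply: leq_add; last first.
  by apply: IH => D hD; apply: hs; rewrite inE hD orbT.
have /mem_Gord[c [d [hcd ->]]] : C \in Gord ordlex by apply: hs; rewrite mem_head.
rewrite size_filter count_map.
have [x0 hx0 E0] := HT (consecutive_neq hcd).
apply: (@leq_trans (count (pred1 x0) T)); last by rewrite count_uniq_mem // leq_b1.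
apply: sub_count => x /= /image_pair_gt1[h1 h2 h3].
by apply/eqP/ka_inj; rewrite E0; apply: ordlex_key.
Qed.

(** Lifting includes the duplicate-free list [Gord le], of size [#|A|.-1], in a list that is no
    longer; hence they agree as multisets. *)
Lemma ordlex_mc_eq : mc_eq (Gord le) (sigG (Gord ordlex)).
Proof.
rewrite /mc_eq filter_Gord.
have hsub : {subset Gord le <= [seq C <- sigG (Gord ordlex) | 1 < #|pred_of_set C|]}.
  move=> C hC; rewrite mem_filter (Gord_card hC) /=.
  case/mem_Gord: hC => e [f [hef ->]].
  have [x [c [d [hx hcd hc hd [<- <-]]]]] := consecutive_lift hef.
  apply/flattenP; exists [seq [set phi y e0 | e0 in [set c; d] :&: AA y] | y <- T].
    by apply/mapP; exists [set c; d] => //; apply/mem_Gord; exists c, d.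
  by apply/mapP; exists x => //; rewrite image_pair.
have hle : size [seq C <- sigG (Gord ordlex) | 1 < #|pred_of_set C|] <= size (Gord le).
  by rewrite (size_Gord H) size_sigG.
have [es ei] := uniq_min_size (uniq_Gord H) hsub hle.
apply: uniq_perm => //; first exact: uniq_Gord.
by apply: leq_size_uniq (uniq_Gord H) hsub hle.
Qed.

Lemma ordlex_consecutive c d x : consecutive ordlex c d -> c \in AA x -> d \in AA x ->
  phi x c != phi x d -> consecutive le (phi x c) (phi x d).
Proof.
move=> hcd hc hd n.
have : [set phi x c; phi x d] \in Gord le.
  have := ordlex_mc_eq; rewrite /mc_eq filter_Gord => /perm_mem ->.
  rewrite mem_filter card_set2_gt1 n /=; apply/flattenP.
  exists [seq [set phi y e0 | e0 in [set c; d] :&: AA y] | y <- T].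
    by apply/mapP; exists [set c; d] => //; apply/mem_Gord; exists c, d.
  by apply/mapP; exists x; rewrite ?image_pair //; apply: key_mem n.
have hlt : ltr le (phi x c) (phi x d).
  by rewrite /ltr n andbT; apply: ordlex_pres => //; apply: consecutive_lt.
case/mem_Gord => e [f [hef /setP E]].
have := E (phi x c); have := E (phi x d); rewrite !inE !eqxx orbT /=.
move=> /esym/orP[]/eqP Ed /esym/orP[]/eqP Ec; rewrite ?Ec ?Ed // in n hlt *.
- by rewrite eqxx in n.
- by case: (ltr_asym H hlt (consecutive_lt hef)).
- by rewrite eqxx in n.
Qed.
End Lex.

(** * The derived language *)

Section Sides.
Variables (A : finType) (s : morph A) (w : seq A).
Hypothesis Hret : ret_for s w.

Lemma AL_split x c : c \in AL s x -> exists y, s c = y ++ phiL s x c :: x.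
Proof.
rewrite inE => /andP[h /suffixP[y E]].
case/lastP: y E => [|y e] E; first by rewrite E ltnn in h.
exists y; rewrite {1}E cat_rcons; congr (_ ++ _ :: _).
rewrite /phiL; set i := (_ - _).-1; have -> : i = size y.
  by rewrite /i E size_cat size_rcons addnK.
by rewrite E cat_rcons nth_cat ltnn subnn.
Qed.

Lemma AL_intro x c y e : s c = y ++ e :: x -> c \in AL s x /\ phiL s x c = e.
Proof.
move=> E; have h : c \in AL s x.
  rewrite inE E -cat_rcons suffix_suffix andbT size_cat size_rcons; lia.
split=> //; rewrite /phiL; set i := (_ - _).-1; have -> : i = size y.
  by rewrite /i E -cat_rcons size_cat size_rcons addnK.
by rewrite E nth_cat ltnn subnn.
Qed.

Lemma AR_split p c : c \in AR s w p -> exists y, s c ++ w = p ++ phiR s w p c :: y.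
Proof.
rewrite inE => /andP[h /prefixP[y E]].
case: y E => [|e y] E; first by rewrite E cats0 ltnn in h.
exists y; rewrite {1}E /phiR; congr (_ ++ _ :: _).
by rewrite E nth_cat ltnn subnn.
Qed.

Lemma AR_intro p c e y : s c ++ w = p ++ e :: y -> c \in AR s w p /\ phiR s w p c = e.
Proof.
move=> E; rewrite inE /phiR E prefix_prefix nth_cat ltnn subnn size_cat /=; split=> //.
by rewrite andbT; lia.
Qed.

(** Left extensions are read leftwards from a block boundary, hence the reversal, which turns the
    suffix code into a prefix code. *)
Definition codeL (c : A) := rev (s c).
Definition codeR (c : A) := s c ++ w.

Lemma codeL_free c d y : codeL c ++ y = codeL d -> c = d.
Proof.
rewrite /codeL => /(congr1 rev); rewrite rev_cat !revK.
exact: (ret_suffix_free Hret).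
Qed.

Lemma codeR_free c d y : codeR c ++ y = codeR d -> c = d.
Proof. by rewrite /codeR -catA; apply: (ret_prefix_free Hret). Qed.

Lemma uniq_TL : uniq (TL s). Proof. exact: undup_uniq. Qed.
Lemma uniq_TR : uniq (TR s w). Proof. exact: undup_uniq. Qed.

Lemma TL_key c d : c != d -> exists2 x, x \in TL s & rev x = lcp (codeL c) (codeL d).
Proof.
move=> ne; exists (lcs (s c) (s d)); last by rewrite /lcs revK.
rewrite mem_undup; apply/flattenP; exists [seq lcs (s c) (s d) | d <- enum A & d != c].
  by apply/mapP; exists c; rewrite ?mem_enum.
by apply/mapP; exists d; rewrite // mem_filter mem_enum andbT eq_sym.
Qed.

Lemma TR_key c d : c != d -> exists2 x, x \in TR s w & id x = lcp (codeR c) (codeR d).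
Proof.
move=> ne; exists (lcp (s c ++ w) (s d ++ w)) => //.
rewrite mem_undup; apply/flattenP.
exists [seq lcp (s c ++ w) (s d ++ w) | d <- enum A & d != c].
  by apply/mapP; exists c; rewrite ?mem_enum.
by apply/mapP; exists d; rewrite // mem_filter mem_enum andbT eq_sym.
Qed.

Lemma codeL_of_AL x c : c \in AL s x -> exists u, codeL c = rev x ++ phiL s x c :: u.
Proof.
case/AL_split=> y E; exists (rev y).
by rewrite /codeL {1}E rev_cat rev_cons cat_rcons.
Qed.

Lemma AL_of_codeL x c y u : codeL c = rev x ++ y :: u -> c \in AL s x /\ phiL s x c = y.
Proof.
rewrite /codeL => /(congr1 rev); rewrite revK rev_cat rev_cons revK cat_rcons.
exact: AL_intro.
Qed.

Lemma last_occ_self : last_occ w w.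
Proof.
split; first by exists [::]; rewrite cats0.
move=> u v /(congr1 size); rewrite !size_cat => h.
by apply: size0nil; lia.
Qed.

Lemma first_occ_nil : first_occ w [::].
Proof. by move=> p q /(congr1 size); rewrite !size_cat /=; lia. Qed.

Lemma first_occ_AL x c : c \in AL s x -> first_occ w x.
Proof.
case/AL_split=> y E p q Ep.
have : (y ++ phiL s x c :: p) ++ w ++ q = s c ++ w by rewrite E -!catA /= Ep.
case/(ret_occ Hret); rewrite ?size_cat /=; first lia.
by rewrite E size_cat /=; lia.
Qed.

Lemma Lsig_infix u v : infix u v -> Lsig s w v -> Lsig s w u.
Proof.
move=> h /hasP[c hc h']; apply/hasP; exists c => //.
exact: infix_trans h h'.
Qed.
End Sides.

Section Derive.
Variables (A : finType) (s : morph A) (w : seq A).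
Hypothesis Hret : ret_for s w.
Variables (L : seq A -> Prop) (leL leR : rel A).
Hypothesis G : good L leL leR.
Hypothesis HD : forall u, L u -> exists z, infix u (wimg s z).

Let HL := good_L G.
Let HR := good_R G.
Let Lfac := good_fac G.
Let M := \max_(c : A) size (s c).

Definition derL : rel A := ordlex leL (codeL s).
Definition derR : rel A := ordlex leR (codeR s w).
Definition derived (v : seq A) : Prop := L (wimg s v ++ w).

Lemma derL_total : total_order derL.
Proof. exact: (ordlex_total HL (codeL_free Hret)). Qed.
Lemma derR_total : total_order derR.
Proof. exact: (ordlex_total HR (codeR_free Hret)). Qed.

Lemma desubstitute_AL_AR c x v p d : first_occ w x -> last_occ w p ->
  L (c :: rcons (x ++ wimg s v ++ p) d) ->
  exists g h, [/\ g \in AL s x, phiL s x g = c, h \in AR s w p, phiR s w p h = d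
    & derived (g :: rcons v h)].
Proof.
move=> hx hp hL.
have [g [h [y [y' [E1 E2 h3]]]]] :=
  desubstitute Hret Lfac (good_extL G) (good_extR G) HD hx hp hL.
by exists g, h; have [-> ->] := AL_intro E1; have [-> ->] := AR_intro E2.
Qed.

(** A long word that follows both [e] and [f] contains [w]. The part [x] before its first occurrence
    is then preceded by [e] and by [f] inside blocks. *)
Lemma consecutive_AL e f : consecutive leL e f ->
  exists x c d, [/\ c \in AL s x, d \in AL s x, phiL s x c = e & phiL s x d = f].
Proof.
move=> hef; have [u [hs h1 h2]] := good_long_special G (M + size w) hef.
have hu : L u by apply: good_consl G _ _ h1.
have /first_occ_exists[x [y [E hx]]] : infix w u.
  by apply: (long_infix Hret HD hu); rewrite hs.
have key c : L (c :: u) -> exists2 g, g \in AL s x & phiL s x g = c.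
  move=> hc; have h : L (c :: x ++ w).
    by apply: Lfac hc; apply/infixP; exists [::], y; rewrite E /= -catA.
  have [d hd] := good_extR G h.
  have [g [_ [k1 k2 _ _ _]]] := @desubstitute_AL_AR c x [::] w d hx (last_occ_self w) hd.
  by exists g.
have [g g1 g2] := key _ h1; have [k k1 k2] := key _ h2.
by exists x, g, k.
Qed.

Lemma consecutive_AR e f : consecutive leR e f ->
  exists x c d, [/\ c \in AR s w x, d \in AR s w x, phiR s w x c = e & phiR s w x d = f].
Proof.
move=> hef; have [u [hs h1 h2]] := good_long_special (good_rev G) (M + size w) hef.
rewrite !rev_cons in h1 h2.
have hu : L (rev u) by apply: good_rconsr G _ _ h1.
have /last_occ_exists[x [p [E hp]]] : infix w (rev u).
  by apply: (long_infix Hret HD hu); rewrite size_rev hs.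
have key c : L (rcons (rev u) c) -> exists2 g, g \in AR s w p & phiR s w p g = c.
  move=> hc; have h : L (rcons p c).
    apply: Lfac hc; rewrite E rcons_cat; exact: suffix_infix.
  have [d hd] := good_extL G h.
  have [_ [g [_ _ k1 k2 _]]] := @desubstitute_AL_AR d [::] [::] p c (@first_occ_nil _ w) hp hd.
  by exists g.
have [g g1 g2] := key _ h1; have [k k1 k2] := key _ h2.
by exists p, g, k.
Qed.

Lemma derL_mc_eq : mc_eq (Gord leL) (sigL s (Gord derL)).
Proof.
exact: (ordlex_mc_eq HL (codeL_free Hret) (uniq_TL s) (can_inj revK) (TL_key s) (@codeL_of_AL _ s) (@AL_of_codeL _ s) consecutive_AL).
Qed.

Lemma derR_mc_eq : mc_eq (Gord leR) (sigR s w (Gord derR)).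
Proof.
exact: (ordlex_mc_eq HR (codeR_free Hret) (uniq_TR s w) (@inj_id _) (TR_key s w) (@AR_split _ s w) (@AR_intro _ s w) consecutive_AR).
Qed.

Lemma der_left_valid : left_valid (Gord leL) s (Gord derL).
Proof.
have Ho := derL_total.
split; [|split; [|split; [|split; [|split]]]].
- exact: (mc_eq_acyclic Ho (mc_eq_refl _)).
- by apply: (mc_eq_connected Ho (mc_eq_refl _)).
- move=> x _; apply: (mc_eq_connected Ho (mc_eq_refl _)) => a b c ha hc.
  exact: (ordlex_convex HL (@codeL_of_AL _ s) (@AL_of_codeL _ s) ha hc).
- exact: derL_mc_eq.
- exact: (mc_eq_acyclic HL derL_mc_eq).
- by apply: (mc_eq_connected HL derL_mc_eq).
Qed.

Lemma der_right_valid : right_valid w (Gord leR) s (Gord derR).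
Proof.
have Ho := derR_total.
split; [|split; [|split; [|split; [|split]]]].
- exact: (mc_eq_acyclic Ho (mc_eq_refl _)).
- by apply: (mc_eq_connected Ho (mc_eq_refl _)).
- move=> x _; apply: (mc_eq_connected Ho (mc_eq_refl _)) => a b c ha hc.
  exact: (@ordlex_convex _ _ HR _ id _ _ (@AR_split _ s w) (@AR_intro _ s w) _ _ _ _ ha hc).
- exact: derR_mc_eq.
- exact: (mc_eq_acyclic HR derR_mc_eq).
- by apply: (mc_eq_connected HR derR_mc_eq).
Qed.

Lemma phiL_order_pres x : order_pres (AL s x) (phiL s x) derL leL.
Proof. exact: (ordlex_pres HL (@codeL_of_AL _ s)). Qed.

Lemma phiR_order_pres p : order_pres (AR s w p) (phiR s w p) derR leR.
Proof. exact: (@ordlex_pres _ _ HR _ id _ _ (@AR_split _ s w)). Qed.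

Lemma der_planar_pres : planar_pres s w derL derR leL leR.
Proof. by split=> x _; [apply: phiL_order_pres | apply: phiR_order_pres]. Qed.

Hypothesis Hdend : dendric s w.

(* A missing edge [c, d] of the connected extension graph of [u] in [L] would close a cycle
   in its extension graph in [Lsig s w], which is a tree. *)
Lemma sig_in_L y : Lsig s w y ->
  (forall c u d, y = c :: rcons u d -> ~~ infix w u) -> L y.
Proof.
have [n] := ubnP (size y); elim: n y => // n IH y hn hy hin.
case: y hn hy hin => [|c y] hn hy hin.
  case/hasP: hy => c _ _; apply: Lfac (good_letter G c); exact: infix0s.
case/lastP: y hn hy hin => [|u d] hn hy hin; first exact: good_letter G c.
have hnu := hin _ _ _ (erefl _).
have hcu : L (c :: u).
  apply: IH; first by move: hn; rewrite /= size_rcons.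
    by apply: (Lsig_infix _ hy); rewrite -rcons_cons; apply: infix_rcons.
  move=> c' u' d' [_ Eu]; apply: contra hnu => h; rewrite Eu.
  by rewrite -cats1; apply: infix_catr.
have hud : L (rcons u d).
  apply: IH; first by move: hn; rewrite /= size_rcons.
    by apply: (Lsig_infix _ hy); apply: infix_cons.
  move=> c' u' d'; case: (u) hnu => [|a u0] hnu; first by case: u'.
  case=> _ /rcons_inj[Eu _]; apply: contra hnu => h; rewrite Eu -cat1s.
  exact: infix_catl.
have [_ [_ acyc]] := Hdend (u := u) ltac:(rewrite /sig_initial hnu andbT; apply: (Lsig_infix _ hy); rewrite -rcons_cons; exact: infix_trans (infix_rcons u d) (infix_cons _ c)).
apply: NNPP => hnot.
(* The extension graph without the edge from [c] to [d]. Edges coming from [L] survive, because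
   [c :: rcons u d] is assumed outside [L]. *)
pose e0 := fun x y : A + A => ext_edge (Lsig s w) u x y &&
  ~~ (((x, y) == (inl c, inr d)) || ((x, y) == (inr d, inl c))).
have e0P c1 d1 : L (c1 :: rcons u d1) -> e0 (inl c1) (inr d1) && e0 (inr d1) (inl c1).
  move=> h; have h' : Lsig s w (c1 :: rcons u d1) := ext_in_Lsig Hret Lfac (good_extL G) (good_extR G) HD h hnu.
  rewrite /e0 /= /Eb h' /=; apply/andP; split; apply/negP => h0; apply: hnot.
    by case/orP: h0 => /eqP // -[<- <-].
  by case/eqP: h0 => <- <-.
have step1 c1 d1 : L (c1 :: rcons u d1) -> connect e0 (inl c1) (inr d1).
  by move/e0P/andP=> [h _]; apply: connect1.
have step2 c1 d1 : L (c1 :: rcons u d1) -> connect e0 (inr d1) (inl c1).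
  by move/e0P/andP=> [_ h]; apply: connect1.
have [c2 hc2] := good_extL G hud.
have hc2u : L (c2 :: u) by apply: (good_rconsr G (c := d)).
have conn a b : leL a b -> L (a :: u) -> L (b :: u) ->
    connect e0 (inl a) (inl b) /\ connect e0 (inl b) (inl a).
  move=> hab ha hb.
  apply: (@consecutive_ind _ leL (fun a b => connect e0 (inl a) (inl b) /\ connect e0 (inl b) (inl a)) a b HL) => //.
    move=> y x z [k1 k2] [k3 k4]; split; [exact: connect_trans k1 k3 | exact: connect_trans k4 k2].
  move=> x y h1 h2 hxy; have lxy := ltrW (consecutive_lt hxy).
  have hx : L (x :: u) by apply: (good_convexL G ha hb h1); apply: ler_trans lxy h2.
  have hy' : L (y :: u) by apply: (good_convexL G ha hb _ h2); apply: ler_trans h1 lxy.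
  have [g [k1 k2]] := good_connected G hxy hx hy'.
  split; [exact: connect_trans (step1 _ _ k1) (step2 _ _ k2) | exact: connect_trans (step1 _ _ k2) (step2 _ _ k1)].
have hcc2 : connect e0 (inl c) (inl c2).
  case E : (leL c c2); first by have [] := conn _ _ E hcu hc2u.
  by have [] := conn c2 c _ hc2u hcu; rewrite // lerNgt // /ltr E.
have /connectP[p hp El] := connect_trans hcc2 (step1 _ _ hc2).
case/shortenP: hp El => p' hp' hu' _ El.
(* The path cannot consist of the deleted edge alone, so that edge closes it into a genuine
   cycle. *)
have : 2 < size (inl c :: p').
  case: p' hp' hu' El => [|a [|b p']] //= /andP[h _] _ Ea.
  by move: h; rewrite -Ea /e0 eqxx andbF.
move/(acyc _ hu') => /negP[].
have sub : subrel e0 (fun x y => [&& x \in ext_vertices (Lsig s w) u, y \in ext_vertices (Lsig s w) u & ext_edge (Lsig s w) u x y]).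
  have vert a b : Eb (Lsig s w) u a b -> Lsig s w (a :: u) /\ Lsig s w (rcons u b).
    move=> h; split; apply: (Lsig_infix _ h); last exact: infix_cons.
    by rewrite -rcons_cons; apply: infix_rcons.
  move=> [a|a] [b|b] //= /andP[/= h _]; rewrite !inE h; have [-> ->] := vert _ _ h; done.
rewrite /cycle rcons_path (sub_path sub hp') /= -El.
have hy' : ext_edge (Lsig s w) u (inr d) (inl c) by [].
rewrite hy' andbT !inE; apply/andP; split; apply: (Lsig_infix _ hy).
  exact: infix_cons.
by rewrite -rcons_cons; apply: infix_rcons.
Qed.

(** In [s c ++ w] the word [w] occurs only at the two ends, so it no longer occurs once the first
    and last letters are removed. *)
Lemma block_in_L c : L (s c ++ w).
Proof.
apply: sig_in_L; first by apply/hasP; exists c; rewrite ?mem_enum ?infix_refl.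
move=> a u b E; apply/negP => /infixP[p [q Eu]].
have := @ret_occ _ _ _ Hret c (a :: p) (rcons q b).
rewrite E Eu /= -!cats1 -!catA => /(_ (erefl _))[//|h].
have := congr1 size E; rewrite /= Eu !size_cat size_rcons !size_cat /= in h *; lia.
Qed.

Lemma der_planar_morph : planar_morph s w leL leR.
Proof.
move=> u /andP[hu hn] c1 d1 c2 d2 h1 h2.
have hin c d : Eb (Lsig s w) u c d -> L (c :: rcons u d).
  by move=> h; apply: sig_in_L => // c' u' d' [_ /rcons_inj[<- _]].
exact: (good_planar G (hin _ _ h1) (hin _ _ h2)).
Qed.

Let block_long u (hu : L u) : M + size w <= size u -> infix w u := long_infix Hret HD hu.

Lemma derived_fac u v : infix u v -> derived v -> derived u.
Proof.
case/infixP=> a [b ->]; rewrite /derived !wimg_cat => h; apply: Lfac h.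
have [r Er] := wimg_pre Hret b.
by apply/infixP; exists (wimg s a), r; rewrite -!catA Er.
Qed.


Lemma derived_between v y : L (wimg s v ++ w ++ y ++ w) ->
  exists z, wimg s v ++ w ++ y ++ w = wimg s (v ++ z) ++ w /\ derived (v ++ z).
Proof.
move=> h; have [r Er] := wimg_pre Hret v.
have [||z Ez] := @decode _ _ _ Hret L HD _ (wimg s v ++ w ++ y) (r ++ y ++ w) h.
- by rewrite catA Er -catA.
- by rewrite -!catA.
have [z' Ez'] := wimg_prefix Hret Ez.
by exists z'; rewrite -Ez' -Ez; split=> //; rewrite /derived -Ez.
Qed.

Lemma derived_extR v : derived v -> exists d, derived (rcons v d).
Proof.
(* One letter more than is needed to meet [w]: the letter set aside makes that occurrence a new one,
   so that the decoded word [z] is nonempty. *)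
move=> hv; have [y hy hL] := ext_right (good_extR G) (M + size w).+1 hv.
case: y hy hL => // d0 y [hy] hL.
have /infixP[y1 [y2 E]] : infix w y.
  apply: block_long; last by rewrite hy.
  by apply: Lfac hL; rewrite -cat_rcons; apply: suffix_infix.
have [|z [Ez hz]] := @derived_between v (d0 :: y1).
  by apply: Lfac hL; apply/infixP; exists [::], y2; rewrite E /= -!catA /= -!catA.
case: z Ez hz => [|d z] Ez hz.
  by have := congr1 size Ez; rewrite cats0 !size_cat /= ?size_cat; lia.
by exists d; apply: derived_fac hz; rewrite -cat_rcons; apply: prefix_infix.
Qed.

Lemma derived_extL v : derived v -> exists c, derived (c :: v).
Proof.
move=> hv; have [y hy hL] := ext_left (good_extL G) (M + size w).+1 hv.
case/lastP: y hy hL => // y c0; rewrite size_rcons => -[hy] hL.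
have /infixP[y1 [y2 E]] : infix w y.
  apply: block_long; last by rewrite hy.
  by apply: Lfac hL; rewrite cat_rcons; apply: prefix_infix.
have hL' : L (wimg s [::] ++ w ++ (rcons y2 c0 ++ wimg s v) ++ w).
  by apply: Lfac hL; apply/infixP; exists y1, [::]; rewrite E cats0 /= -!cats1 -!catA.
have [z [/= Ez hz]] := derived_between hL'.
have [r Er] := wimg_pre Hret v.
have [|z1 [z2 [E1 E2]]] := @wimg_occ _ _ _ Hret z (w ++ rcons y2 c0) r.
  by rewrite -Ez -!catA Er.
have E3 : wimg s z2 = wimg s v.
  apply: (@cat_cancel _ (w ++ rcons y2 c0)); apply: (@cat_cancelr _ w).
  by rewrite {1}E2 -wimg_cat -E1 -Ez -!catA.
have {}E3 := ret_inj Hret E3; subst z2.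
case/lastP: z1 E1 E2 => [|z1 c] E1 E2.
  by have := congr1 size E2; rewrite size_cat size_rcons /=; lia.
exists c; apply: derived_fac hz; rewrite E1 cat_rcons; exact: suffix_infix.
Qed.

(** The words [x] and [p] after which the left and the right codes diverge surround [wimg s u];
    planarity of [x ++ wimg s u ++ p] in [L] is pulled back. *)
Lemma derived_planar u c1 d1 c2 d2 : derived (c1 :: rcons u d1) -> derived (c2 :: rcons u d2) ->
  ltr derL c1 c2 -> derR d1 d2.
Proof.
move=> h1 h2 hc.
case: (eqVneq d1 d2) => [->|nd]; first exact: (ler_refl _ derR_total).
have [x [_ x1 x2 nx]] := key_exists (codeL_free Hret) (TL_key s) (@AL_of_codeL _ s) (ltr_neq hc).
have [p [_ p1 p2 np]] := @key_exists _ _ (codeR_free Hret) _ id _ _ (TR_key s w) (@AR_intro _ s w) _ _ nd.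
have key c d : c \in AL s x -> d \in AR s w p -> derived (c :: rcons u d) ->
    L (phiL s x c :: rcons (x ++ wimg s u ++ p) (phiR s w p d)).
  case/AL_split=> y E /AR_split[y' E']; rewrite /derived wimg_cons wimg_rcons -!catA E'.
  move=> h; apply: Lfac h; apply/infixP; exists y, y'.
  by rewrite {1}E -!cats1 -!catA /= -!catA.
have k1 := key _ _ x1 p1 h1; have k2 := key _ _ x2 p2 h2.
have lx : ltr leL (phiL s x c1) (phiL s x c2).
  by rewrite /ltr nx andbT; apply: phiL_order_pres.
have lp := good_planar G k1 k2 lx.
rewrite lerNgt; last exact: derR_total.
apply/negP=> /(phiR_order_pres p2 p1) h; move/negP: np; apply; apply/eqP.
exact: (ler_anti HR lp h).
Qed.

Lemma extend_both u e f m : consecutive leL e f -> L (e :: u) -> L (f :: u) ->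
  exists y, [/\ size y = m, L (e :: u ++ y) & L (f :: u ++ y)].
Proof.
move=> hef h1 h2; elim: m => [|m [y [<- k1 k2]]]; first by exists [::]; rewrite cats0.
have [d [j1 j2]] := good_connected G hef k1 k2.
by exists (rcons y d); rewrite size_rcons -rcons_cat.
Qed.

(** The images of [c] and [c'] are consecutive, so a common right extension can be prolonged to the
    next [w], which yields a letter [d]. Desubstitution returns letters [g] and [g'] with the same
    images, possibly other than [c] and [c'], but [g <= c < c' <= g'], and planarity forces [d]
    after [c u] and [c' u] as well. *)
Lemma derived_connected u c c' : consecutive derL c c' -> derived (c :: u) ->
  derived (c' :: u) -> exists d, derived (c :: rcons u d) /\ derived (c' :: rcons u d).
Proof.
move=> hcc h h'; have Ho := derL_total; have Hr := derR_total.
have lcc := consecutive_lt hcc.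
have [x [_ x1 x2 nx]] := key_exists (codeL_free Hret) (TL_key s) (@AL_of_codeL _ s) (ltr_neq lcc).
have hef : consecutive leL (phiL s x c) (phiL s x c').
  exact: (ordlex_consecutive HL (codeL_free Hret) (uniq_TL s) (can_inj revK) (TL_key s) (@codeL_of_AL _ s) (@AL_of_codeL _ s) consecutive_AL hcc x1 x2 nx).
have lef := consecutive_lt hef.
have key a : a \in AL s x -> derived (a :: u) -> L (phiL s x a :: x ++ wimg s u ++ w).
  case/AL_split=> y E; rewrite /derived wimg_cons -!catA => k; apply: Lfac k.
  by rewrite E -catA; apply: suffix_infix.
have [y [hy k k']] := extend_both (M + size w).+1 hef (key _ x1 h) (key _ x2 h').
case: y hy k k' => // d0 y [hy] k k'.
have /infixP[y1 [y2 E]] : infix w y.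
  apply: block_long; last by rewrite hy.
  apply: Lfac k; rewrite -cat_cons -cat_rcons; exact: suffix_infix.
have hL' : L (wimg s u ++ w ++ (d0 :: y1) ++ w).
  apply: Lfac k; apply/infixP; exists (phiL s x c :: x), y2.
  by rewrite E /= -!catA /= -!catA.
have [z [Ez hz]] := derived_between hL'.
case: z Ez hz => [|d z] Ez hz.
  by have := congr1 size Ez; rewrite cats0 !size_cat /= ?size_cat; lia.
have lift a : L (a :: (x ++ wimg s u ++ w) ++ d0 :: y) ->
    exists2 g, g \in AL s x /\ phiL s x g = a & derived (g :: rcons u d).
  move=> ha; have ha' : L (a :: x ++ wimg s (rcons u d) ++ w).
    have [r Er] := wimg_pre Hret z.
    apply: Lfac ha; apply/infixP; exists [::], (r ++ y2); rewrite /=; congr cons.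
    rewrite -!catA; congr cat; rewrite E.
    transitivity ((wimg s u ++ w ++ (d0 :: y1) ++ w) ++ y2).
      by rewrite -!catA.
    have Er' : wimg s z ++ w ++ y2 = w ++ r ++ y2 by rewrite catA Er -catA.
    by rewrite Ez -cat_rcons wimg_cat -!catA Er'.
  have [f hf] := good_extR G ha'.
  have [g [t [g1 g2 _ _ g3]]] := desubstitute_AL_AR (first_occ_AL Hret x1) (last_occ_self w) hf.
  exists g => //; apply: derived_fac g3; rewrite -rcons_cons; exact: infix_rcons.
have [g [g1 g2] g3] := lift _ k; have [g' [g1' g2'] g3'] := lift _ k'.
have lg : derL g c.
  rewrite lerNgt //; apply/negP=> l.
  have l2 := consecutive_le Ho hcc l.
  case: (ler_eqVlt Ho l2) => [E0|/(phiL_order_pres x2 g1)]; first by move: nx; rewrite E0 g2 eqxx.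
  by rewrite g2 lerNgt // lef.
have lg' : derL c' g'.
  rewrite lerNgt //; apply/negP=> l.
  have l2 := consecutive_ge Ho hcc l.
  case: (ler_eqVlt Ho l2) => [E0|/(phiL_order_pres g1' x1)]; first by move: nx; rewrite -E0 g2' eqxx.
  by rewrite g2' lerNgt // lef.
exists d; split.
- case: (ler_eqVlt Ho lg) => [<- //|l1].
  have [f hf] := derived_extR h; rewrite rcons_cons in hf.
  have -> : d = f.
    apply: (ler_anti Hr); first exact: (derived_planar g3 hf l1).
    by apply: (derived_planar hf g3'); apply: ltr_le_trans lcc lg'.
  exact: hf.
- case: (ler_eqVlt Ho lg') => [-> //|l1].
  have [f hf] := derived_extR h'; rewrite rcons_cons in hf.
  have -> : d = f.
    apply: (ler_anti Hr); last exact: (derived_planar hf g3' l1).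
    by apply: (derived_planar g3 hf); apply: ler_lt_trans lg lcc.
  exact: hf.
Qed.

Lemma derived_recurrent u : derived u -> exists x, derived (u ++ x ++ u).
Proof.
move=> hu; have [x hx] := good_recurrent G hu.
rewrite -!catA in hx; have hx' : L (wimg s u ++ w ++ (x ++ wimg s u) ++ w).
  by rewrite -!catA.
have [z [Ez hz]] := derived_between hx'; set t := u ++ z in Ez hz.
have [r Er] := wimg_pre Hret u.
have [|z1 [z2 [E1 E2]]] := @wimg_occ _ _ _ Hret t (wimg s u ++ w ++ x) r.
  by rewrite -Ez -!catA Er.
have E3 : wimg s z2 = wimg s u.
  apply: (@cat_cancel _ (wimg s u ++ w ++ x)); apply: (@cat_cancelr _ w).
  by rewrite {1}E2 -wimg_cat -E1 -Ez -!catA.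
have {}E3 := ret_inj Hret E3; subst z2.
have [|z3 E4] := @wimg_prefix _ _ _ Hret u z1 (x ++ w); first by rewrite -E2 -!catA.
by exists z3; move: hz; rewrite E1 E4 -catA.
Qed.

Theorem derived_good : good derived derL derR.
Proof.
split.
- exact: derL_total.
- exact: derR_total.
- exact: derived_fac.
- exact: derived_extL.
- exact: derived_extR.
- by move=> c; rewrite /derived wimg1; apply: block_in_L.
- exact: derived_planar.
- exact: derived_connected.
- exact: derived_recurrent.
Qed.
End Derive.

(** * Languages of regular interval exchanges *)

(* MathComp reserves the delimiter R for [ring_scope]. *)
Delimit Scope R_scope with Re.

Lemma RplusA : associative Rplus.
Proof. by move=> x y z; lra. Qed.
Lemma RplusC : commutative Rplus.
Proof. by move=> x y; lra. Qed.
Lemma Rplus0 : left_id R0 Rplus.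
Proof. by move=> x; lra. Qed.
HB.instance Definition _ := Monoid.isComLaw.Build R R0 Rplus RplusA RplusC Rplus0.

Notation "\rsum_ ( i | P ) F" := (\big[Rplus/R0]_(i | P%B) F%Re)
  (at level 41, F at level 41, i at level 50).

(** * Stacking weights along a total order *)

Section Layout.
Variable A : finType.
Implicit Types (le : rel A) (m : A -> R).

Lemma rsum_filterE m (P : pred A) : rsum m [seq d <- enum A | P d] = \rsum_(d | P d) m d.
Proof.
have E s : rsum m s = \big[Rplus/R0]_(d <- s) m d.
  by elim: s => [|d s IH]; rewrite ?big_nil // big_cons -IH.
by rewrite E big_filter big_enum_cond.
Qed.

Lemma rsum_enum m : rsum m (enum A) = \rsum_(d | true) m d.
Proof. by rewrite -rsum_filterE filter_predT. Qed.

Lemma rsum_ge0 m (P : pred A) : (forall c, P c -> (0 <= m c)%Re) -> (0 <= \rsum_(d | P d) m d)%Re.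
Proof. by move=> h; apply: (big_ind (fun x => (0 <= x)%Re)) => //; [lra | move=> x y; lra]. Qed.

Lemma rsum_le m m' (P : pred A) : (forall c, P c -> (m c <= m' c)%Re) ->
  (\rsum_(d | P d) m d <= \rsum_(d | P d) m' d)%Re.
Proof. by move=> h; apply: (big_ind2 (fun x y => (x <= y)%Re)) => //; [lra | move=> x y z t; lra]. Qed.

Section OneLayout.
Variables (le : rel A) (m : A -> R).
Hypothesis H : total_order le.
Hypothesis m0 : forall c, (0 <= m c)%Re.

(** The weight [m] is kept general: besides interval lengths, it will be the weights of the
    one-letter extensions of a word. *)
Definition off c := \rsum_(d | ltr le d c) m d.

Lemma off_ge0 c : (0 <= off c)%Re.
Proof. exact: rsum_ge0. Qed.

Lemma off_first c : (forall d, le c d) -> off c = R0.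
Proof. by move=> h; apply: big1 => d; rewrite ltrNge // h. Qed.

Lemma off_succ c d : consecutive le c d -> off d = (off c + m c)%Re.
Proof.
move=> h; rewrite /off (bigD1 c) /=; last exact: consecutive_lt.
rewrite RplusC; congr Rplus; apply: eq_bigl => x.
apply/andP/idP => [[h1 h2]|h1].
  by rewrite /ltr h2 andbT; apply: consecutive_ge h1.
by split; [apply: ltr_trans H h1 (consecutive_lt h) | case/andP: h1].
Qed.

Lemma off_last c : (forall d, le d c) -> (off c + m c)%Re = \rsum_(d | true) m d.
Proof.
move=> h; rewrite (bigD1 c) //= RplusC; congr Rplus.
by apply: eq_bigl => x; rewrite /ltr h.
Qed.

Lemma off_mono c d : ltr le c d -> (off c + m c <= off d)%Re.
Proof.
move=> h; have [e he hed] := succ_exists H h.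
rewrite -(off_succ he).
case: (ler_eqVlt H hed) => [->|l]; first lra.
rewrite /off [X in (_ <= X)%Re](bigID (fun x => ltr le x e)) /=.
have -> : \rsum_(i | ltr le i d && ltr le i e) m i = \rsum_(i | ltr le i e) m i.
  apply: eq_bigl => x; apply: andb_idl => hx; exact: ltr_trans H hx l.
suff : (0 <= \rsum_(i | ltr le i d && ~~ ltr le i e) m i)%Re by lra.
exact: rsum_ge0.
Qed.

Lemma off_le c : (off c + m c <= \rsum_(d | true) m d)%Re.
Proof.
have [b hb] := max_exists c H; rewrite -(off_last hb).
case: (ler_eqVlt H (hb c)) => [->|/off_mono]; first lra.
have := m0 b; lra.
Qed.

Lemma off_locate t : (0 <= t < \rsum_(d | true) m d)%Re ->
  exists c, (off c <= t < off c + m c)%Re.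
Proof.
move=> [h1 h2]; apply: NNPP => hno.
case: (pickP (fun _ : A => true)) => [x _|h0]; last first.
  by rewrite big1 in h2; [lra | move=> i _; have := h0 i].
have [a ha] := min_exists x H; have [b hb] := max_exists x H.
suff : (off a <= t)%Re -> (off b <= t)%Re.
  rewrite (off_first ha) => /(_ h1) h3; apply: hno; exists b; split=> //.
  by rewrite (off_last hb).
apply: (@consecutive_ind _ le (fun x y => (off x <= t)%Re -> (off y <= t)%Re) a b H) => //.
  by move=> y z w k1 k2 /k1.
move=> y z _ _ hyz hy; rewrite (off_succ hyz); apply: Rnot_lt_le => hlt.
by apply: hno; exists y.
Qed.

Lemma off_unique c d t : (off c <= t < off c + m c)%Re -> (off d <= t < off d + m d)%Re -> c = d.
Proof.
move=> h1 h2; case: (eqVneq c d) => // ne; exfalso.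
by case: (ltr_total H ne) => /off_mono; lra.
Qed.
End OneLayout.
End Layout.

(** * Words coded by the points of an interval exchange *)

Section IETLanguage.
Variables (A : finType) (le1 le2 : rel A) (lam : A -> R).
Hypothesis HI : is_IET le1 le2 lam.

Let H1 : total_order le1. Proof. by case: HI. Qed.
Let H2 : total_order le2. Proof. by case: HI => _ []. Qed.
Let lam_gt0 c : (0 < lam c)%Re. Proof. by case: HI => _ [_ []]. Qed.
Let lam_ge0 c : (0 <= lam c)%Re. Proof. by have := lam_gt0 c; lra. Qed.
Let lam1 : \rsum_(d | true) lam d = R1.
Proof. by rewrite -rsum_enum; case: HI => _ [_ []]. Qed.

Notation T := (Tiet le1 le2 lam).
Notation lft := (lend le1 lam).
Notation ift := (iend le2 lam).
Notation inI := (inI le1 lam).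
Notation codes := (codes le1 le2 lam).
Definition shiftI c := (ift c - lft c)%Re.
Definition unitI t := (0 <= t < 1)%Re.

Lemma lendE c : lft c = off le1 lam c. Proof. exact: rsum_filterE. Qed.
Lemma iendE c : ift c = off le2 lam c. Proof. exact: rsum_filterE. Qed.

Lemma inI_unit c t : inI c t -> unitI t.
Proof.
rewrite /inI /Defs.inI lendE /unitI => h.
have := off_ge0 le1 lam_ge0 c; have := off_le H1 lam_ge0 c; rewrite lam1; lra.
Qed.

Lemma inI_unique c d t : inI c t -> inI d t -> c = d.
Proof. by rewrite /Defs.inI !lendE; apply: off_unique. Qed.

Lemma inI_exists t : unitI t -> exists c, inI c t.
Proof.
move=> h; have [|c hc] := @off_locate _ le1 lam H1 t; first by rewrite lam1.
by exists c; rewrite /Defs.inI lendE.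
Qed.

Lemma inI_lend c : inI c (lft c).
Proof. by split; [lra | have := lam_gt0 c; lra]. Qed.

Lemma inIbP c t : reflect (inI c t) (inIb le1 lam c t).
Proof.
rewrite /inIb /Defs.inI; case: Rle_dec => h1; last by apply: ReflectF => -[].
by case: Rlt_dec => h2; [apply: ReflectT | apply: ReflectF => -[]].
Qed.

Lemma TietE c t : inI c t -> T t = (t + shiftI c)%Re.
Proof.
move=> h; rewrite /Tiet; case: pickP => [d /inIbP hd|h0].
  by rewrite (inI_unique h hd) /shiftI.
by have := h0 c; move/inIbP: h => ->.
Qed.

Lemma T_image c t : inI c t -> (ift c <= T t < ift c + lam c)%Re.
Proof. by move=> h; rewrite (TietE h) /shiftI; case: h; lra. Qed.

Lemma ift_unit c y : (ift c <= y < ift c + lam c)%Re -> unitI y.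
Proof.
rewrite iendE /unitI => h.
have := off_ge0 le2 lam_ge0 c; have := off_le H2 lam_ge0 c; rewrite lam1; lra.
Qed.

Lemma ift_unique c d y : (ift c <= y < ift c + lam c)%Re -> (ift d <= y < ift d + lam d)%Re -> c = d.
Proof. by rewrite !iendE; apply: off_unique. Qed.

Lemma T_back c y : (ift c <= y < ift c + lam c)%Re -> inI c (y - shiftI c)%Re /\ T (y - shiftI c)%Re = y.
Proof.
move=> h; have h' : inI c (y - shiftI c)%Re by rewrite /Defs.inI /shiftI; lra.
by split=> //; rewrite (TietE h'); lra.
Qed.

Lemma T_unit t : unitI t -> unitI (T t).
Proof. by case/inI_exists => c /T_image/ift_unit. Qed.

Lemma ift_exists y : unitI y -> exists c, (ift c <= y < ift c + lam c)%Re.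
Proof.
move=> h; have [|c hc] := @off_locate _ le2 lam H2 y; first by rewrite lam1.
by exists c; rewrite iendE.
Qed.

Lemma T_inj t t' : unitI t -> unitI t' -> T t = T t' -> t = t'.
Proof.
move=> /inI_exists[c hc] /inI_exists[d hd] E.
have E' : c = d by apply: (ift_unique (T_image hc)); rewrite E; apply: T_image.
by subst d; move: E; rewrite (TietE hc) (TietE hd); lra.
Qed.

Lemma iterT_unit n t : unitI t -> unitI (iter n T t).
Proof. by move=> h; elim: n => //= n; apply: T_unit. Qed.

Lemma iterT_inj n t t' : unitI t -> unitI t' -> iter n T t = iter n T t' -> t = t'.
Proof.
move=> h h'; elim: n => //= n IH E; apply: IH.
by apply: T_inj E; apply: iterT_unit.
Qed.

Lemma codes_cat t u v : codes t (u ++ v) <-> codes t u /\ codes (iter (size u) T t) v.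
Proof.
elim: u t => [|c u IH] t /=; first by split=> [h|[]].
by rewrite -iterS iterSr; split=> [[h1 /IH[]]|[[h1 h2] h3]]; [split | split=> //; apply/IH].
Qed.

Lemma codes_rcons t u d : codes t (rcons u d) <-> codes t u /\ inI d (iter (size u) T t).
Proof. by rewrite -cats1 codes_cat /=; split=> -[? []]. Qed.

Lemma codes_shift t t' u : codes t u -> codes t' u ->
  (iter (size u) T t - iter (size u) T t' = t - t')%Re.
Proof.
elim: u t t' => [|c u IH] t t' //= [h1 h2] [h3 h4].
by rewrite -iterS iterSr -iterS iterSr (IH _ _ h2 h4) (TietE h1) (TietE h3); lra.
Qed.

Lemma codes_convex t t' x u : codes t u -> codes t' u -> (t <= x <= t')%Re -> codes x u.
Proof.
elim: u t t' x => [|c u IH] t t' x //= [h1 h2] [h3 h4] h.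
have hx : inI c x by case: h1 h3 => ? ? [? ?]; split; lra.
split=> //; apply: (IH (T t) (T t')) => //.
by rewrite (TietE h1) (TietE h3) (TietE hx); lra.
Qed.

Lemma codes_unique t u v : codes t u -> codes t v -> size u = size v -> u = v.
Proof.
elim: u t v => [|c u IH] t [|d v] //= [h1 h2] [h3 h4] [h].
by rewrite (inI_unique h1 h3) (IH _ _ h2 h4 h).
Qed.

Definition langI u := exists t, unitI t /\ codes t u.

Lemma langI_fac u v : infix u v -> langI v -> langI u.
Proof.
case/infixP=> a [b ->] [t [ht]]; rewrite codes_cat => -[_]; rewrite codes_cat => -[h _].
by exists (iter (size a) T t); split=> //; apply: iterT_unit.
Qed.

Lemma langI_extR u : langI u -> exists d, langI (rcons u d).
Proof.
case=> t [ht hu]; have [d hd] := inI_exists (iterT_unit (size u) ht).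
by exists d, t; rewrite codes_rcons.
Qed.

Lemma langI_extL u : langI u -> exists c, langI (c :: u).
Proof.
case=> t [ht hu]; have [c hc] := ift_exists ht; have [h1 h2] := T_back hc.
by exists c, (t - shiftI c)%Re; split; [apply: inI_unit h1 | rewrite /= h2].
Qed.

Lemma langI_letter c : langI [:: c].
Proof. by exists (lft c); split; [apply: inI_unit (inI_lend c) | split=> //; apply: inI_lend]. Qed.

Lemma langI_consP c u : langI (c :: u) <->
  exists y, (ift c <= y < ift c + lam c)%Re /\ codes y u.
Proof.
split=> [[t [ht /= [hc hu]]]|[y [hy hu]]]; first by exists (T t); split=> //; apply: T_image.
have [h1 h2] := T_back hy.
by exists (y - shiftI c)%Re; split; [apply: inI_unit h1 | rewrite /= h2].
Qed.

Lemma ift_lt c d x y : ltr le2 c d -> (ift c <= x < ift c + lam c)%Re ->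
  (ift d <= y < ift d + lam d)%Re -> (x < y)%Re.
Proof. by rewrite !iendE => /(off_mono H2 lam_ge0); lra. Qed.

Lemma lft_le c d x y : inI c x -> inI d y -> (x <= y)%Re -> le1 c d.
Proof.
rewrite /Defs.inI !lendE => h1 h2 h; rewrite lerNgt //; apply/negP=> /(off_mono H1 lam_ge0).
lra.
Qed.

Lemma langI_planar u c1 d1 c2 d2 : langI (c1 :: rcons u d1) -> langI (c2 :: rcons u d2) ->
  ltr le2 c1 c2 -> le1 d1 d2.
Proof.
move=> /langI_consP[x [hx /codes_rcons[kx dx]]] /langI_consP[y [hy /codes_rcons[ky dy]]] h.
have hxy := ift_lt h hx hy.
apply: (lft_le dx dy); have := codes_shift kx ky; lra.
Qed.

Hypothesis HReg : regular_IET le1 le2 lam.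

Lemma lft_unit c : unitI (lft c).
Proof. exact: inI_unit (inI_lend c). Qed.

(** For distinct letters two orbits would meet; for a single one the orbit would be periodic, hence
    finite. *)
Lemma no_connection c d k : lft c <> R0 -> lft d <> R0 ->
  iter k.+1 T (lft c) = lft d -> False.
Proof.
move=> hc hd E; case: HReg => hinf hdis.
case: (eqVneq c d) => [Ecd|/eqP ne]; last first.
  by apply: (hdis c d hc hd ne (lft d)); [exists k.+1; left | exists 0; left].
subst d; set z := lft c in E.
have per n : iter (n * k.+1) T z = z.
  by elim: n => // n IH; rewrite mulSn iterD IH.
have red n : iter n T z = iter (n %% k.+1) T z.
  by rewrite {1}(divn_eq n k.+1) addnC iterD per.
have [z' [ho hn]] := hinf c hc (map (fun i => iter i T z) (iota 0 k.+1)).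
have inl n : List.In (iter n T z) (map (fun i => iter i T z) (iota 0 k.+1)).
  rewrite red; have := ltn_pmod n (ltn0Sn k); move: (n %% _) => i hi.
  have : i \in iota 0 k.+1 by rewrite mem_iota.
  elim: (iota 0 k.+1) => //= a s IH; rewrite inE => /orP[/eqP->|/IH]; auto.
case: ho => n [E'|E']; first by apply: hn; rewrite -E'.
(* The relation [orbit] ranges over all reals. Outside the unit interval [T] is the identity, so
   such a [z'] never reaches [lft c]. *)
case: (classic (unitI z')) => hz'.
  have : iter n T z' = iter n T (iter (n * k) T z).
    by rewrite -iterD -mulnS per.
  by move/(iterT_inj hz' (iterT_unit _ (lft_unit c))) => Ez; apply: hn; rewrite Ez.
apply: (hz'); have : iter n T z' = z'.
  elim: n {E'} => //= n ->; rewrite /Tiet; case: pickP => // d /inIbP/inI_unit.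
  by move=> /hz'.
by rewrite E' => <-; apply: lft_unit.
Qed.

Lemma lft_eq0 c : lft c = R0 -> forall d, le1 c d.
Proof.
rewrite lendE => h d; rewrite lerNgt //; apply/negP => /(off_mono H1 lam_ge0).
have := lam_gt0 d; have := off_ge0 le1 lam_ge0 d; lra.
Qed.

(* [ift c] is the image of [lft c], or the second image of a nonzero left endpoint when
   [lft c = 0]. *)
Lemma no_connection_image c d k : ift c <> R0 -> lft d <> R0 ->
  iter k T (ift c) = lft d -> False.
Proof.
move=> hc hd E.
have Tl e : T (lft e) = ift e.
  by rewrite (TietE (inI_lend e)) /shiftI; lra.
case: (Req_dec (lft c) R0) => h0; last first.
  by apply: (no_connection (k := k) h0 hd); rewrite iterSr Tl.
have [a ha] := min_exists c H2.
have ia : ift a = R0 by rewrite iendE; apply: off_first.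
have hla : lft a <> R0.
  move=> h; apply: hc.
  suff -> : c = a by [].
  exact: (ler_anti H1 (lft_eq0 h0 a) (lft_eq0 h c)).
by apply: (no_connection (k := k.+1) hla hd); rewrite iterSr iterSr Tl ia -h0 Tl.
Qed.

(** The common endpoint [q] of the two image intervals codes [u], by convexity. The letter [d] read
    after it serves [c']; it serves [c] too, through points just left of [q], unless [q] is sent
    exactly to [lft d], which is a connection. *)
Lemma langI_connected u c c' : consecutive le2 c c' -> langI (c :: u) -> langI (c' :: u) ->
  exists d, langI (c :: rcons u d) /\ langI (c' :: rcons u d).
Proof.
move=> hcc /langI_consP[x [hx kx]] /langI_consP[y [hy ky]].
have Eq : ift c' = (ift c + lam c)%Re by rewrite !iendE (off_succ _ H2 hcc).
set q := ift c' in Eq hy.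
have kq : codes q u by apply: (codes_convex kx ky); lra.
have hq : (ift c' <= q < ift c' + lam c')%Re by rewrite -/q; have := lam_gt0 c'; lra.
have [d hd] := inI_exists (iterT_unit (size u) (ift_unit hq)).
exists d; split; last first.
  by apply/langI_consP; exists q; split=> //; apply/codes_rcons.
have hx1 := codes_shift kx kq.
have q0 : q <> R0 by have := off_ge0 le2 lam_ge0 c; rewrite -iendE; have := lam_gt0 c; lra.
case: (Req_dec (iter (size u) T q) (lft d)) => [E|ne].
  case: (Req_dec (lft d) R0) => hd0; last by case: (no_connection_image q0 hd0 E).
  have : unitI (iter (size u) T x) by apply: iterT_unit; apply: ift_unit hx.
  rewrite /unitI; lra.
(* The second bound is the point sent to [lft d] by the translation that moves the points coding
   [u]; staying right of [x] keeps the code. *)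
pose t := Rmax x (q - (iter (size u) T q - lft d))%Re.
case: (hd) => hd1 hd2.
have ht : (x <= t < q)%Re by rewrite /t /Rmax; case: Rle_dec => ?; lra.
have ht2 : (q - (iter (size u) T q - lft d) <= t)%Re by apply: Rmax_r.
have kt : codes t u by apply: (codes_convex kx kq); lra.
apply/langI_consP; exists t; split; first lra.
apply/codes_rcons; split=> //; have := codes_shift kt kq; rewrite /Defs.inI; lra.
Qed.

(** Truncated at zero because the ends of an empty box may be in the wrong order. *)
Definition len (l h : R) := Rmax R0 (h - l)%Re.

(** The piece containing [l] starts there; remove it and go on from its right end. *)
Lemma interval_sum (I : eqType) (s : seq I) (f g : I -> R) l h : uniq s ->
  (forall t, (l <= t < h)%Re <-> exists2 i, i \in s & (f i <= t < g i)%Re) ->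
  (forall i j t, i \in s -> j \in s -> (f i <= t < g i)%Re -> (f j <= t < g j)%Re -> i = j) ->
  len l h = \big[Rplus/R0]_(i <- s) len (f i) (g i).
Proof.
have [n] := ubnP (size s); elim: n s l h => // n IH s l h hn us cov dis.
case: (Rlt_le_dec l h) => hlh; last first.
  rewrite big1_seq => [|i /andP[_ hi]]; rewrite /len Rmax_left //; first lra.
  apply: Rnot_lt_le => hlt; have := cov (f i); case=> _ [|h1 h2]; last lra.
  by exists i => //; lra.
have [i hi hil] : exists2 i, i \in s & (f i <= l < g i)%Re by apply/cov; lra.
have fi : f i = l.
  suff : (l <= f i)%Re by lra.
  by have := cov (f i); case=> _ [|h1 h2]; [exists i => //; lra | lra].
have gi : (g i <= h)%Re.
  apply: Rnot_lt_le => hlt; have := cov h; case=> _ [|h1 h2]; last lra.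
  by exists i => //; lra.
rewrite (perm_big _ (perm_to_rem hi)) /= big_cons -(IH (rem i s) (g i) h).
- rewrite /len fi; rewrite !Rmax_right; lra.
- by rewrite size_rem //; case: (s) hi hn => // a s'; rewrite /= ltnS.
- exact: rem_uniq.
- move=> t; split=> [ht|[j]].
    have [j hj1 hj2] : exists2 j, j \in s & (f j <= t < g j)%Re by apply/cov; lra.
    exists j => //; rewrite mem_rem_uniq // inE hj1 andbT.
    by apply/eqP=> E; subst j; lra.
  rewrite mem_rem_uniq // inE => /andP[/eqP ne hj] ht.
  have ht' : (l <= t < h)%Re by apply/cov; exists j.
  split; last lra; apply: Rnot_lt_le => hlt; apply: ne.
  by apply: (dis j i t) => //; lra.
- by move=> a b t; rewrite !mem_rem_uniq // !inE => /andP[_ ha] /andP[_ hb]; apply: dis.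
Qed.

Fixpoint box (u : seq A) : R * R :=
  if u is c :: u' then
    (Rmax (lft c) ((box u').1 - shiftI c), Rmin (lft c + lam c) ((box u').2 - shiftI c))%Re
  else (R0, R1).

Lemma boxP u t : ((box u).1 <= t < (box u).2)%Re <-> unitI t /\ codes t u.
Proof.
elim: u t => [|c u IH] t /=; first by split=> [|[]].
have X : (Rmax (lft c) ((box u).1 - shiftI c) <= t < Rmin (lft c + lam c) ((box u).2 - shiftI c))%Re
   <-> inI c t /\ ((box u).1 <= t + shiftI c < (box u).2)%Re.
  rewrite /Defs.inI /Rmax /Rmin; case: Rle_dec => ?; case: Rle_dec => ?; lra.
rewrite X; split=> [[h1 /IH[h2 h3]]|[h1 [h2 h3]]].
  by split; [apply: inI_unit h1 | rewrite (TietE h1)].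
by split=> //; apply/IH; rewrite -(TietE h2); split=> //; apply: T_unit.
Qed.

Definition mass u := len (box u).1 (box u).2.

Lemma mass_ge0 u : (0 <= mass u)%Re.
Proof. exact: Rmax_l. Qed.

Lemma mass_nil : mass [::] = R1.
Proof. by rewrite /mass /len /= Rmax_right; lra. Qed.

Lemma mass_langI u : langI u <-> (0 < mass u)%Re.
Proof.
rewrite /mass /len; split=> [[t /boxP h]|h].
  by rewrite Rmax_right; lra.
exists (box u).1; apply/boxP; move: h; rewrite /Rmax; case: Rle_dec => ?; lra.
Qed.

Lemma mass_right u : \rsum_(d | true) mass (rcons u d) = mass u.
Proof.
rewrite /mass; symmetry; rewrite -big_enum /=.
apply: (@interval_sum _ _ (fun d => (box (rcons u d)).1) (fun d => (box (rcons u d)).2)).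
- exact: enum_uniq.
- move=> t; rewrite boxP; split=> [[h1 h2]|[d _ /boxP[h1 /codes_rcons[h2 _]]]] //.
  have [d hd] := inI_exists (iterT_unit (size u) h1).
  by exists d; rewrite ?mem_enum //; apply/boxP; rewrite codes_rcons.
- move=> d e t _ _ /boxP[_ /codes_rcons[_ h1]] /boxP[_ /codes_rcons[_ h2]].
  exact: inI_unique h1 h2.
Qed.

(** [T] translates the box of [c :: u] onto the part of the box of [u] inside the image of the
    interval of [c]; these parts tile the box of [u]. *)
Lemma mass_left u : \rsum_(c | true) mass (c :: u) = mass u.
Proof.
rewrite /mass; symmetry; rewrite -big_enum /=.
rewrite (@interval_sum _ (enum A) (fun c => (box (c :: u)).1 + shiftI c)%Re (fun c => (box (c :: u)).2 + shiftI c)%Re).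
- by apply: eq_bigr => c _; rewrite /len /=; congr Rmax; lra.
- exact: enum_uniq.
- have X c t : ((box (c :: u)).1 + shiftI c <= t < (box (c :: u)).2 + shiftI c)%Re <->
     ((ift c <= t < ift c + lam c)%Re /\ codes t u).
    have -> : ((box (c :: u)).1 + shiftI c <= t < (box (c :: u)).2 + shiftI c)%Re <->
       ((box (c :: u)).1 <= t - shiftI c < (box (c :: u)).2)%Re by lra.
    rewrite boxP; split=> [[_ [h1 h2]]|[h1 h2]].
      have := T_image h1; have := TietE h1; have -> : (t - shiftI c + shiftI c)%Re = t by lra.
      by move=> E; rewrite E in h2 *.
    have [k1 k2] := T_back h1; split; first exact: inI_unit k1.
    by split=> //; rewrite k2.
  move=> t; rewrite boxP; split=> [[h1 h2]|[c _ /X[h1 h2]]].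
    by have [c hc] := ift_exists h1; exists c; rewrite ?mem_enum //; apply/X.
  by split=> //; apply: ift_unit h1.
- move=> c d t _ _; set bx := box; rewrite /= => h1 h2.
  suff X a : (((box (a :: u)).1 + shiftI a <= t < (box (a :: u)).2 + shiftI a)%Re -> (ift a <= t < ift a + lam a)%Re).
    exact: ift_unique (X c h1) (X d h2).
  move=> h; have : ((box (a :: u)).1 <= t - shiftI a < (box (a :: u)).2)%Re by lra.
  case/boxP=> _ [k _]; have := T_image k; rewrite (TietE k).
  by have -> : (t - shiftI a + shiftI a)%Re = t by lra.
Qed.
End IETLanguage.

(** * Recurrence for an invariant weight *)

Section Weights.
Variables (A : finType) (mu : seq A -> R).
Hypothesis mu_ge0 : forall u, (0 <= mu u)%Re.
Hypothesis mu_nil : mu [::] = R1.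
Hypothesis mu_left : forall u, \rsum_(c | true) mu (c :: u) = mu u.
Hypothesis mu_right : forall u, \rsum_(d | true) mu (rcons u d) = mu u.

Fixpoint wsum n (f : seq A -> R) : R :=
  if n is n'.+1 then \rsum_(c | true) wsum n' (fun v => f (c :: v)) else f [::].

Lemma wsum_ext n f g : (forall v, size v = n -> f v = g v) -> wsum n f = wsum n g.
Proof.
elim: n f g => [|n IH] f g h /=; first exact: h.
by apply: eq_bigr => c _; apply: IH => v hv; apply: h; rewrite /= hv.
Qed.

Lemma wsum_cat m n f : wsum (m + n) f = wsum m (fun z => wsum n (fun v => f (z ++ v))).
Proof. by elim: m f => [|m IH] f //=; apply: eq_bigr => c _; rewrite IH. Qed.

Lemma wsum_plus n f g : wsum n (fun v => f v + g v)%Re = (wsum n f + wsum n g)%Re.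
Proof.
elim: n f g => [|n IH] f g //=; rewrite -big_split /=.
by apply: eq_bigr => c _; rewrite IH.
Qed.

Lemma wsum_le n f g : (forall v, size v = n -> (f v <= g v)%Re) -> (wsum n f <= wsum n g)%Re.
Proof.
elim: n f g => [|n IH] f g h /=; first exact: h.
by apply: rsum_le => c _; apply: IH => v hv; apply: h; rewrite /= hv.
Qed.

Lemma wsum_rsum n (f : A -> seq A -> R) :
  wsum n (fun v => \rsum_(c | true) f c v) = \rsum_(c | true) wsum n (f c).
Proof.
elim: n f => [|n IH] f //=; rewrite exchange_big /=.
by apply: eq_bigr => d _; rewrite IH.
Qed.

Lemma wsum_exchange m n (f : seq A -> seq A -> R) :
  wsum m (fun z => wsum n (fun v => f z v)) = wsum n (fun v => wsum m (fun z => f z v)).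
Proof.
elim: m f => [|m IH] f //=; rewrite wsum_rsum.
by apply: eq_bigr => c _; rewrite IH.
Qed.

Lemma wsum_left m v : wsum m (fun z => mu (z ++ v)) = mu v.
Proof.
elim: m => [|m IH] //=; rewrite -wsum_rsum -[RHS]IH.
by apply: wsum_ext => z _; rewrite mu_left.
Qed.

Lemma wsum_right n z : wsum n (fun v => mu (z ++ v)) = mu z.
Proof.
elim: n z => [|n IH] z /=; first by rewrite cats0.
rewrite -[RHS]mu_right; apply: eq_bigr => c _; rewrite -IH.
by apply: wsum_ext => v _; rewrite cat_rcons.
Qed.

Lemma wsum_zero n : wsum n (fun=> R0) = R0.
Proof. by elim: n => //= n IH; rewrite big1. Qed.

Lemma wsum_pick u g : wsum (size u) (fun z => if z == u then g z else R0) = g u.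
Proof.
elim: u g => [|c u IH] g //=.
rewrite (bigD1 c) //= [X in Rplus _ X]big1 => [|d ne].
  rewrite -(IH (fun z => g (c :: z))).
  by rewrite RplusC Rplus0; apply: wsum_ext => v _; rewrite eqseq_cons eqxx.
rewrite -[RHS](wsum_zero (size u)); apply: wsum_ext => v _.
by rewrite eqseq_cons (negbTE ne).
Qed.

(* Poincare recurrence: if the occurrences of [u] at the multiples of [size u] never met
   twice in a word of positive weight, their weights would add up beyond the total 1. *)
Lemma weight_recurrent u : (0 < mu u)%Re -> exists x, (0 < mu (u ++ x ++ u))%Re.
Proof.
move=> hu; apply: NNPP => hno.
have hz x : mu (u ++ x ++ u) = R0.
  have := mu_ge0 (u ++ x ++ u); case=> // h; by case: hno; exists x.
set m := size u.
(* Tests whether [u] is one of the first [K] successive blocks of length [m] of [v]. *)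
pose hit := fix hit K v := if K is K'.+1 then (take m v == u) || hit K' (drop m v) else false.
have hitP K v : hit K v -> infix u v.
  elim: K v => //= K IH v /orP[/eqP E|/IH /infixP[a [b E]]].
    by rewrite -(cat_take_drop m v) E; apply/infixP; exists [::], (drop m v).
  by rewrite -(cat_take_drop m v) E; apply: infix_catl; exact: infix_infix.
have mono a b : mu (a ++ b) = R0 -> forall c, mu (a ++ b ++ c) = R0.
  move=> h c; have := wsum_right (size c) (a ++ b); rewrite h => E.
  have := mu_ge0 (a ++ b ++ c).
  suff : (mu (a ++ b ++ c) <= wsum (size c) (fun v => mu ((a ++ b) ++ v)))%Re by rewrite E; lra.
  rewrite -(wsum_pick c (fun z => mu (a ++ b ++ z))).
  by apply: wsum_le => z _; rewrite catA; case: ifP => _; [lra | apply: mu_ge0].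
(* Weights of hits at different places add up exactly, since a word with two hits has weight
   zero. *)
have meas K : wsum (K * m) (fun v => if hit K v then mu v else R0) = (INR K * mu u)%Re.
  elim: K => [|K IH]; first by rewrite /= Rmult_0_l.
  rewrite mulSn wsum_cat.
  transitivity (wsum m (fun z => wsum (K * m) (fun v => (if z == u then mu (z ++ v) else R0)
     + (if hit K v then mu (z ++ v) else R0))%Re)).
    apply: wsum_ext => z hzs; apply: wsum_ext => v _ /=.
    rewrite take_size_cat // drop_size_cat //.
    case: eqP => [E|_] /=; case E2 : (hit K v); try lra.
    case/infixP: (hitP _ _ E2) => a [b ->]; rewrite E.
    have M : mu (u ++ a ++ u ++ b) = R0 by rewrite catA; apply: mono; rewrite -catA.
    by rewrite M; lra.
  rewrite (wsum_ext (g := fun z => (if z == u then mu z else R0) +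
     wsum (K * m) (fun v => if hit K v then mu (z ++ v) else R0))%Re); last first.
    move=> z _; rewrite wsum_plus; congr Rplus.
    case: ifP => _; [exact: wsum_right | exact: wsum_zero].
  rewrite wsum_plus wsum_pick wsum_exchange S_INR.
  rewrite (wsum_ext (n := K * m) (g := fun v => if hit K v then mu v else R0)); last first.
    move=> v _; case: ifP => _; [exact: wsum_left | exact: wsum_zero].
  rewrite IH; lra.
have le1 K : (INR K * mu u <= 1)%Re.
  suff : (INR K * mu u <= mu [::])%Re by rewrite mu_nil.
  rewrite -meas -(wsum_right (K * m) [::]); apply: wsum_le => v _ /=.
  by case: ifP => _; [lra | apply: mu_ge0].
have [K hK] := INR_unbounded (/ mu u)%Re.
have := le1 K; have := Rinv_l (mu u) ltac:(lra) => h1 h2.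
have : (/ mu u * mu u < INR K * mu u)%Re by apply: Rmult_lt_compat_r.
lra.
Qed.
End Weights.

Theorem langI_good (A : finType) (le1 le2 : rel A) (lam : A -> R) :
  is_IET le1 le2 lam -> regular_IET le1 le2 lam -> good (langI le1 le2 lam) le2 le1.
Proof.
move=> HI HReg; have [h1 [h2 _]] := HI; split=> //.
- exact: (langI_fac HI).
- exact: (langI_extL HI).
- exact: (langI_extR HI).
- exact: (langI_letter HI).
- exact: (langI_planar HI).
- exact: (langI_connected HI HReg).
- move=> u /(mass_langI HI) hu.
  have [x hx] := weight_recurrent (mass_ge0 le1 le2 lam) (mass_nil le1 le2 lam)
     (mass_left HI) (mass_right HI) hu.
  by exists x; apply/(mass_langI HI).
Qed.

(** * Irreducibility and primitivity *)

Section Irreducible.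
Variables (A : finType) (L : seq A -> Prop) (leL leR : rel A).
Hypothesis G : good L leL leR.

Lemma ksmallest_down (le : rel A) k x y : total_order le -> le x y ->
  y \in ksmallest le k -> x \in ksmallest le k.
Proof.
move=> H h; rewrite !inE; apply: leq_ltn_trans; apply: subset_leq_card.
by apply/subsetP=> z; rewrite !inE => hz; apply: ltr_le_trans H hz h.
Qed.

Lemma good_path (P : pred A) g t h : (forall x y, L [:: x; y] -> P x -> P y) ->
  L (g :: rcons t h) -> P g -> P h.
Proof.
move=> st; elim: t g => [|x t IH] g hL hg; first exact: st hL hg.
apply: (IH x); first by apply: good_consl G _ _ hL.
apply: (st g) => //; apply: (good_fac G) hL; apply/infixP; exists [::], (rcons t h); by [].
Qed.

(** If both orders had the same [k] smallest letters [B], take consecutive [c] in [B] and [c']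
    outside, with a common successor [g]. By planarity, [g] in [B] makes [B] closed under
    successors, and [g] outside makes the complement closed. A return from [g] to [c'] or to [c]
    contradicts this. *)
Lemma good_irreducible : irreducible leL leR.
Proof.
move=> k /andP[k0 kn]; apply/eqP => E.
have HL := good_L G; have HR := good_R G.
pose B := ksmallest leL k.
have dL x y : leL x y -> y \in B -> x \in B by apply: ksmallest_down.
have dR x y : leR x y -> y \in B -> x \in B by rewrite /B E; apply: ksmallest_down.
have [x0 _] : exists x : A, true by case/card_gt0P: (leq_ltn_trans (leq0n k) kn) => x; exists x.
have [m hm] := min_exists x0 HL; have [M hM] := max_exists x0 HL.
have mB : m \in B.
  rewrite inE; suff -> : [set d | ltr leL d m] = set0 by rewrite cards0.
  by apply/setP=> d; rewrite !inE ltrNge // hm.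
have MB : M \notin B.
  rewrite inE -leqNgt; suff -> : [set d | ltr leL d M] = [set~ M] by rewrite cardsC1; lia.
  by apply/setP=> d; rewrite !inE /ltr hM.
have [c [c' [hcc cB cB']]] : exists c c', [/\ consecutive leL c c', c \in B & c' \notin B].
  apply: NNPP => hno; move/negP: MB; apply.
  apply: (@consecutive_ind _ leL (fun x y => x \in B -> y \in B) m M HL) => //.
    by move=> y x z h1 h2 /h1.
  move=> x y _ _ hxy hx; apply: NNPP => /negP hy; apply: hno; by exists x, y.
have [g [/= hg hg']] := good_connected G hcc (good_letter G c) (good_letter G c').
have lcc := consecutive_lt hcc.
case gB : (g \in B).
- have [x hx] := good_recurrent G hg'.
  have : c' \in B.
    apply: (@good_path (mem B) g x c') => //; last first.
      apply: (good_fac G) hx; apply/infixP; exists [:: c'], [:: g].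
      by rewrite /= cat_rcons.
    move=> y z hyz yB; apply: (dR _ g) => //.
    apply: (good_planar G (u := [::]) hyz hg').
    rewrite ltrNge //; apply/negP=> h; move/negP: cB'; apply; exact: dL h yB.
  by rewrite (negbTE cB').
- have [x hx] := good_recurrent G hg.
  have : c \notin B.
    apply: (@good_path (fun z => z \notin B) g x c) => //; last by rewrite gB.
      move=> y z hyz yB; apply/negP => zB; move/negP: gB; apply; apply: (dR _ z) => //.
      apply: (good_planar G (u := [::]) hg hyz).
      rewrite ltrNge //; apply/negP=> h; move/negP: yB; apply; exact: dL h cB.
    apply: (good_fac G) hx; apply/infixP; exists [:: c], [:: g].
    by rewrite /= cat_rcons.
  by rewrite cB.
Qed.
End Irreducible.

Section ReturnExtra.
Variables (A : finType) (s : morph A) (w : seq A).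
Hypothesis Hret : ret_for s w.

Lemma infix_decode v z : infix (wimg s v ++ w) (wimg s z) -> infix v z.
Proof.
case/infixP=> p [q E]; have [r Er] := wimg_pre Hret v.
have [|z1 [z2 [Ez Ep]]] := @wimg_occ _ _ _ Hret z p (r ++ q ++ w).
  by rewrite E Er -!catA.
have [|z3 Ez3] := @wimg_prefix _ _ _ Hret v z2 (q ++ w).
  apply: (@cat_cancel _ p); have -> : p ++ wimg s v ++ w ++ q ++ w = wimg s z ++ w.
    by rewrite E -!catA.
  by rewrite Ez wimg_cat -catA -Ep.
by rewrite Ez Ez3; apply: infix_infix.
Qed.

Lemma size_wimg z : size z <= size (wimg s z).
Proof.
elim: z => // c z IH; rewrite wimg_cons size_cat /=.
by have := ret_nonerasing Hret c; lia.
Qed.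

Lemma ret_nil_size c : w = [::] -> size (s c) = 1.
Proof.
move=> E; have := ret_nonerasing Hret c; case Es : (s c) => [//|x t] _.
have := @ret_occ _ _ _ Hret c [:: x] t; rewrite E /= cats0 Es => /(_ (erefl _))[//|h]; exact: esym h.
Qed.
End ReturnExtra.

(** * Compositions of return morphisms *)

Section Towers.
Variables (A : finType) (sg : nat -> morph A) (w : nat -> seq A).
Hypothesis Hw : forall n, ret_for (sg n) (w n).

(** Plays for the composition of [k] morphisms from level [n] the role of [w] for one: an image
    followed by it begins with it. *)
Fixpoint Wd n k : seq A := if k is k'.+1 then wimg (sg n) (Wd n.+1 k') ++ w n else [::].

Lemma compw_cat n k u v : compw sg n k (u ++ v) = compw sg n k u ++ compw sg n k v.
Proof. by elim: k n => //= k IH n; rewrite IH wimg_cat. Qed.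

Lemma size_compw n k u : size u <= size (compw sg n k u).
Proof. by elim: k n => //= k IH n; apply: leq_trans (IH _) (size_wimg (Hw n) _). Qed.

Lemma Wd_prefix n k v : exists r, compw sg n k v ++ Wd n k = Wd n k ++ r.
Proof.
elim: k n => [|k IH] n /=; first by exists v; rewrite cats0.
have [r Er] := IH n.+1; have [r' Er'] := wimg_pre (Hw n) r.
by exists r'; rewrite catA -wimg_cat Er wimg_cat -!catA Er'.
Qed.

Lemma size_Wd n j k : size (Wd (n + j) k) <= size (Wd n (j + k)).
Proof.
elim: j n => [|j IH] n; first by rewrite addn0.
rewrite -(addSnnS n j) (addSn j k) /= size_cat; apply: leq_trans (IH _) _.
by have := size_wimg (Hw n) (Wd n.+1 (j + k)); lia.
Qed.

Lemma Wd_long : (forall n, exists j, w (n + j) != [::]) -> forall M n, exists k, M <= size (Wd n k).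
Proof.
move=> H; elim=> [|M IH] n; first by exists 0.
have [j hj] := H n; have [k hk] := IH (n + j).+1.
exists (j + k.+1); apply: leq_trans (size_Wd _ _ _); rewrite /= size_cat.
have := size_wimg (Hw (n + j)) (Wd (n + j).+1 k).
by case: (w (n + j)) hj => //= x t _; lia.
Qed.

Lemma size_compw1 n k c : (forall j, w (n + j) = [::]) -> size (compw sg n k [:: c]) = 1.
Proof.
elim: k n => //= k IH n h.
have := IH n.+1 (fun j => _); rewrite -/compw.
have h' j : w (n.+1 + j) = [::] by rewrite addSnnS.
move=> /(_ h'); case: (compw sg n.+1 k [:: c]) => [|x [|y t]] // _.
by rewrite wimg1; apply: (ret_nil_size (Hw n)); rewrite -(addn0 n).
Qed.

Variable Lg : nat -> seq A -> Prop.
Hypothesis LgS : forall n v, Lg n.+1 v <-> derived (sg n) (w n) (Lg n) v.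

Lemma Lg_compw n k v : Lg (n + k) v -> Lg n (compw sg n k v ++ Wd n k).
Proof.
elim: k n => [|k IH] n; first by rewrite addn0 cats0.
by rewrite -addSnnS => /IH/LgS; rewrite /derived /= wimg_cat -catA.
Qed.

Variables (leL leR : nat -> rel A).
Hypothesis Gd : forall n, good (Lg n) (leL n) (leR n).
Hypothesis Lg_Ln : forall n u, Lg n u -> Ln sg n u.
Hypothesis HA : 1 < #|A|.

(** With empty return words from [n] on, all compositions would send letters to letters, and no word
    of length two could occur. *)
Lemma w_often n : exists j, w (n + j) != [::].
Proof.
apply: NNPP => hno.
have h j : w (n + j) = [::] by apply/eqP; apply: contraT => hj; case: hno; exists j.
case/card_gt0P: (ltnW HA) => c _.
have [y hy hL] := ext_right (good_extR (Gd n)) 1 (good_letter (Gd n) c).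
have [N [d [_ hi]]] := Lg_Ln hL.
by have := size_infix hi; rewrite size_compw1 // size_cat hy.
Qed.

(* If [C = compw sg n k [:: c]] were short, then [Wd n k], a prefix of [C ++ Wd n k], would
   have the small period [size C], although it contains a long right special word
   followed by two distinct letters. *)
Lemma towers_primitive : primitive_seq sg.
Proof.
move=> n; have G := Gd n.
have [M hM] : exists M, forall z, Lg n z -> M <= size z -> forall d, d \in z.
  have H d := good_uniformly_recurrent G (good_letter G d).
  have [F hF] := fin_all_exists H; exists (\max_d F d) => z hz hs d.
  have : infix [:: d] z by apply: hF => //; apply: leq_trans hs; exact: leq_bigmax.
  by case/infixP=> a [b ->]; rewrite mem_cat mem_cat mem_head orbT.
have /card_gt1P[x [y [_ _ nxy]]] := HA.
have [e [f hef]] : exists e f, consecutive (leR n) e f.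
  case: (ltr_total (good_R G) nxy) => h; have [s hs _] := succ_exists (good_R G) h.
    by exists x, s.
  by exists y, s.
have [u [hu h1 h2]] := good_long_special (good_rev G) M hef.
rewrite !rev_cons in h1 h2; set v := rev u in h1 h2.
have hv : size v = M by rewrite size_rev.
have [M1 hM1] := good_uniformly_recurrent G h1.
have [M2 hM2] := good_uniformly_recurrent G h2.
(* Long enough for [Wd n k] to contain both [rcons v e] and [rcons v f]; the successor forces [k] to
   be positive. *)
have [k hk] := Wd_long w_often (M1 + M2).+1 n.
have k0 : 0 < k by case: k hk.
exists (n + k); split; first lia.
rewrite addKn => c d.
have hc := Lg_compw (good_letter (Gd (n + k)) c).
apply: hM.
  by apply: (good_fac G) hc; apply: prefix_infix.
rewrite leqNgt; apply/negP => hq.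
set C := compw sg n k [:: c] in hc hq; set W := Wd n k in hk hc.
have q0 : 0 < size C by have := size_compw n k [:: c].
have hW : Lg n W by apply: (good_fac G) hc; apply: suffix_infix.
have [r Er] := Wd_prefix n k [:: c]; rewrite -/C -/W in Er.
have per i : i + size C < size W -> nth c W (i + size C) = nth c W i.
  move=> hi; have := congr1 (fun t => nth c t (i + size C)) Er.
  rewrite nth_cat ltnNge leq_addl /= addnK => ->.
  by rewrite nth_cat hi.
have key g : infix (rcons v g) W -> g = nth c v (M - size C).
  case/infixP=> p [t E].
  have hs := congr1 size E; rewrite !size_cat size_rcons hv in hs.
  have P := per (size p + (M - size C)).
  have e1 : size p + (M - size C) + size C = size p + M by lia.
  rewrite e1 in P; have := P ltac:(rewrite hs; lia).
  have nthW j : j < M.+1 -> nth c W (size p + j) = nth c (rcons v g) j.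
    by move=> hj; rewrite E nth_cat ltnNge leq_addr /= addKn nth_cat size_rcons hv hj.
  rewrite !nthW; try lia; rewrite !nth_rcons hv ltnn eqxx => ->.
  by have -> : M - size C < M by lia.
have E1 := key e (hM1 _ hW ltac:(lia)); have E2 := key f (hM2 _ hW ltac:(lia)).
by move: (consecutive_neq hef); rewrite E1 {1}E2 eqxx.
Qed.
End Towers.

(** * From an interval exchange to a path *)

Section Orbits.
Variables (A : finType) (le1 le2 : rel A) (lam : A -> R).
Hypothesis HI : is_IET le1 le2 lam.
Notation T := (Tiet le1 le2 lam).

Lemma biinfinite_coding t : unitI t -> exists x : biseq A,
  (forall n, codes le1 le2 lam t [seq x (Z.of_nat k) | k <- iota 0 n]) /\
  (forall u, factor x u -> exists y, unitI y /\ codes le1 le2 lam y u).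
Proof.
move=> ht.
have [a _] := inI_exists HI ht.
have [letter hletter] : exists f : R -> A, forall y, unitI y -> inI le1 lam (f y) y.
  apply: (functional_choice (fun y c => unitI y -> inI le1 lam c y)) => y.
  by have [/(inI_exists HI)[c hc]|hn] := classic (unitI y); [exists c | exists a].
have [Tinv hTinv] : exists f : R -> R, forall y, unitI y -> unitI (f y) /\ T (f y) = y.
  apply: (functional_choice (fun y z => unitI y -> unitI z /\ T z = y)) => y.
  have [/(ift_exists HI)[c hc]|hn] := classic (unitI y); last by exists y.
  have [h1 h2] := T_back HI hc; exists (y - shiftI le1 le2 lam c)%Re => _.
  by split=> //; apply: (inI_unit HI h1).
pose orb (i : Z) := if (0 <=? i)%Z then iter (Z.to_nat i) T t else iter (Z.to_nat (- i)) Tinv t.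
have orbU i : unitI (orb i).
  rewrite /orb; case: ifP => _; first exact: (iterT_unit HI).
  by elim: (Z.to_nat _) => //= n /hTinv[].
have orbS i : T (orb i) = orb (i + 1)%Z.
  rewrite /orb; case: Z.leb_spec => h.
    case: Z.leb_spec => h2; last by lia.
    by have -> : Z.to_nat (i + 1) = (Z.to_nat i).+1 by lia.
  have E : Z.to_nat (- i) = (Z.to_nat (- (i + 1))).+1 by lia.
  rewrite E /=; set n := Z.to_nat _.
  have hU : unitI (iter n Tinv t) by elim: n {E} => //= n /hTinv[].
  have [_ ->] := hTinv _ hU; case: Z.leb_spec => // h2.
  rewrite /n; have E1 : Z.to_nat (i + 1) = 0 by clear -h2 h; lia.
  have E2 : Z.to_nat (- (i + 1)) = 0 by clear -h2 h; lia.
  by rewrite E1 E2.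
pose x : biseq A := fun i => letter (orb i).
have cod i n : codes le1 le2 lam (orb i) [seq x (i + Z.of_nat k)%Z | k <- iota 0 n].
  elim: n i => //= n IH i; split.
    by rewrite /x Z.add_0_r; apply: hletter.
  rewrite orbS; have := IH (i + 1)%Z; congr (codes _ _ _ _ _).
  rewrite -(addn0 1) iotaDl -map_comp; apply: eq_map => k /=; congr x; lia.
exists x; split=> [n|u [i ->]]; last by exists (orb i); split.
exact: (cod 0%Z n).
Qed.

Lemma langI_factor u : langI le1 le2 lam u -> exists x : biseq A,
  factor x u /\ (forall v, factor x v -> exists y, unitI y /\ codes le1 le2 lam y v).
Proof.
case=> t [ht hu]; have [x [h1 h2]] := biinfinite_coding ht.
exists x; split=> //; exists 0%Z.
apply: (codes_unique HI hu); last by rewrite size_map size_iota.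
exact: h1.
Qed.
End Orbits.

Section Step.
Variables (A : finType) (s : morph A) (w : seq A).
Hypothesis Hret : ret_for s w.
Variables (L : seq A -> Prop) (leL leR : rel A).
Hypothesis G : good L leL leR.
Hypothesis HD : forall u, L u -> exists z, infix u (wimg s z).
Hypothesis Hdend : dendric s w.

Lemma mc_eq_perm (G1 G2 G3 : seq {set A}) : perm_eq G1 G2 -> mc_eq G2 G3 -> mc_eq G1 G3.
Proof. by move=> h; apply: perm_trans; apply: perm_filter. Qed.

Lemma order_pres_rev (D : {set A}) phi (pre le : rel A) :
  order_pres D phi pre (rev_order le) -> order_pres D phi (rev_order pre) le.
Proof. by move=> h x y hx hy; rewrite (ltr_rev pre) => hxy; exact: (h y x hy hx hxy). Qed.

(** The letters at which two codes diverge decide both derived orders. *)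
Lemma derL_rev a b : ltr (derL s leL) a b -> ltr (derL s (rev_order leL)) b a.
Proof.
move=> h; have [x [_ xa xb ne]] := key_exists (codeL_free Hret) (TL_key s) (@AL_of_codeL _ s) (ltr_neq h).
have HL' := rev_order_total (good_L G).
apply: (ordlex_lt HL' (codeL_free Hret) (@codeL_of_AL _ s) xb xa).
rewrite (ltr_rev leL) /ltr ne andbT.
by apply: (phiL_order_pres G).
Qed.

(** An order and its reverse have the same path graph, so validity for the flipped language also
    holds from the unflipped vertex. *)
Lemma flipped_left_valid : left_valid (Gord leL) s (Gord (derL s (rev_order leL))).
Proof.
have [h1 [h2 [h3 [h4 [h5 h6]]]]] := der_left_valid Hret (good_flip G) HD.
split; [|split; [|split; [|split; [|split]]]] => //.
by apply: mc_eq_perm h4; apply: Gord_rev_perm (good_L G).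
Qed.

Lemma flipped_right_valid : right_valid w (Gord leR) s (Gord (derR s w (rev_order leR))).
Proof.
have [h1 [h2 [h3 [h4 [h5 h6]]]]] := der_right_valid Hret (good_flip G) HD.
split; [|split; [|split; [|split; [|split]]]] => //.
by apply: mc_eq_perm h4; apply: Gord_rev_perm (good_R G).
Qed.

Lemma flipped_planar_pres : planar_pres s w (rev_order (derL s (rev_order leL)))
  (rev_order (derR s w (rev_order leR))) leL leR.
Proof.
have [h1 h2] := der_planar_pres s w (good_flip G).
by split=> x hx; apply: order_pres_rev; [apply: h1 | apply: h2].
Qed.
End Step.

Section Forward.
Variables (A : finType) (S : morph A -> Prop) (a b : A).
Hypothesis HA : 1 < #|A|.
Hypothesis Hab : a != b.
Hypothesis HS : forall s, S s -> dendric_return s.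
Variables (X : biseq A -> Prop) (sg : nat -> morph A).
Hypothesis Hrep : S_adic_rep S X sg.

Section Vertices.
Variable w : nat -> seq A.

(** When the derived left order puts [b] before [a], the orders are reversed before deriving; this
    uses the second alternative of the edge condition. *)
Definition next_vertex n (p : vertex A) : vertex A :=
  let q := (derL (sg n) p.1, derR (sg n) (w n) p.2) in
  if ltr q.1 a b then q
  else (derL (sg n) (rev_order p.1), derR (sg n) (w n) (rev_order p.2)).

Fixpoint vertices (p : vertex A) n : vertex A :=
  if n is n'.+1 then next_vertex n' (vertices p n') else p.

Fixpoint languages (L : seq A -> Prop) n : seq A -> Prop :=
  if n is n'.+1 then derived (sg n') (w n') (languages L n') else L.
End Vertices.

Lemma Ln_desubstitute n u : Ln sg n u -> exists z, infix u (wimg (sg n) z).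
Proof.
case=> N [c [h hi]]; exists (compw sg n.+1 (N - n.+1) [:: c]).
by move: hi; have -> : N - n = (N - n.+1).+1 by lia.
Qed.

Lemma good_path_exists (L : seq A -> Prop) leL leR : good L leL leR -> ltr leL a b ->
  (forall u, L u -> Ln sg 0 u) ->
  primitive_seq sg /\ exists v, labels_path a b S sg v.
Proof.
move=> G0 hab hL.
have [w hw] : exists w : nat -> seq A, forall n, ret_word (sg n) (w n) /\ dendric (sg n) (w n).
  apply: (functional_choice (fun n u => ret_word (sg n) u /\ dendric (sg n) u)) => n.
  by apply: HS; case: Hrep.
have hr n : ret_for (sg n) (w n) by case: (hw n) => -[].
have hd n : dendric (sg n) (w n) by case: (hw n).
pose V := vertices w (leL, leR); pose Lg := languages w L.
have inv n : [/\ good (Lg n) (V n).1 (V n).2, ltr (V n).1 a b & forall u, Lg n u -> Ln sg n u].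
  elim: n => [|n [G h hLn]]; first by split.
  have HD u : Lg n u -> exists z, infix u (wimg (sg n) z).
    by move=> /hLn; apply: Ln_desubstitute.
  have G1 : good (Lg n.+1) (V n.+1).1 (V n.+1).2.
    rewrite /V /= /next_vertex /=; case: ifP => _ /=.
      exact: (derived_good (hr n) G HD (hd n)).
    exact: (derived_good (hr n) (good_flip G) HD (hd n)).
  split=> //.
    rewrite /V /= /next_vertex /=; case: ifP => //= /negbT hn.
    have Ho := derL_total (hr n) G.
    have : ltr (derL (sg n) (vertices w (leL, leR) n).1) b a.
      by case: (ltr_total Ho Hab) => // h'; rewrite h' in hn.
    exact: (derL_rev (hr n) G).
  (* Two extra letters exclude [N = n.+1], where the preimage is a single letter, since [Ln] at
     level [n.+1] asks for a larger [N]. *)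
  move=> u hu; have [y hy huy] := ext_right (good_extR G1) 2 hu.
  have := hLn _ huy; case=> N [c [hN]].
  have E : N - n = (N - n.+1).+1 by lia.
  rewrite E => /(infix_decode (hr n)) hi.
  exists N, c; split; last first.
    by apply: infix_trans hi; apply: prefix_infix.
  rewrite ltn_neqAle hN andbT; apply/eqP=> EN.
  have := size_infix hi; rewrite -EN subnn /= size_cat hy; lia.
split.
  apply: (@towers_primitive _ sg w hr Lg _ (fun n => (V n).1) (fun n => (V n).2)) => //.
  - by move=> n; case: (inv n).
  - by move=> n u hu; case: (inv n) => _ _; apply.
exists V => n; have [G h hLn] := inv n; split.
  split; [exact: good_L G | split; [exact: good_R G | split=> //]].
  exact: good_irreducible G.
have HD u : Lg n u -> exists z, infix u (wimg (sg n) z).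
  by move=> /hLn; apply: Ln_desubstitute.
split; first by case: Hrep.
exists (w n); split; first by case: (hw n).
rewrite /V /= /next_vertex /=; case: ifP => _ /=.
  split; first exact: (der_left_valid (hr n) G HD).
  split; first exact: (der_right_valid (hr n) G HD).
  split; first exact: (der_planar_morph (hr n) G HD (hd n)).
  by left; apply: (der_planar_pres _ _ G).
split; first exact: (flipped_left_valid (hr n) G HD).
split; first exact: (flipped_right_valid (hr n) G HD).
split; first exact: (der_planar_morph (hr n) G HD (hd n)).
by right; apply: (flipped_planar_pres _ _ G).
Qed.

Theorem coding_path : coding_regular_IET X ->
  primitive_seq sg /\ exists v, labels_path a b S sg v.
Proof.
case=> le1 [le2 [lam [HI [HReg Hnat]]]].
have G := langI_good HI HReg.
have hL u : langI le1 le2 lam u -> Ln sg 0 u.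
  move=> /(langI_factor HI)[x [hx hall]].
  have /(proj2 Hrep) : X x by apply/Hnat => v /hall[y [[h1 h2] h3]]; exists y.
  exact.
case: (ltr_total (good_L G) Hab) => h; first exact: good_path_exists G h hL.
apply: (good_path_exists (good_flip G)) => //.
by rewrite (ltr_rev le2).
Qed.
End Forward.

(** * Word frequencies *)

Lemma free_ultrafilter : exists U : (nat -> Prop) -> Prop,
  [/\ forall P Q, U P -> U Q -> U (fun k => P k /\ Q k),
      forall P Q : nat -> Prop, (forall k, P k -> Q k) -> U P -> U Q,
      ~ U (fun _ => False),
      forall P, U P \/ U (fun k => ~ P k)
    & forall N, U (fun k => N <= k)].
Proof.
have [U [HU sub]] := filter.ultraFilterLemma filter.eventually_filter.
have HF : filter.Filter U by apply: filter.filter_filter.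
exists U; split.
- by move=> P Q; apply: filter.filterI.
- by move=> P Q h; apply: filter.filterS.
- exact: filter.filter_not_empty.
- by move=> P; apply: filter.in_ultra_setVsetC.
- by move=> N; apply: sub; exists N.
Qed.

(** * Limits along an ultrafilter *)

Section Limits.
Variable U : (nat -> Prop) -> Prop.
Hypothesis UI : forall P Q, U P -> U Q -> U (fun k => P k /\ Q k).
Hypothesis US : forall P Q : nat -> Prop, (forall k, P k -> Q k) -> U P -> U Q.
Hypothesis U0 : ~ U (fun _ => False).
Hypothesis UC : forall P, U P \/ U (fun k => ~ P k).
Hypothesis UT : forall N, U (fun k => N <= k).

Definition ulim (f : nat -> R) x := forall e, (0 < e)%Re -> U (fun k => (Rabs (f k - x) < e)%Re).

Lemma ulim_exists f : (forall k, (0 <= f k <= 1)%Re) -> exists x, ulim f x.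
Proof.
move=> hf; pose E y := U (fun k => (y <= f k)%Re).
have [|| x [hx1 hx2]] := completeness E.
- exists 1%Re => y hy; apply: Rnot_lt_le => h; apply: U0; apply: US hy => k.
  by have := hf k; lra.
- by exists 0%Re; apply: (US _ (UT 0)) => k _; have := hf k; lra.
exists x => e he.
have h1 : U (fun k => (x - e / 2 <= f k)%Re).
  apply: NNPP => h; have : is_upper_bound E (x - e / 2)%Re.
    move=> y hy; apply: Rnot_lt_le => hlt; apply: h; apply: US hy => k; lra.
  by move=> /hx2; lra.
have h2 : U (fun k => (f k < x + e / 2)%Re).
  case: (UC (fun k => (x + e / 2 <= f k)%Re)) => h; first by have := hx1 _ h; lra.
  by apply: US h => k; lra.
apply: (US _ (UI h1 h2)) => k [k1 k2]; apply: Rabs_def1; lra.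
Qed.

Lemma ulim_unique f x y : ulim f x -> ulim f y -> x = y.
Proof.
move=> hx hy; case: (Req_dec x y) => // ne; exfalso.
have he : (0 < Rabs (x - y) / 2)%Re by have := Rabs_pos_lt (x - y) ltac:(lra); lra.
apply: U0; apply: (US _ (UI (hx _ he) (hy _ he))) => k [].
rewrite /Rabs; do 3 case: Rcase_abs => ?; lra.
Qed.

Lemma ulim_plus f g x y : ulim f x -> ulim g y -> ulim (fun k => f k + g k)%Re (x + y)%Re.
Proof.
move=> hx hy e he; have he2 : (0 < e / 2)%Re by lra.
apply: (US _ (UI (hx _ he2) (hy _ he2))) => k [].
rewrite /Rabs; do 3 case: Rcase_abs => ?; lra.
Qed.

Lemma ulim_const c : ulim (fun=> c) c.
Proof. by move=> e he; apply: (US _ (UT 0)) => k _; rewrite Rminus_diag Rabs_R0. Qed.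

Lemma ulim_close f g x : ulim f x ->
  (forall e, (0 < e)%Re -> exists N, forall k, N <= k -> (Rabs (f k - g k) < e)%Re) -> ulim g x.
Proof.
move=> hx h e he; have he2 : (0 < e / 2)%Re by lra.
have [N hN] := h _ he2.
apply: (US _ (UI (hx _ he2) (UT N))) => k [] h1 /hN; move: h1.
rewrite /Rabs; do 3 case: Rcase_abs => ?; lra.
Qed.

Lemma ulim_ge f x c N : ulim f x -> (forall k, N <= k -> (c <= f k)%Re) -> (c <= x)%Re.
Proof.
move=> hx h; apply: Rnot_lt_le => hlt; have he : (0 < c - x)%Re by lra.
apply: U0; apply: (US _ (UI (hx _ he) (UT N))) => k [] h1 /h; move: h1.
rewrite /Rabs; case: Rcase_abs => ?; lra.
Qed.

Lemma ulim_ext f g x : (forall k, f k = g k) -> ulim f x -> ulim g x.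
Proof. by move=> h hx e /hx; apply: US => k; rewrite h. Qed.

Lemma ulim_rsum (A : finType) (f : A -> nat -> R) (x : A -> R) :
  (forall c, ulim (f c) (x c)) -> ulim (fun k => \rsum_(c | true) f c k) (\rsum_(c | true) x c).
Proof.
move=> h; rewrite -big_enum /=.
apply: (@ulim_ext (fun k => \big[Rplus/R0]_(c <- enum A) f c k)) => [k|].
  by rewrite big_enum.
elim: (enum A) => [|c s IH].
  by rewrite big_nil; apply: ulim_ext (ulim_const R0) => k; rewrite big_nil.
by rewrite big_cons; apply: ulim_ext (ulim_plus (h c) IH) => k; rewrite big_cons.
Qed.
End Limits.

Section Counting.
Variable A : finType.
Implicit Types (u z : seq A).

(** The end of [z] counts as a position, so the empty word has [(size z).+1] occurrences; this is
    the denominator of [fr] and gives [mu [::] = R1]. *)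
Fixpoint cnt u z : nat := if z is y :: z' then prefix u z + cnt u z' else prefix u [::].

Lemma cnt0 u : cnt u [::] = prefix u [::].
Proof. by []. Qed.

Lemma cntS u y z : cnt u (y :: z) = prefix u (y :: z) + cnt u z.
Proof. by []. Qed.

Lemma cnt_le u z : cnt u z <= (size z).+1.
Proof.
elim: z => [|y z IH]; first by rewrite cnt0 leq_b1.
by rewrite cntS -add1n; apply: leq_add => //; apply: leq_b1.
Qed.

Lemma cnt_nil z : cnt [::] z = (size z).+1.
Proof. by elim: z => // y z IH; rewrite cntS IH prefix0s. Qed.

Lemma cnt_small u z : size z < size u -> cnt u z = 0.
Proof.
elim: z => [|y z IH] h; first by rewrite cnt0; case: u h.
have hz : size z < size u by apply: ltn_trans h.
rewrite cntS (IH hz) addn0; case E : (prefix u (y :: z)) => //.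
by have := size_prefix E; rewrite leqNgt h.
Qed.

Lemma cnt_infix u z : 0 < cnt u z -> infix u z.
Proof.
elim: z => [|y z IH]; first by rewrite cnt0; case: u.
rewrite cntS; case E : (prefix u (y :: z)) => h; first by rewrite infix_consl E.
by rewrite -cat1s; apply: infix_catl; apply: IH.
Qed.

Lemma infix_cnt u z : infix u z -> 0 < cnt u z.
Proof.
elim: z => [|y z IH]; first by rewrite cnt0; case: u.
by rewrite infix_consl cntS => /orP[->|/IH] //; rewrite addn_gt0 orbC => ->.
Qed.

Lemma cnt_cat u z1 z2 : u != [::] -> cnt u z1 + cnt u z2 <= cnt u (z1 ++ z2).
Proof.
move=> hu; elim: z1 => [|y z IH]; first by rewrite cnt0; case: u hu.
rewrite cat_cons !cntS -addnA; apply: leq_add => //.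
case E : (prefix u (y :: z)) => //; case/prefixP: E => t E.
by rewrite -cat_cons E -catA prefix_prefix.
Qed.

Lemma sum_prefix_cons u y z : \sum_(c : A) prefix (c :: u) (y :: z) = prefix u z :> nat.
Proof.
rewrite (bigD1 y) //= eqxx /= big1 ?addn0 // => c ne.
by rewrite (negbTE ne).
Qed.

Lemma cnt_left u z : \sum_(c : A) cnt (c :: u) z + prefix u z = cnt u z.
Proof.
elim: z => [|y z IH]; first by rewrite big1.
rewrite cntS addnC; congr addn; rewrite -IH addnC -(sum_prefix_cons u y z) -big_split.
by apply: eq_bigr => c _; rewrite cntS.
Qed.

Lemma prefix_rcons_split u z : prefix u z = \sum_(d : A) prefix (rcons u d) z + (u == z) :> nat.
Proof.
elim: u z => [|c u IH] [|y z] /=.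
- by rewrite big1.
- rewrite (bigD1 y) //= eqxx prefix0s /= big1 // => d ne; by rewrite (negbTE ne).
- by rewrite big1.
- rewrite eqseq_cons; case: (c == y); last by rewrite big1.
  exact: IH.
Qed.

Lemma cnt_right u z : \sum_(d : A) cnt (rcons u d) z <= cnt u z <= (\sum_(d : A) cnt (rcons u d) z).+1.
Proof.
elim: z => [|y z IH].
  by rewrite big1 => [|d _]; [case: u | case: u].
have E : \sum_(d : A) cnt (rcons u d) (y :: z) =
    \sum_(d : A) prefix (rcons u d) (y :: z) + \sum_(d : A) cnt (rcons u d) z.
  by rewrite -big_split.
have E2 : cnt u (y :: z) = prefix u (y :: z) + cnt u z by [].
rewrite E E2 prefix_rcons_split; move: IH; case: (eqVneq u (y :: z)) => [Eu _|_ /andP[h1 h2]].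
  have -> : cnt u z = 0 by apply: cnt_small; rewrite Eu.
  have -> : \sum_(d : A) cnt (rcons u d) z = 0.
    by apply: big1 => d _; apply: cnt_small; rewrite Eu size_rcons /=; lia.
  by apply/andP; split; lia.
by apply/andP; split; lia.
Qed.
End Counting.

Section Frequencies.
Variables (A : finType) (L : seq A -> Prop) (W : nat -> seq A).
Hypothesis LW : forall k u, infix u (W k) -> L u.
Hypothesis Wlong : forall M, exists N, forall k, N <= k -> M <= size (W k).
Hypothesis Wrec : forall u, L u -> u != [::] -> exists M N, forall k, N <= k ->
  size (W k) < M * cnt u (W k).

Definition fr u k := (INR (cnt u (W k)) / INR (size (W k)).+1)%Re.

Lemma fr_bound u k : (0 <= fr u k <= 1)%Re.
Proof.
have h0 : (0 < INR (size (W k)).+1)%Re by apply: lt_0_INR; apply/ltP.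
have h1 : (INR (cnt u (W k)) <= INR (size (W k)).+1)%Re.
  by apply: le_INR; apply/leP; apply: cnt_le.
have h2 := pos_INR (cnt u (W k)).
rewrite /fr; split; first by apply: Rmult_le_pos => //; left; apply: Rinv_0_lt_compat.
by apply: (Rmult_le_reg_r (INR (size (W k)).+1)) => //; rewrite /Rdiv Rmult_assoc Rinv_l; lra.
Qed.

(** Extending occurrences by one letter loses at most one of them, at an end of [W k]; the limit
    does not see it. *)
Lemma fr_close (m n : nat -> nat) : (forall k, m k <= n k <= (m k).+1) ->
  forall e, (0 < e)%Re -> exists N, forall k, N <= k ->
  (Rabs (INR (m k) / INR (size (W k)).+1 - INR (n k) / INR (size (W k)).+1) < e)%Re.
Proof.
move=> h e he; have [M hM] := INR_unbounded (/ e)%Re.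
have [N hN] := Wlong M; exists N => k /hN hk.
have hs : (INR M < INR (size (W k)).+1)%Re by apply: lt_INR; apply/ltP.
have he' : (0 < / e)%Re by apply: Rinv_0_lt_compat.
set s := INR (size (W k)).+1 in hs *.
have hs0 : (0 < s)%Re by lra.
have hd : (0 <= INR (n k) - INR (m k) <= 1)%Re.
  have /andP[h1 h2] := h k; have := le_INR _ _ (elimT leP h1); have := le_INR _ _ (elimT leP h2).
  rewrite S_INR; lra.
have -> : (INR (m k) / s - INR (n k) / s = - ((INR (n k) - INR (m k)) / s))%Re by rewrite /Rdiv; lra.
rewrite Rabs_Ropp Rabs_right; last first.
  by apply: Rle_ge; apply: Rmult_le_pos; [lra | left; apply: Rinv_0_lt_compat].
apply: (Rmult_lt_reg_r s) => //; rewrite /Rdiv Rmult_assoc Rinv_l; last lra.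
have : (e * / e < e * s)%Re by apply: Rmult_lt_compat_l; lra.
rewrite Rinv_r; lra.
Qed.

Lemma INR_rsum (f : A -> nat) s : (s <> 0)%Re ->
  (INR (\sum_(c : A) f c) / s)%Re = \rsum_(c | true) (INR (f c) / s)%Re.
Proof.
move=> hs; apply: (big_rec2 (fun (x : nat) y => (INR x / s)%Re = y)); first by rewrite /= /Rdiv; lra.
by move=> i x y _ <-; rewrite plus_INR /Rdiv; lra.
Qed.

Lemma frequencies_exist : exists mu : seq A -> R,
  [/\ forall u, (0 <= mu u)%Re, mu [::] = R1,
      forall u, \rsum_(c | true) mu (c :: u) = mu u,
      forall u, \rsum_(d | true) mu (rcons u d) = mu u
    & forall u, L u <-> (0 < mu u)%Re].
Proof.
have [U [UI US U0 UC UT]] := free_ultrafilter.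
have [mu hmu] : exists mu : seq A -> R, forall u, ulim U (fr u) (mu u).
  apply: (functional_choice (fun u x => ulim U (fr u) x)) => u.
  by apply: (ulim_exists UI US U0 UC UT); apply: fr_bound.
have hs k : (INR (size (W k)).+1 <> 0)%Re by have := lt_0_INR (size (W k)).+1 (elimT ltP (ltn0Sn _)); lra.
have ge0 u : (0 <= mu u)%Re.
  by apply: (ulim_ge UI US U0 UT (N := 0) (hmu u)) => k _; have := fr_bound u k; lra.
have muL : L [::] by apply: (LW (k := 0)); apply: infix0s.
have nil1 : mu [::] = R1.
  apply: (ulim_unique UI US U0 (hmu [::])).
  apply: (ulim_ext US (f := fun=> R1)) (ulim_const US UT R1) => k.
  by rewrite /fr cnt_nil /Rdiv Rinv_r.
exists mu; split=> //.
- move=> u; apply: (ulim_unique UI US U0 _ (hmu u)).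
  apply: (ulim_close UI US UT (ulim_rsum UI US UT (fun c => hmu (c :: u)))).
  move=> e he; have [|N hN] := fr_close (m := fun k => \sum_(c : A) cnt (c :: u) (W k)) (n := fun k => cnt u (W k)) _ he.
    by move=> k; rewrite -cnt_left; case: (prefix u (W k)); apply/andP; split; lia.
  by exists N => k /hN; rewrite INR_rsum.
- move=> u; apply: (ulim_unique UI US U0 _ (hmu u)).
  apply: (ulim_close UI US UT (ulim_rsum UI US UT (fun c => hmu (rcons u c)))).
  move=> e he; have [|N hN] := fr_close (m := fun k => \sum_(c : A) cnt (rcons u c) (W k)) (n := fun k => cnt u (W k)) _ he.
    by move=> k; apply: cnt_right.
  by exists N => k /hN; rewrite INR_rsum.
- move=> u; split=> [hu|hpos].
    case: (eqVneq u [::]) => [->|ne]; first by rewrite nil1; lra.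
    have [M [N hN]] := Wrec hu ne.
    have hM : (0 < INR M)%Re.
      by apply: lt_0_INR; apply/ltP; have := hN N (leqnn N); case: (M).
    have : (/ INR M <= mu u)%Re.
      apply: (ulim_ge UI US U0 UT (N := N) (hmu u)) => k /hN hk.
      have h1 := le_INR _ _ (elimT leP hk); rewrite mult_INR in h1.
      have h0 : (0 < INR (size (W k)).+1)%Re by apply: lt_0_INR; apply/ltP.
      rewrite /fr; set s := INR (size (W k)).+1 in h0 h1 *; set c := INR (cnt _ _) in h1 *.
      apply: (Rmult_le_reg_r (INR M * s)); first exact: Rmult_lt_0_compat.
      have -> : (/ INR M * (INR M * s) = s)%Re by field; lra.
      have -> : (c / s * (INR M * s) = INR M * c)%Re by field; lra.
      exact: h1.
    by have := Rinv_0_lt_compat _ hM; lra.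
  apply: NNPP => hn.
  have : mu u = R0.
    apply: (ulim_unique UI US U0 (hmu u)).
    apply: (ulim_ext US (f := fun=> R0)) (ulim_const US UT R0) => k.
    have -> : fr u k = (INR 0 / INR (size (W k)).+1)%Re.
      rewrite /fr; case E : (cnt u (W k)) => [//|x].
      by case: hn; apply: (@LW k); apply: cnt_infix; rewrite E.
    by rewrite /= /Rdiv Rmult_0_l.
  by move=> h; rewrite h in hpos; lra.
Qed.
End Frequencies.

(** * From an invariant weight to an interval exchange *)

Section NoConnections.
Variables (A : finType) (le1 le2 : rel A) (lam : A -> R).
Hypothesis HI : is_IET le1 le2 lam.
Notation T := (Tiet le1 le2 lam).
Notation lft := (lend le1 lam).
Hypothesis nocon : forall c d k, lft c <> R0 -> lft d <> R0 -> iter k.+1 T (lft c) = lft d -> False.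

Lemma lft_inj c d : lft c = lft d -> c = d.
Proof.
move=> E; apply: (inI_unique HI (inI_lend HI c)); rewrite E; exact: (inI_lend HI).
Qed.

(** As [T] is injective on the unit interval, any repetition or meeting of orbits can be pulled back
    until an iterate of one left endpoint equals a left endpoint. *)
Lemma regular_no_connection : regular_IET le1 le2 lam.
Proof.
have U c : unitI (lft c) by apply: (lft_unit HI).
have conn c d k : lft c <> R0 -> lft d <> R0 -> c <> d -> iter k T (lft c) = lft d -> False.
  case: k => [|k] hc hd ne E; [exact: ne (lft_inj E) | exact: nocon hc hd E].
split=> [c hc l|c d hc hd ne z].
  apply: NNPP => hno.
  have hin i : List.In (iter i T (lft c)) l.
    by apply: NNPP => h; apply: hno; exists (iter i T (lft c)); split=> //; exists i; left.
  have inj : FinFun.Injective (fun i => iter i T (lft c)).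
    suff main i j : i < j -> iter i T (lft c) = iter j T (lft c) -> False.
      by move=> i j E; case: (ltngtP i j) => // h; [case: (main _ _ h E) | case: (main _ _ h (esym E))].
    move=> hij; rewrite -(subnKC (ltnW hij)) iterD => /(iterT_inj HI (U c) (iterT_unit HI _ (U c))) E.
    have e : j - i = (j - i).-1.+1 by lia.
    by rewrite e in E; apply: (nocon hc hc (esym E)).
  have := List.NoDup_incl_length (FinFun.Injective_map_NoDup inj (List.seq_NoDup (length l).+1 0)).
  move=> /(_ l); rewrite List.length_map List.length_seq => H.
  have : (length l).+1 <= length l.
    by apply/leP; apply: H => y /List.in_map_iff[i [<- _]].
  by rewrite ltnn.
have main2 c' d' n m : lft c' <> R0 -> lft d' <> R0 -> c' <> d' -> iter n T (lft c') = z -> iter m T (lft d') = z -> m <= n -> False.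
  move=> hc' hd' ne' E1 E2 h; move: E1; rewrite -E2 -(subnKC h) iterD.
  move=> /(iterT_inj HI (iterT_unit HI _ (U c')) (U d')); exact: conn.
have main3 c' d' n m : lft c' <> R0 -> lft d' <> R0 -> c' <> d' -> iter n T z = lft c' -> iter m T z = lft d' -> n <= m -> False.
  move=> hc' hd' ne' E1 E2 h; move: E2; rewrite -(subnK h) iterD E1; exact: conn.
case=> n [E1|E1] [m [E2|E2]].
- case: (leqP m n) => h; first exact: main2 hc hd ne E1 E2 h.
  exact: main2 hd hc (nesym ne) E2 E1 (ltnW h).
- by apply: (conn c d (m + n)) => //; rewrite iterD E1.
- by apply: (conn d c (n + m) hd hc (nesym ne)); rewrite iterD E2.
- case: (leqP n m) => h; first exact: main3 hc hd ne E1 E2 h.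
  exact: main3 hd hc (nesym ne) E2 E1 (ltnW h).
Qed.
End NoConnections.

Section Weighted.
Variables (A : finType) (L : seq A -> Prop) (leL leR : rel A) (mu : seq A -> R).
Hypothesis HL : total_order leL.
Hypothesis HR : total_order leR.
Hypothesis mu_ge0 : forall u, (0 <= mu u)%Re.
Hypothesis mu_nil : mu [::] = R1.
Hypothesis mu_left : forall u, \rsum_(c | true) mu (c :: u) = mu u.
Hypothesis mu_right : forall u, \rsum_(d | true) mu (rcons u d) = mu u.
Hypothesis mu_pos : forall u, L u <-> (0 < mu u)%Re.
Hypothesis Lfac : forall u v, infix u v -> L v -> L u.
Hypothesis Lletter : forall c, L [:: c].
Hypothesis Lplanar : forall u c1 d1 c2 d2, L (c1 :: rcons u d1) -> L (c2 :: rcons u d2) ->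
    ltr leL c1 c2 -> leR d1 d2.
Hypothesis Lspecial : forall e f m, consecutive leL e f ->
  exists u, [/\ size u = m, L (e :: u) & L (f :: u)].
Hypothesis Lirr : irreducible leL leR.
Hypothesis HA : 1 < #|A|.

Definition freq c := mu [:: c].
Notation T := (Tiet leR leL freq).
Notation lft := (lend leR freq).
Notation ift := (iend leL freq).

Lemma weighted_IET : is_IET leR leL freq.
Proof.
split=> //; split=> //; split; first by move=> c; apply/mu_pos.
by rewrite rsum_enum -mu_nil -mu_left.
Qed.
Let HI := weighted_IET.

(** The total weight of the words [p ++ v], with [v] of the length of [u] and before it
    lexicographically for [leR]. For empty [p] it is the left end of the interval of [u]. *)
Fixpoint pos (p u : seq A) : R :=
  if u is c :: u' then (\rsum_(d | ltr leR d c) mu (rcons p d) + pos (rcons p c) u')%Re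
  else R0.

Lemma pos_rcons p u b : pos p (rcons u b) =
  (pos p u + \rsum_(d | ltr leR d b) mu (p ++ rcons u d))%Re.
Proof.
elim: u p => [|c u IH] p /=.
  by rewrite Rplus_0_r Rplus_0_l; apply: eq_bigr => d _; rewrite cats1.
by rewrite IH Rplus_assoc; congr (_ + (_ + _))%Re; apply: eq_bigr => d _; rewrite cat_rcons.
Qed.

Lemma pos_ge0 p u : (0 <= pos p u)%Re.
Proof.
elim: u p => [|c u IH] p /=; first lra.
have := IH (rcons p c); have := @rsum_ge0 A (fun d => mu (rcons p d)) (fun d => ltr leR d c) (fun d _ => mu_ge0 _).
lra.
Qed.

Lemma pos_le p u : (pos p u + mu (p ++ u) <= mu p)%Re.
Proof.
elim: u p => [|c u IH] p /=; first by rewrite cats0; lra.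
have := IH (rcons p c); rewrite cat_rcons => h.
have := @off_le A leR (fun d => mu (rcons p d)) HR (fun d => mu_ge0 _) c.
rewrite mu_right /off; lra.
Qed.

Lemma mu_zero u : ~ L u -> mu u = R0.
Proof.
move=> h; case: (mu_ge0 u) => // h'; by case: h; apply/mu_pos.
Qed.

(* Sorting the words [c u] of the language by [c] and then by [u], or by [u] and then by [c],
   gives the same order: this is where planarity enters. *)
Lemma pos_image c u : L (c :: u) ->
  (ift c + pos [:: c] u = pos [::] u + \rsum_(e | ltr leL e c) mu (e :: u))%Re.
Proof.
elim/last_ind: u => [|u b IH] hL; first by rewrite iendE /off /freq /=; lra.
have hcu : L (c :: u) by apply: Lfac hL; rewrite -rcons_cons; apply: infix_rcons.
rewrite !pos_rcons -Rplus_assoc IH //.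
pose m e d := mu (e :: rcons u d).
have E1 : \rsum_(e | ltr leL e c) mu (e :: u) =
    (\rsum_(e | ltr leL e c) \rsum_(d | ltr leR d b) m e d + \rsum_(e | ltr leL e c) m e b)%Re.
  rewrite -big_split /=; apply: eq_bigr => e he.
  rewrite -mu_right (bigID (fun d => ltr leR d b)) /=; congr Rplus.
  rewrite (bigD1 b) /= ?ltrr // big1 => [|d /andP[h1 h2]]; first by rewrite Rplus_0_r.
  apply: mu_zero => h; have := Lplanar h hL he.
  by move/(ler_eqVlt HR) => [E|E]; [rewrite E eqxx in h2 | rewrite E in h1].
have E2 : \rsum_(d | ltr leR d b) mu ([::] ++ rcons u d) =
    (\rsum_(d | ltr leR d b) \rsum_(e | ltr leL e c) m e d + \rsum_(d | ltr leR d b) m c d)%Re.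
  rewrite -big_split /=; apply: eq_bigr => d hd.
  rewrite -mu_left (bigID (fun e => ltr leL e c)) /=; congr Rplus.
  rewrite (bigD1 c) /= ?ltrr // big1 => [|e /andP[h1 h2]]; first by rewrite Rplus_0_r.
  apply: mu_zero => h.
  have hce : ltr leL c e by rewrite ltrNge //; apply: contra h1 => h1; rewrite /ltr h1.
  by have := Lplanar hL h hce; rewrite lerNgt // hd.
rewrite E1 E2 exchange_big /=.
have -> : \rsum_(d | ltr leR d b) mu (c :: rcons u d) = \rsum_(d | ltr leR d b) m c d by [].
have -> : \rsum_(e | ltr leL e c) mu (e :: rcons u b) = \rsum_(e | ltr leL e c) m e b by [].
lra.
Qed.

Definition inJ u t := (pos [::] u <= t < pos [::] u + mu u)%Re.

Lemma pos_cons c u : pos [::] (c :: u) = (lft c + pos [:: c] u)%Re.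
Proof. by rewrite lendE. Qed.

Lemma inJ_letter c u t : inJ (c :: u) t -> inI leR freq c t.
Proof.
rewrite /inJ pos_cons /Defs.inI => h.
have E : freq c = mu [:: c] by [].
by have := pos_ge0 [:: c] u; have := pos_le [:: c] u; rewrite E /=; lra.
Qed.

(** The lower bound keeps the distance to the left end, so that interior points stay interior. *)
Lemma T_inJ c u t : L (c :: u) -> inJ (c :: u) t ->
  (pos [::] u + (t - pos [::] (c :: u)) <= T t < pos [::] u + mu u)%Re.
Proof.
move=> hL ht; rewrite (TietE HI (inJ_letter ht)) /shiftI.
have E := pos_image hL; move: ht; rewrite /inJ pos_cons => ht.
have S0 := @rsum_ge0 A (fun e => mu (e :: u)) (fun e => ltr leL e c) (fun d _ => mu_ge0 _).
have S1 := @off_le A leL (fun e => mu (e :: u)) HL (fun d => mu_ge0 _) c.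
rewrite mu_left /off in S1; lra.
Qed.

Lemma inJ_codes u t : L u -> inJ u t -> codes leR leL freq t u.
Proof.
elim: u t => //= c u IH t hL ht; split; first exact: inJ_letter ht.
have hu : L u by apply: Lfac hL; apply: infix_cons.
by apply: IH => //; have := T_inJ hL ht; move: ht; rewrite /inJ; lra.
Qed.

Lemma inJ_exists n t : unitI t -> exists u, [/\ size u = n, L u & inJ u t].
Proof.
move=> ht; elim: n => [|n [u [<- hu hj]]].
  exists [::]; split=> //; first by apply/mu_pos; rewrite mu_nil; lra.
  by rewrite /inJ /= mu_nil; move: ht; rewrite /unitI; lra.
have [|d hd] := @off_locate A leR (fun d => mu (rcons u d)) HR (t - pos [::] u)%Re.
  by rewrite mu_right; move: hj; rewrite /inJ; lra.
exists (rcons u d); rewrite size_rcons; split=> //; first by apply/mu_pos; lra.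
by rewrite /inJ pos_rcons; move: hd; rewrite /off /=; lra.
Qed.

(** The intervals of the words of [L] of a given length cover the unit interval, and a point codes
    only one word of each length. *)
Lemma weighted_lang u : langI leR leL freq u <-> L u.
Proof.
split=> [[t [ht hu]]|hu].
  have [v [hs hv hj]] := inJ_exists (size u) ht.
  by rewrite (codes_unique HI hu (inJ_codes hv hj)).
have hpos : (0 < mu u)%Re by apply/mu_pos.
have h1 := pos_ge0 [::] u; have h2 := pos_le [::] u; rewrite mu_nil /= in h2.
exists (pos [::] u); split; first by rewrite /unitI; lra.
by apply: inJ_codes => //; rewrite /inJ; lra.
Qed.

(** Each step removes a letter and keeps the point interior; after [m] steps it is interior to the
    interval of one letter. *)
Lemma interior_not_lft m u t d : size u = m.+1 -> L u ->
  (pos [::] u < t < pos [::] u + mu u)%Re -> iter m T t <> lft d.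
Proof.
elim: m u t => [|m IH] [|c u] t // [hs] hL ht E.
  case: u hs hL ht => // _ hL ht.
  have hc : inI leR freq c t by apply: (@inJ_letter c [::]); rewrite /inJ; lra.
  have Ec : c = d by apply: (inI_unique HI hc); rewrite (E : t = _); apply: (inI_lend HI).
  by move: ht; rewrite pos_cons /= (E : t = _) Ec; lra.
have hj : inJ (c :: u) t by rewrite /inJ; lra.
move: E; rewrite iterSr; apply: (IH u) => //.
  by apply: Lfac hL; apply: infix_cons.
by have := T_inJ hL hj; lra.
Qed.

Lemma ift_interior c e m d : consecutive leL e c -> iter m T (ift c) <> lft d.
Proof.
move=> hec; have [u [hs he hc]] := Lspecial m.+1 hec.
have hu : L u by apply: Lfac hc; apply: infix_cons.
apply: (interior_not_lft hs hu).
have Ec := pos_image hc; have Ee := pos_image he.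
have pe : (0 < mu (e :: u))%Re by apply/mu_pos.
have pc : (0 < mu (c :: u))%Re by apply/mu_pos.
have E : ift c = (ift e + mu [:: e])%Re by rewrite !iendE (off_succ _ HL hec).
have b1 := pos_ge0 [:: c] u; have b2 := pos_le [:: e] u; rewrite /= in b2.
have S0 := @rsum_ge0 A (fun e => mu (e :: u)) (fun x => ltr leL x e) (fun d _ => mu_ge0 _).
have S1 := @off_le A leL (fun e => mu (e :: u)) HL (fun d => mu_ge0 _) c.
rewrite mu_left /off in S1; lra.
Qed.

Lemma weighted_regular : regular_IET leR leL freq.
Proof.
apply: (regular_no_connection HI) => c d k hc hd.
have Tl e : T (lft e) = ift e by rewrite (TietE HI (inI_lend HI e)) /shiftI; lra.
have [x0 hx0] := min_exists c HL.
have main e m : e != x0 -> iter m T (ift e) <> lft d.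
  move=> ne; have lx : ltr leL x0 e by rewrite /ltr hx0 eq_sym.
  by have [s hs _] := pred_exists HL lx; apply: ift_interior hs.
(* Only the image of the [leL]-least letter starts at 0, which is no interior point. One more step
   leads to the image of the [leR]-least letter, and irreducibility with [k = 1] says that this is
   another letter. *)
rewrite iterSr Tl; case: (eqVneq c x0) => [E|ne]; last exact: main.
have i0 : ift x0 = R0 by rewrite iendE; apply: off_first.
rewrite E i0; case: k => [|k] /=; first by move=> h; apply: hd.
have [y0 hy0] := min_exists c HR.
have l0 : lft y0 = R0 by rewrite lendE; apply: off_first.
rewrite -iterS iterSr -l0 Tl; apply: main; apply/eqP=> Exy.
have /eqP[] := Lirr (k := 1) HA.
apply/setP=> z; rewrite !inE.
have first (le : rel A) (H : total_order le) : (forall d, le x0 d) ->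
    (#|[set d0 | ltr le d0 z]| < 1) = (z == x0).
  move=> hmin; rewrite ltnS leqn0 cards_eq0; apply/eqP/eqP => [h|->].
    apply/eqP; apply: contraT => ne; move/setP/(_ x0): h.
    by rewrite !inE /ltr hmin eq_sym ne.
  by apply/setP=> y; rewrite !inE ltrNge // hmin.
by rewrite !first // -?Exy //; move=> d0; rewrite -Exy.
Qed.
End Weighted.

(** * From a path to an interval exchange *)

Section Levels.
Variables (A : finType) (sg : nat -> morph A) (w : nat -> seq A).
Hypothesis HA : 1 < #|A|.
Hypothesis Hprim : primitive_seq sg.
Hypothesis Hr : forall n, ret_for (sg n) (w n).

Lemma compw_add n j k u : compw sg n (j + k) u = compw sg n j (compw sg (n + j) k u).
Proof. by elim: j n => [|j IH] n /=; [rewrite addn0 | rewrite IH addSnnS]. Qed.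

Lemma compw_nil n k : compw sg n k [::] = [::].
Proof. by elim: k n => //= k IH n; rewrite IH. Qed.

Lemma compw_infix n k u v : infix u v -> infix (compw sg n k u) (compw sg n k v).
Proof. by case/infixP=> a [b ->]; rewrite !compw_cat infix_infix. Qed.

Lemma Ln_fac n u v : infix u v -> Ln sg n v -> Ln sg n u.
Proof. by move=> h [N [c [h1 h2]]]; exists N, c; split=> //; apply: infix_trans h h2. Qed.

Lemma Ln_letter n c : Ln sg n [:: c].
Proof.
by have [N [h1 h2]] := Hprim n; exists N, c; split=> //; rewrite infix1s.
Qed.

Lemma primitive_after n u : Ln sg n u -> exists K, forall k, K <= k -> forall d, infix u (compw sg n k [:: d]).
Proof.
case=> N [c [h1 h2]]; have [N' [h3 h4]] := Hprim N.
exists (N' - n) => k hk d.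
have [e [t E]] : exists e t, compw sg N' (k - (N' - n)) [:: d] = e :: t.
  have := size_compw Hr N' (k - (N' - n)) [:: d].
  by case: (compw _ _ _ _) => [|e t] // _; exists e, t.
have -> : k = (N' - n) + (k - (N' - n)) by lia.
rewrite compw_add; have -> : n + (N' - n) = N' by lia.
rewrite E; apply: (@infix_trans _ (compw sg n (N' - n) [:: e])); last first.
  by apply: compw_infix; apply/infixP; exists [::], t.
have -> : N' - n = (N - n) + (N' - N) by lia.
rewrite compw_add; have -> : n + (N - n) = N by lia.
apply: infix_trans h2 _; apply: compw_infix; by rewrite infix1s.
Qed.

Lemma compw_double n k u : (forall d, 1 < size (compw sg n k [:: d])) ->
  2 * size u <= size (compw sg n k u).
Proof.
move=> h; elim: u => [|c u IH] //.
by rewrite -cat1s compw_cat !size_cat /=; have := h c; lia.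
Qed.

(** Over a primitive stretch the image of a letter contains all letters, hence at least two, and
    lengths double. *)
Lemma compw_long M n : exists K, forall k, K <= k -> forall d, M <= size (compw sg n k [:: d]).
Proof.
elim: M n => [|M IH] n; first by exists 0.
have [N [hN h]] := Hprim n; have [K hK] := IH N.
exists (N - n + K) => k hk d.
have -> : k = (N - n) + (k - (N - n)) by lia.
rewrite compw_add; have -> : n + (N - n) = N by lia.
set t := compw sg N _ _.
have ht : M <= size t by apply: hK; lia.
have ht1 : 0 < size t := size_compw Hr N (k - (N - n)) [:: d].
have := @compw_double n (N - n) t; move=> H.
have {}H : 2 * size t <= size (compw sg n (N - n) t).
  apply: H => e; apply: leq_trans HA _; rewrite cardE.
  by apply: uniq_leq_size; [exact: enum_uniq | move=> x _; apply: h].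
lia.
Qed.

(** Place [u] in the image of the middle one of three successive letters; the outer images provide
    the neighbours. *)
Lemma Ln_inner n u : Ln sg n u -> exists c d, Ln sg n (c :: rcons u d).
Proof.
move=> hu; have [K hK] := primitive_after hu.
have [x0 _] : exists x : A, true by case/card_gt0P: (ltnW HA) => x; exists x.
have [J hJ] := compw_long 3 (n + K).
have := hJ J.+1 (leqnSn _) x0; case E : (compw _ _ _ _) => [|x [|y [|z t]]] // _.
have h1 := size_compw Hr n K [:: x]; have h3 := size_compw Hr n K [:: z].
have /infixP[p [q Ey]] := hK K (leqnn _) y.
case/lastP E1 : (compw sg n K [:: x] ++ p) => [|p' c].
  by have := congr1 size E1; rewrite size_cat /=; move: h1 => /=; lia.
case E3 : (q ++ compw sg n K [:: z]) => [|d q'].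
  by have := congr1 size E3; rewrite size_cat /=; move: h3 => /=; lia.
exists c, d, (n + (K + J.+1)), x0; split; first lia.
rewrite addKn compw_add E.
have -> : [:: x, y, z & t] = [:: x] ++ [:: y] ++ [:: z] ++ t by [].
rewrite !compw_cat Ey.
apply/infixP; exists p', (q' ++ compw sg n K t).
have -> : compw sg n K [:: x] ++ (p ++ u ++ q) ++ compw sg n K [:: z] ++ compw sg n K t =
  (compw sg n K [:: x] ++ p) ++ u ++ (q ++ compw sg n K [:: z]) ++ compw sg n K t.
  by rewrite -!catA.
by rewrite E1 E3 cat_rcons -cats1 /= -!catA.
Qed.

Lemma Ln_extL n u : Ln sg n u -> exists c, Ln sg n (c :: u).
Proof.
case/Ln_inner=> c [d h]; exists c; apply: Ln_fac h.
by rewrite -rcons_cons; apply: infix_rcons.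
Qed.

Lemma Ln_extR n u : Ln sg n u -> exists d, Ln sg n (rcons u d).
Proof.
by case/Ln_inner=> c [d h]; exists d; apply: Ln_fac h; apply: infix_cons.
Qed.

Lemma Ln_preimage n u : Ln sg n u -> exists2 z, Ln sg n.+1 z & infix u (wimg (sg n) z).
Proof.
case=> N [c [h1 h2]]; exists (compw sg n.+1 (N - n.+1) [:: c]); last first.
  by move: h2; have -> : N - n = (N - n.+1).+1 by lia.
case: (ltnP n.+1 N) => h; first by exists N, c; split=> //; apply: infix_refl.
have -> : N - n.+1 = 0 by lia.
exact: Ln_letter.
Qed.

Lemma Ln_infix_wimg n u : Ln sg n u -> exists z, infix u (wimg (sg n) z).
Proof. by case/Ln_preimage=> z _; exists z. Qed.

Lemma Ln_image n v : Ln sg n.+1 v -> Ln sg n (wimg (sg n) v).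
Proof.
case=> N [c [h1 h2]]; exists N, c; split; first lia.
have -> : N - n = (N - n.+1).+1 by lia.
exact: wimg_infix.
Qed.

Lemma Ln_derived n v : Ln sg n.+1 v <-> derived (sg n) (w n) (Ln sg n) v.
Proof.
rewrite /derived; split=> h.
  (* The image of [y] has at least [size (w n)] letters, so it starts with the whole return word. *)
  have [y hy hL] := ext_right (@Ln_extR n.+1) (size (w n)) h.
  have hi := Ln_image hL; rewrite wimg_cat in hi; apply: Ln_fac hi.
  have [r Er] := wimg_pre (Hr n) y.
  have [|q -> _] := cat_split (esym Er); first by rewrite -hy; apply: size_wimg (Hr n) _.
  by rewrite catA; apply: prefix_infix.
have [z hz hi] := Ln_preimage h.
by apply: Ln_fac hz; apply: (infix_decode (Hr n)).
Qed.

Lemma w_nonempty n : exists j, w (n + j) != [::].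
Proof.
apply: NNPP => hno.
have h j : w (n + j) = [::] by apply/eqP; apply: contraT => hj; case: hno; exists j.
have [x0 _] : exists x : A, true by case/card_gt0P: (ltnW HA) => x; exists x.
have [K hK] := compw_long 2 n.
by have := hK K (leqnn _) x0; rewrite (size_compw1 Hr).
Qed.

Lemma compw_frequencies : exists mu : seq A -> R,
  [/\ forall u, (0 <= mu u)%Re, mu [::] = R1,
      forall u, \rsum_(c | true) mu (c :: u) = mu u,
      forall u, \rsum_(d | true) mu (rcons u d) = mu u
    & forall u, Ln sg 0 u <-> (0 < mu u)%Re].
Proof.
have [x0 _] : exists x : A, true by case/card_gt0P: (ltnW HA) => x; exists x.
apply: (@frequencies_exist _ _ (fun k => compw sg 0 k [:: x0])).
- move=> [|k] u hu; first by apply: Ln_fac hu (Ln_letter 0 x0).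
  by exists k.+1, x0.
- by move=> M; have [K hK] := compw_long M 0; exists K => k /hK.
- move=> u hu ne; have [K hK] := primitive_after hu.
  pose M := \max_(d : A) size (compw sg 0 K [:: d]).
  exists M.+1, K => k hk.
  have -> : k = K + (k - K) by lia.
  rewrite compw_add add0n; set t := compw sg K _ _.
  have ht : 0 < size t := size_compw Hr K (k - K) [:: x0].
  have h1 : size (compw sg 0 K t) <= M * size t.
    elim: (t) => [|c t' IH]; first by rewrite compw_nil.
    rewrite -cat1s compw_cat !size_cat /= mulnDr muln1; apply: leq_add => //.
    exact: (leq_bigmax c).
  have h2 : size t <= cnt u (compw sg 0 K t).
    elim: (t) => [|c t' IH] //.
    rewrite -cat1s compw_cat; apply: leq_trans (cnt_cat _ _ ne).
    by rewrite size_cat /=; apply: leq_add => //; apply: infix_cnt; apply: hK.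
  apply: leq_ltn_trans h1 _; apply: (@leq_trans (M.+1 * size t)); first by rewrite mulSn; lia.
  by rewrite leq_mul2l h2 orbT.
Qed.

Variables (a b : A) (v : nat -> vertex A).
Hypothesis Hv : forall n, iet_vertex a b (v n).
Hypothesis Hlv : forall n, left_valid (Gord (v n).1) (sg n) (Gord (v n.+1).1).
Hypothesis Hpm : forall n, planar_morph (sg n) (w n) (v n).1 (v n).2.
Hypothesis Hpp : forall n, planar_pres (sg n) (w n) (v n.+1).1 (v n.+1).2 (v n).1 (v n).2 \/
     planar_pres (sg n) (w n) (rev_order (v n.+1).1) (rev_order (v n.+1).2) (v n).1 (v n).2.

Let HL n : total_order (v n).1. Proof. by case: (Hv n). Qed.
Let HR n : total_order (v n).2. Proof. by case: (Hv n) => _ []. Qed.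

Definition planar_at n (leL leR : rel A) u := forall c1 d1 c2 d2,
  Ln sg n (c1 :: rcons u d1) -> Ln sg n (c2 :: rcons u d2) -> ltr leL c1 c2 -> leR d1 d2.

Lemma planar_at_rev n leL leR u : planar_at n leL leR u ->
  planar_at n (rev_order leL) (rev_order leR) u.
Proof.
by move=> h c1 d1 c2 d2 h1 h2; rewrite (ltr_rev leL) => hc; exact: h h2 h1 hc.
Qed.

(** Outer letters at level [n] are images of extensions of [u] one level up. Order preservation
    transfers the left comparison upwards and the right one downwards. *)
Lemma planar_lift n pL pR leL leR x u p : total_order pL -> total_order pR ->
  total_order leL -> total_order leR ->
  planar_pres (sg n) (w n) pL pR leL leR -> first_occ (w n) x -> last_occ (w n) p ->
  planar_at n.+1 pL pR u -> planar_at n leL leR (x ++ wimg (sg n) u ++ p).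
Proof.
move=> TpL TpR TL0 TR0 [ppL ppR] hx hp hpl c1 d1 c2 d2 h1 h2 hc.
have key c d : Ln sg n (c :: rcons (x ++ wimg (sg n) u ++ p) d) ->
    exists g h, [/\ g \in AL (sg n) x, phiL (sg n) x g = c, h \in AR (sg n) (w n) p,
      phiR (sg n) (w n) p h = d & Ln sg n.+1 (g :: rcons u h)].
  move=> h; have [g [k [y [y' [E1 E2 h3]]]]] :=
    desubstitute (Hr n) (@Ln_fac n) (@Ln_extL n) (@Ln_extR n) (@Ln_infix_wimg n) hx hp h.
  exists g, k; have [-> ->] := AL_intro E1; have [-> ->] := AR_intro E2.
  by split=> //; apply/Ln_derived.
have [g1 [k1 [a1 a2 a3 a4 a5]]] := key _ _ h1.
have [g2 [k2 [b1 b2 b3 b4 b5]]] := key _ _ h2.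
have nphi : phiL (sg n) x g1 != phiL (sg n) x g2 by rewrite a2 b2; apply: ltr_neq hc.
have hxT : x \in TL (sg n).
  exact: (key_mem (can_inj revK) (TL_key (sg n)) (@codeL_of_AL _ (sg n)) a1 b1 nphi).
have lg : ltr pL g1 g2.
  rewrite ltrNge //; apply/negP => hge.
  case: (ler_eqVlt TpL hge) => [E|hlt]; first by rewrite E eqxx in nphi.
  by have := ppL _ hxT _ _ b1 a1 hlt; rewrite a2 b2 lerNgt // hc.
have lk := hpl _ _ _ _ a5 b5 lg.
case: (eqVneq d1 d2) => [->|nd]; first exact: ler_refl.
have npsi : phiR (sg n) (w n) p k1 != phiR (sg n) (w n) p k2 by rewrite a4 b4.
have hpT : p \in TR (sg n) (w n).
  exact: (@key_mem _ _ _ id _ _ (@inj_id _) (TR_key (sg n) (w n)) (@AR_split _ (sg n) (w n)) _ _ _ a3 b3 npsi).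
case: (ler_eqVlt TpR lk) => [E|hlt]; first by rewrite E eqxx in npsi.
by have := ppR _ hpT _ _ a3 b3 hlt; rewrite a4 b4.
Qed.

Lemma Ln_planar n u : planar_at n (v n).1 (v n).2 u.
Proof.
have [m] := ubnP (size u); elim: m n u => // m IHm n u hu.
(* A nonempty [w n] makes the desubstituted word shorter. Otherwise its length need not drop, and
   the inner induction counts the levels up to a nonempty return word. *)
have [j hj] := w_nonempty n.
elim: j n u hu hj => [|j IHj] n u hu hj c1 d1 c2 d2 h1 h2 hc;
  (case: (boolP (infix (w n) u)) => hw; last first;
   [have e1 := ext_in_Lsig (Hr n) (@Ln_fac n) (@Ln_extL n) (@Ln_extR n) (@Ln_infix_wimg n) h1 hw;
    have e2 := ext_in_Lsig (Hr n) (@Ln_fac n) (@Ln_extL n) (@Ln_extR n) (@Ln_infix_wimg n) h2 hw;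
    apply: (Hpm _ e1 e2 hc); rewrite /sig_initial hw andbT; apply: (Lsig_infix _ e1);
    exact: infix_trans (infix_rcons u d1) (infix_cons _ c1)
   |]);
  (have hLu : Ln sg n u by apply: Ln_fac h1; exact: infix_trans (infix_rcons u d1) (infix_cons _ c1));
  have [x [z [p [Eu hx hp]]]] := decompose (Hr n) (@Ln_fac n) (@Ln_infix_wimg n) hLu hw;
  (have sz : size z + size (w n) <= size u by
    case: (hp) => [[p' Ep] _]; rewrite Eu Ep !size_cat; have := size_wimg (Hr n) z; lia);
  (suff hz : planar_at n.+1 (v n.+1).1 (v n.+1).2 z by
    rewrite Eu in h1 h2; case: (Hpp n) => pp;
    [ exact: (planar_lift (HL _) (HR _) (HL _) (HR _) pp hx hp hz h1 h2 hc)
    | exact: (planar_lift (rev_order_total (HL _)) (rev_order_total (HR _)) (HL _) (HR _) pp hx hp (planar_at_rev hz) h1 h2 hc)]).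
- apply: IHm; rewrite addn0 in hj.
  have : 0 < size (w n) by rewrite lt0n size_eq0.
  by lia.
- case: (posnP (size (w n))) => h0; last by apply: IHm; lia.
  by apply: IHj; [lia | rewrite addSnnS].
Qed.

(** Cliques are unordered and an edge may reverse the orders, so the pair may be met in either
    direction. *)
Lemma consecutive_down n e f : consecutive (v n).1 e f ->
  exists x c d, [/\ consecutive (v n.+1).1 c d, c \in AL (sg n) x, d \in AL (sg n) x &
    (phiL (sg n) x c = e /\ phiL (sg n) x d = f) \/ (phiL (sg n) x c = f /\ phiL (sg n) x d = e)].
Proof.
move=> hef; have [_ [_ [_ [hmc _]]]] := Hlv n.
have : [set e; f] \in Gord (v n).1 by apply/mem_Gord; exists e, f.
move: hmc; rewrite /mc_eq filter_Gord => /perm_mem ->.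
rewrite mem_filter => /andP[hcard /flattenP[t /mapP[C hC ->] /mapP[x hx E]]].
case/mem_Gord: hC => c [d [hcd EC]]; subst C; rewrite E in hcard.
have [hc hd ne] := image_pair_gt1 hcard.
exists x, c, d; split=> //.
rewrite (image_pair _ hc hd) in E; move/setP: E => E.
have := E (phiL (sg n) x c); have := E (phiL (sg n) x d); rewrite !inE !eqxx orbT.
move=> /orP[]/eqP E1 /orP[]/eqP E2; auto; by move: ne; rewrite E1 E2 eqxx.
Qed.

Lemma special_lift n m x c d e f u : c \in AL (sg n) x -> d \in AL (sg n) x ->
  phiL (sg n) x c = e -> phiL (sg n) x d = f -> m <= size u ->
  Ln sg n.+1 (c :: u) -> Ln sg n.+1 (d :: u) ->
  exists u', [/\ m + size (w n) <= size u', Ln sg n (e :: u') & Ln sg n (f :: u')].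
Proof.
move=> hc hd <- <- hm h1 h2; exists (x ++ wimg (sg n) u ++ w n).
have key g : g \in AL (sg n) x -> Ln sg n.+1 (g :: u) ->
    Ln sg n (phiL (sg n) x g :: x ++ wimg (sg n) u ++ w n).
  case/AL_split=> y Ey /Ln_derived; rewrite /derived wimg_cons -catA => h; apply: Ln_fac h.
  by rewrite Ey -catA; apply: suffix_infix.
split; [|exact: key|exact: key].
by rewrite !size_cat; have := size_wimg (Hr n) u; lia.
Qed.

(** Lifting a separating word through level [n] adds at least [size (w n)] letters; the inner
    induction crosses the levels where nothing is gained. *)
Lemma Ln_special_long m n e f : consecutive (v n).1 e f ->
  exists u, [/\ m <= size u, Ln sg n (e :: u) & Ln sg n (f :: u)].
Proof.
elim: m n e f => [|m IHm] n e f hef; first by exists [::]; split=> //; apply: Ln_letter.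
have step k n' e' f' : consecutive (v n').1 e' f' ->
    (forall c d, consecutive (v n'.+1).1 c d ->
      exists u, [/\ k <= size u, Ln sg n'.+1 (c :: u) & Ln sg n'.+1 (d :: u)]) ->
    exists u, [/\ k + size (w n') <= size u, Ln sg n' (e' :: u) & Ln sg n' (f' :: u)].
  move=> hef' H; have [x [c [d [hcd hc hd hphi]]]] := consecutive_down hef'.
  have [u [hu h1 h2]] := H _ _ hcd.
  by case: hphi => -[Ec Ed]; [apply: special_lift hc hd Ec Ed hu h1 h2 | apply: special_lift hd hc Ed Ec hu h2 h1].
have [j hj] := w_nonempty n.
elim: j n e f hef hj => [|j IHj] n e f hef hj.
  rewrite addn0 in hj; have hw : 0 < size (w n) by rewrite lt0n size_eq0.
  have [u [hu h1 h2]] := step m n e f hef (IHm n.+1).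
  by exists u; split=> //; lia.
have [|u [hu h1 h2]] := step m.+1 n e f hef.
  by move=> c d hcd; apply: IHj => //; rewrite addSnnS.
by exists u; split=> //; lia.
Qed.

Lemma levels_coding (X : biseq A -> Prop) :
  (forall x, X x <-> (forall u, factor x u -> Ln sg 0 u)) ->
  coding_regular_IET_for X (v 0).2 (v 0).1.
Proof.
move=> HX; have [mu [m1 m2 m3 m4 m5]] := compw_frequencies.
have Lsp e f m : consecutive (v 0).1 e f ->
    exists u, [/\ size u = m, Ln sg 0 (e :: u) & Ln sg 0 (f :: u)].
  move=> /(Ln_special_long m)[u [hu h1 h2]]; exists (take m u).
  have key g : Ln sg 0 (g :: u) -> Ln sg 0 (g :: take m u).
    apply: Ln_fac; apply/infixP; exists [::], (drop m u).
    by rewrite /= cat_take_drop.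
  by split; [exact: size_takel | exact: key | exact: key].
have irr : irreducible (v 0).1 (v 0).2 by case: (Hv 0) => _ [_ []].
have pl u := @Ln_planar 0 u.
exists (freq mu); split; [|split].
- exact: (weighted_IET (HL 0) (HR 0) m2 m3 m5 (@Ln_letter 0)).
- exact: (weighted_regular (HL 0) (HR 0) m1 m2 m3 m4 m5 (@Ln_fac 0) (@Ln_letter 0) pl Lsp irr HA).
- have lang u := weighted_lang (HL 0) (HR 0) m1 m2 m3 m4 m5 (@Ln_fac 0) (@Ln_letter 0) pl u.
  move=> x; rewrite HX; split=> h u /h.
    by move/lang => [t [[t1 t2] t3]]; exists t.
  by case=> t [t1 [t2 t3]]; apply/lang; exists t.
Qed.
End Levels.

Theorem mainTheorem2 (A : finType) (S : morph A -> Prop) (a b : A)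
  (HA : 1 < #|A|) (Hab : a != b)
  (HS : forall s, S s -> dendric_return s)
  (X : biseq A -> Prop) (sg : nat -> morph A)
  (HX : shift_space X) (Hrep : S_adic_rep S X sg) :
  (coding_regular_IET X <->
     primitive_seq sg /\ exists v : nat -> vertex A, labels_path a b S sg v) /\
  (forall v : nat -> vertex A, primitive_seq sg -> labels_path a b S sg v ->
     coding_regular_IET_for X (v 0).2 (v 0).1).
Proof.
have back v : primitive_seq sg -> labels_path a b S sg v ->
    coding_regular_IET_for X (v 0).2 (v 0).1.
  move=> Hprim Hpath.
  have [w hw] : exists w : nat -> seq A, forall n, ret_word (sg n) (w n) /\
      left_valid (Gord (v n).1) (sg n) (Gord (v n.+1).1) /\
      right_valid (w n) (Gord (v n).2) (sg n) (Gord (v n.+1).2) /\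
      planar_morph (sg n) (w n) (v n).1 (v n).2 /\
      (planar_pres (sg n) (w n) (v n.+1).1 (v n.+1).2 (v n).1 (v n).2 \/
       planar_pres (sg n) (w n) (rev_order (v n.+1).1) (rev_order (v n.+1).2) (v n).1 (v n).2).
    have H n := proj2 (proj2 (Hpath n)).
    by case: (functional_choice _ H) => w hw; exists w.
  apply: (@levels_coding _ sg w HA Hprim _ a b v).
  - by move=> n; case: (hw n) => -[].
  - by move=> n; case: (Hpath n).
  - by move=> n; case: (hw n) => _ [].
  - by move=> n; case: (hw n) => _ [_ [_ []]].
  - by move=> n; case: (hw n) => _ [_ [_ []]].
  - by case: Hrep.
split=> //; split; first exact: (coding_path HA Hab HS Hrep).
by case=> Hprim [v hv]; exists (v 0).2, (v 0).1; apply: back.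
Qed.
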